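(* Let $n\ge 1$ be an integer and $\sigma>0$. Let $f:\mathbb{R}^n\to\mathbb{C}$ be the characteristic function of a probability measure $\mu$ on $\mathbb{R}^n$. Suppose that $\mu$ has a nonzero absolutely continuous part (with respect to Lebesgue measure on $\mathbb{R}^n$) with continuous density $\varphi$. If there exist $a\in\mathbb{R}^n$ and $\tau=(\tau_1,\dots,\tau_n)\in\mathbb{R}^n$ with $\tau_k>0$ for $k=1,\dots,n$, such that $$\tau_k\le \frac{2\pi}{\sigma}\quad\text{for } k=1,\dots,n$$ and $$(\operatorname{supp}\varphi)\cap\bigl(a+\tau\mathbb{Z}^n\bigr)=\emptyset,$$ then $f$ has the $\sigma$-deterministic property.
   Context: For a probability (Borel) measure $\mu$ on $\mathbb{R}^n$, its characteristic function is $\hat\mu(x)=\int_{\mathbb{R}^n}e^{-i(x,t)}\,d\mu(t)$, $x\in\mathbb{R}^n$, where $(x,t)=\sum_{k=1}^n x_kt_k$. A function on $\mathbb{R}^n$ is called a characteristic function if it is the characteristic function of some probability measure on $\mathbb{R}^n$. For $\sigma>0$ set $Q^n_\sigma=\{x\in\mathbb{R}^n: |x_k|\le\sigma,\ k=1,\dots,n\}$ and $V_\sigma=\mathbb{R}^n\setminus Q^n_\sigma$. A characteristic function $f$ on $\mathbb{R}^n$ has the $\sigma$-deterministic property if there is no characteristic function $g$ on $\mathbb{R}^n$ with $g\not\equiv f$ such that $f(x)=g(x)$ for all $x\in V_\sigma$. $\operatorname{supp}\varphi$ is the usual (closed) support of $\varphi$, i.e. the closure of $\{t\in\mathbb{R}^n:\varphi(t)\ne0\}$.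 For $a,\tau\in\mathbb{R}^n$, $a+\tau\mathbb{Z}^n=\{(a_1+\tau_1m_1,\dots,a_n+\tau_nm_n): m\in\mathbb{Z}^n\}$. *)

(* Defs.v *)
From HB Require Import structures.
From mathcomp Require Import all_boot all_order all_algebra.
From mathcomp Require Import all_classical all_reals all_analysis.
From mathcomp Require Import measurable_realfun.
From mathcomp Require Export complex.

Set Implicit Arguments.
Unset Strict Implicit.
Unset Printing Implicit Defensive.

Import Order.TTheory GRing.Theory Num.Theory.
Import numFieldNormedType.Exports.

Local Open Scope classical_set_scope.
Local Open Scope ring_scope.

(** R^n is ['rV[R]_n], with the sigma-algebra generated by the open sets. *)

Fact borel_mx_display : measure_display.
Proof. exact: default_measure_display. Qed.

Section borel_mx.
Variables (R : realType) (m n : nat).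

Definition borel_mx : set (set 'M[R]_(m, n)) := <<s open >>.

Let borel_mx0 : borel_mx set0.
Proof. exact: sigma_algebra0. Qed.

Let borel_mxC A : borel_mx A -> borel_mx (~` A).
Proof. exact: sigma_algebraC. Qed.

Let borel_mx_bigcup (F : (set 'M[R]_(m, n))^nat) :
  (forall i, borel_mx (F i)) -> borel_mx (\bigcup_i F i).
Proof. exact: sigma_algebra_bigcup. Qed.

HB.instance Definition _ := @isMeasurable.Build borel_mx_display
  'M[R]_(m, n) borel_mx borel_mx0 borel_mxC borel_mx_bigcup.

End borel_mx.

Section rV_measurability.
Variables (R : realType) (n : nat).

Lemma open_measurable_rV (U : set 'rV[R]_n) : open U -> measurable U.
Proof. by move=> oU; exact: sub_sigma_algebra. Qed.

Lemma measurable_coord_rV (i : 'I_n) :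
  measurable_fun setT (fun x : 'rV[R]_n => x 0 i).
Proof.
apply: (measurability _ (measurable_realfun.RGenOpens.measurableE R)).
move=> _ [_ [a [b ->]] <-]; rewrite setTI; apply: open_measurable_rV.
by apply: open_comp => [x _|]; [exact: coord_continuous|exact: itv_open].
Qed.

Lemma measurable_fun_rVP d (T : measurableType d) (f : T -> 'rV[R]_n) :
  (forall i, measurable_fun setT (fun t => f t 0 i)) -> measurable_fun setT f.
Proof.
move=> mf; apply: (measurability (@open 'rV[R]_n) erefl) => // _ [U oU <-]; rewrite setTI.
pose e (p : 'rV[rat]_n * nat) : R := p.2.+1%:R^-1.
pose B (p : 'rV[rat]_n * nat) : set 'rV[R]_n :=
  [set x | forall i, ball (ratr (p.1 0 i) : R) (e p) (x 0 i)].
have -> : f @^-1` U = \bigcup_(p in [set p | B p `<=` U])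
    \bigcap_(i in [set: 'I_n]) ((fun t => f t 0 i) @^-1` ball (ratr (p.1 0 i) : R) (e p)).
  rewrite eqEsubset; split => [t /= Uft|t [p BU ft]]; last first.
    by apply: BU => i; exact: ft.
  have /nbhs_ballP[r /= r0 rU] : nbhs (f t) U by exact: open_nbhs_nbhs.
  have r20 : 0 < r / 2 by rewrite divr_gt0.
  have [k _ /(_ _ (leqnn _)) kr] : \forall k \near \oo, k.+1%:R^-1 < r / 2.
    exact: near_infty_natSinv_lt (PosNum r20).
  have /choice[q qP] : forall i, exists q : rat, `|f t 0 i - ratr q| < k.+1%:R^-1 :> R.
    move=> i.
    have /rat_in_itvoo[q] : f t 0 i - k.+1%:R^-1 < f t 0 i + k.+1%:R^-1 :> R.
      by rewrite ltrD2l gtrN// invr_gt0.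
    rewrite in_itv /= => /andP[q1 q2]; exists q.
    by rewrite ltr_distlC q1.
  exists (\row_i q i, k) => /= [x Bx|i _ /=]; last first.
    by rewrite mxE /ball /= distrC.
  apply: rU; split => // j i; rewrite ord1 /ball /=.
  have := Bx i; rewrite mxE /ball /= => qx.
  rewrite (splitr r); apply: (@le_lt_trans _ _ (`|f t 0 i - ratr (q i)| + `|ratr (q i) - x 0 i|)).
    by rewrite -[X in `|X|](subrKA (ratr (q i))) ler_normD.
  apply: ltrD; first exact: lt_trans (qP i) kr.
  exact: lt_trans qx kr.
rewrite (_ : bigcup _ _ = \bigcup_k
    (if unpickle k is Some p then
       if `[< B p `<=` U >] then \bigcap_(i in [set: 'I_n])
         ((fun t => f t 0 i) @^-1` ball (ratr (p.1 0 i) : R) (e p))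
       else set0
     else set0)); last first.
  rewrite eqEsubset; split=> [t [p /= BU ft]|t [k _]].
    by exists (pickle p) => //; rewrite pickleK asboolT.
  case: (unpickle k) => // p; case: ifPn => // /asboolP BU ft.
  by exists p.
apply: bigcupT_measurable => k.
case: (unpickle k) => [p|]; last exact: measurable0.
case: ifPn => _; last exact: measurable0.
apply: fin_bigcap_measurable => // i _.
rewrite -[X in measurable X]setTI; apply: mf => //.
exact: measurable_ball.
Qed.

End rV_measurability.

(** Lebesgue measure on R^n is the n-fold product of the one on R;
    [lebesgue_rV_box] checks its normalization on boxes. *)

Section lebesgue_rV.
Variable R : realType.

Definition cons_rV n (z : R * 'rV[R]_n) : 'rV[R]_n.+1 :=
  row_mx (z.1%:M : 'rV_1) z.2.

Lemma cons_rV0 n (z : R * 'rV[R]_n) : cons_rV z 0 ord0 = z.1.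
Proof.
rewrite mxE; case: splitP => [j _|j /eqP//]; by rewrite ord1 mxE.
Qed.

Lemma cons_rV_lift n (z : R * 'rV[R]_n) i :
  cons_rV z 0 (lift ord0 i) = z.2 0 i.
Proof.
rewrite mxE; case: splitP => [j|j]; rewrite lift0; first by rewrite ord1.
by move=> [/val_inj ->].
Qed.

Lemma measurable_cons_rV n : measurable_fun setT (@cons_rV n).
Proof.
apply: measurable_fun_rVP => i; case: (unliftP ord0 i) => [j ->|->].
  under eq_fun do rewrite cons_rV_lift.
  exact: (measurableT_comp (measurable_coord_rV j) measurable_snd).
by under eq_fun do rewrite cons_rV0; exact: measurable_fst.
Qed.

Definition uncons_rV n (x : 'rV[R]_n.+1) : R * 'rV[R]_n :=
  (x 0 ord0, \row_i x 0 (lift ord0 i)).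

Lemma cons_rVK n : cancel (@cons_rV n) (@uncons_rV n).
Proof.
move=> z; rewrite /uncons_rV cons_rV0 [RHS]surjective_pairing; congr pair.
by apply/rowP => i; rewrite mxE cons_rV_lift.
Qed.

Lemma measurable_uncons_rV n : measurable_fun setT (@uncons_rV n).
Proof.
apply: measurable_fun_pair; first exact: measurable_coord_rV.
apply: measurable_fun_rVP => i; under eq_fun do rewrite mxE.
exact: measurable_coord_rV.
Qed.

Section succ.
Variables (n : nat) (m : {sigma_finite_measure set 'rV[R]_n -> \bar R}).

Definition lebesgue_rV_succ : set 'rV[R]_n.+1 -> \bar R :=
  pushforward (@lebesgue_measure R \x m)%E (@cons_rV n).

Let lebesgue_rV_succ0 : lebesgue_rV_succ set0 = 0%E.
Proof. by rewrite /lebesgue_rV_succ measure0//; exact: measurable_cons_rV. Qed.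

Let lebesgue_rV_succ_ge0 A : (0 <= lebesgue_rV_succ A)%E.
Proof. by rewrite /lebesgue_rV_succ measure_ge0//; exact: measurable_cons_rV. Qed.

Let lebesgue_rV_succ_sigma_additive : semi_sigma_additive lebesgue_rV_succ.
Proof. apply: measure_semi_sigma_additive; exact: measurable_cons_rV. Qed.

HB.instance Definition _ := isMeasure.Build _ _ _ lebesgue_rV_succ
  lebesgue_rV_succ0 lebesgue_rV_succ_ge0 lebesgue_rV_succ_sigma_additive.

Let lebesgue_rV_succ_sigma_finite : sigma_finite setT lebesgue_rV_succ.
Proof.
have [F FT mF] : sigma_finite setT (@lebesgue_measure R \x m)%E.
  have /sigma_finiteP[F [FT ndF Foo]] := sigma_finiteT (@lebesgue_measure R).
  have /sigma_finiteP[G [GT ndG Goo]] := sigma_finiteT m.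
  exists (fun k => F k `*` G k).
    rewrite -setXTT FT GT; apply/seteqP; split=> [[x y] [[i _ Fx] [j _ Gy]]|].
      exists (maxn i j) => //; split.
        by move: Fx; apply/subsetPset/ndF/leq_maxl.
      by move: Gy; apply/subsetPset/ndG/leq_maxr.
    by move=> [x y] [k _ [Fx Gy]]; split; exists k.
  move=> k; have [? ?] := Foo k; have [? ?] := Goo k.
  split; first exact: measurableX.
  by rewrite product_measure1E// lte_mul_pinfty// ge0_fin_numE.
exists (fun k => @uncons_rV n @^-1` F k).
  by rewrite -preimage_bigcup -FT preimage_setT.
move=> k; have [mFk Fk] := mF k; split.
  rewrite -[X in measurable X]setTI; exact: measurable_uncons_rV.
rewrite /lebesgue_rV_succ /pushforward -comp_preimage.
by rewrite (_ : _ \o _ = id) // funeqE => z /=; rewrite cons_rVK.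
Qed.

HB.instance Definition _ := Measure_isSigmaFinite.Build _ _ _
  lebesgue_rV_succ lebesgue_rV_succ_sigma_finite.

End succ.

Fixpoint lebesgue_rV n : {sigma_finite_measure set 'rV[R]_n -> \bar R} :=
  if n is n'.+1 then lebesgue_rV_succ (lebesgue_rV n')
  else @dirac _ 'rV[R]_0 (const_mx 0) R.

Lemma lebesgue_rV_box n (a b : 'rV[R]_n) : (forall k, a 0 k <= b 0 k) ->
  lebesgue_rV n [set x : 'rV[R]_n | forall k, a 0 k <= x 0 k <= b 0 k] =
  (\prod_k (b 0 k - a 0 k))%:E.
Proof.
elim: n a b => [|n IHn] a b ab.
  by rewrite /= diracE big_ord0 mem_set// => -[].
rewrite big_ord_recl EFinM.
pose s (c : 'rV[R]_n.+1) := (uncons_rV c).2.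
have sE c i : s c 0 i = c 0 (lift ord0 i) by rewrite mxE.
transitivity ((@lebesgue_measure R \x lebesgue_rV n)%E
  (`[a 0 ord0, b 0 ord0] `*`
   [set x : 'rV[R]_n | forall k, s a 0 k <= x 0 k <= s b 0 k])).
  congr (product_measure1 _ _ _); apply/seteqP; split=> [z /= abz|z /= [z1 z2] k].
    split; first by have := abz ord0; rewrite cons_rV0 in_itv.
    by move=> k; have := abz (lift ord0 k); rewrite cons_rV_lift !sE.
  case: (unliftP ord0 k) => [j ->|->]; first by rewrite cons_rV_lift -!sE.
  by rewrite cons_rV0; move: z1; rewrite in_itv.
rewrite product_measure1E//; last first.
  rewrite (_ : mkset _ = \bigcap_(k in [set: 'I_n])
     ((fun x : 'rV[R]_n => x 0 k) @^-1` `[s a 0 k, s b 0 k])); last first.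
    by apply/seteqP; split=> x /= H k; [move=> _ /=|];
      have := H k; rewrite /= in_itv//; exact.
  apply: fin_bigcap_measurable => // k _.
  by rewrite -[X in measurable X]setTI; exact: measurable_coord_rV.
rewrite IHn; last by move=> k; rewrite !sE.
rewrite [X in (X * _)%E]lebesgue_measure_itv/= lte_fin -EFinB; congr (_ * _)%E.
  case: ltP => // ba; suff -> : b 0 ord0 = a 0 ord0 by rewrite subrr.
  by apply/eqP; rewrite eq_le ba ab.
by congr EFin; apply: eq_bigr => k _; rewrite !sE.
Qed.

End lebesgue_rV.

Section sigma_determinism.
Variables (R : realType) (n : nat).
Implicit Types (x t a tau : 'rV[R]_n) (f g : 'rV[R]_n -> R[i]).

Definition dotrv x t : R := \sum_k x 0 k * t 0 k.

Definition expi (r : R) : R[i] := (cos r +i* sin r)%C.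

Definition cintegral (mu : probability 'rV[R]_n R) (F : 'rV[R]_n -> R[i]) :
    R[i] :=
  (\int[mu]_t complex.Re (F t) +i* \int[mu]_t complex.Im (F t))%C.

Definition charfun (mu : probability 'rV[R]_n R) x : R[i] :=
  cintegral mu (fun t => expi (- dotrv x t)).

Definition is_charfun f :=
  exists mu : probability 'rV[R]_n R, forall x, f x = charfun mu x.

Definition cube (sigma : R) : set 'rV[R]_n :=
  [set x | forall k, `|x 0 k| <= sigma].

Definition sigma_deterministic (sigma : R) f :=
  ~ exists g, [/\ is_charfun g, ~ (forall x, g x = f x) &
                  forall x, (~` cube sigma) x -> f x = g x].

Definition lebesgue_decomposition (mu : probability 'rV[R]_n R)
    (mu_ac mu_s : {measure set 'rV[R]_n -> \bar R}) :=
  [/\ forall A, measurable A -> mu A = (mu_ac A + mu_s A)%E,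
      mu_ac `<< lebesgue_rV R n &
      exists N, [/\ measurable N, lebesgue_rV R n N = 0%E & mu_s (~` N) = 0%E]].

Definition has_density (nu : {measure set 'rV[R]_n -> \bar R}) (phi : 'rV[R]_n -> R) :=
  forall A, measurable A ->
    nu A = (\int[lebesgue_rV R n]_(t in A) (phi t)%:E)%E.

Definition supp (phi : 'rV[R]_n -> R) : set 'rV[R]_n :=
  closure [set t | phi t != 0].

Definition shifted_lattice a tau : set 'rV[R]_n :=
  [set x | exists m : 'rV[int]_n,
     forall k, x 0 k = a 0 k + tau 0 k * (m 0 k)%:~R].

End sigma_determinism.

(* Main.v *)
From HB Require Import structures.
Require Import Defs.
From mathcomp Require Import all_boot all_order all_algebra.
From mathcomp Require Import all_classical all_reals all_analysis.
From mathcomp Require Import measurable_realfun.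
From mathcomp Require Import complex ring lra.

Import Order.TTheory GRing.Theory Num.Theory.
Import numFieldNormedType.Exports.

Local Open Scope classical_set_scope.
Local Open Scope ring_scope.

Set Implicit Arguments.
Unset Strict Implicit.
Unset Printing Implicit Defensive.

(** Let mu and nu be probability measures whose characteristic functions agree off
    the cube of side 2 sigma, and let h = A - i B be the difference of these
    functions.  It is continuous, vanishes off the cube and vanishes at the origin,
    where both characteristic functions equal 1.  The proof has three parts.

    Inversion.  Since h is bounded with bounded support, mu - nu has the density
    u / (2 pi)^n with respect to Lebesgue measure, where u(s) is the integral over the
    cube of A(x) cos(x.s) + B(x) sin(x.s); lemma [box_inversion] obtains this on
    boxes, by mollifying their indicators with products of Poisson kernels, which
    are the Fourier transforms of Laplace kernels.  On a box where phi = 0, the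
    part of mu off a null set carrying its singular part is 0, so that
    mu - nu = - nu <= 0 off this null set.  As u is continuous, u <= 0 on the box
    ([density_diff_le0]).  The support of phi is closed and misses the lattice
    L = a + tau Z^n; hence u <= 0 in a neighbourhood of each point of L.

    From a sign to identical vanishing.  The Fejer means of u over the points of
    L converge to the sum of h, twisted by a character, over the dual lattice
    with steps 2 pi / tau_k >= sigma.  All points of the dual lattice but the origin
    are off the interior of the cube, so that h vanishes there, and h also vanishes
    at the origin: the limit is 0.  As all terms of the means are nonpositive, u = 0
    on L ([fint_lattice_eq0]).  Next, u is shown to vanish on the points whose
    coordinates of index >= j belong to the lattice, by induction on j.  If this
    holds for j, each such point near L is a local maximum of u in direction j, so
    the j-th partial derivative of u vanishes there; being analytic, as a Fourier
    integral over a bounded set ([osc_flat]), this derivative vanishes on the whole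
    slice.  So on a line in direction j, with its later coordinates in the lattice,
    u has double zeros along an arithmetic progression of step
    tau_j <= 2 pi / sigma.  Its frequencies along the line lie in [- P, P] with
    P = 2 pi / tau_j >= sigma.  For y in ]0, P[, the waves of frequencies y and y - P
    take proportional values on the progression, and no other frequency of the open
    interval does; a second condition, given by the derivatives in which they are
    weighted by y and y - P, separates the two.  The values and derivatives of u on
    the progression thus determine u on the line ([osc_double_zeros]), where it
    therefore vanishes; after n steps u = 0 everywhere ([fint_eq0]).

    Conclusion.  If u = 0 then mu and nu agree on the open boxes, a family that is
    stable under intersection and generates the Borel sets, so that mu = nu
    ([density_diff_eq0]). *)

(** * Integrals of bounded functions over sets of finite measure *)

Lemma integral_integrable_EFin {R : realType} d (T : measurableType d)
    (m : {measure set T -> \bar R}) D (f : T -> R) :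
  measurable D -> m.-integrable D (EFin \o f) ->
  (\int[m]_(x in D) (f x)%:E)%E = (\int[m]_(x in D) f x)%:E.
Proof. by move=> mD If; rewrite /Rintegral fineK//; exact: integrable_fin_num. Qed.

Section bounded_integrals.
Context {R : realType} d {T : measurableType d} (m : {measure set T -> \bar R}).
Variable D : set T.
Hypothesis mD : measurable D.
Hypothesis mDoo : (m D < +oo)%E.

Lemma bounded_integrable (f : T -> R) M : measurable_fun D f ->
  (forall x, D x -> `|f x| <= M) -> m.-integrable D (EFin \o f).
Proof.
move=> mf fM; apply: measurable_bounded_integrable => //.
exists M; split; first exact: num_real.
by move=> y My x Dx /=; apply: (le_trans (fM _ Dx)); exact: ltW.
Qed.

Lemma integral_EFin_Rintegral (f : T -> R) M : measurable_fun D f ->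
  (forall x, D x -> `|f x| <= M) ->
  (\int[m]_(x in D) (f x)%:E)%E = (\int[m]_(x in D) f x)%:E.
Proof.
by move=> mf fM; apply: integral_integrable_EFin => //; exact: bounded_integrable mf fM.
Qed.

Lemma norm_Rintegral_le (f : T -> R) M : measurable_fun D f ->
  (forall x, D x -> `|f x| <= M) ->
  `|\int[m]_(x in D) f x| <= M * fine (m D).
Proof.
move=> mf fM; have intf := bounded_integrable mf fM.
apply: (le_trans (le_normr_Rintegral mD intf)).
rewrite -Rintegral_cst//; apply: le_Rintegral => //.
  by rewrite (_ : EFin \o _ = abse \o (EFin \o f)) //; exact: integrable_abse.
exact: (@bounded_integrable (cst M) `|M|).
Qed.

Lemma Rintegral_sum (I : Type) (s : seq I) (f : I -> T -> R) :
  (forall i, m.-integrable D (EFin \o f i)) ->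
  \int[m]_(x in D) (\sum_(i <- s) f i x) = \sum_(i <- s) \int[m]_(x in D) f i x.
Proof.
move=> intf; have mf i : measurable_fun D (f i).
  by apply/measurable_EFinP; exact: measurable_int (intf i).
elim: s => [|i s IH].
  rewrite big_nil; under eq_Rintegral do rewrite big_nil.
  by rewrite Rintegral_cst// mul0r.
rewrite big_cons -IH -RintegralD//; first by apply: eq_Rintegral => x _; rewrite big_cons.
rewrite (_ : _ \o _ = (fun x => \sum_(j <- s) (f j x)%:E)%E); last first.
  by apply/funext => x /=; rewrite sumEFin.
by apply: integrable_sum => // k _; exact: intf.
Qed.

Lemma Rintegral_cvg_ae (f_ : nat -> T -> R) (f : T -> R) M :
  (forall n, measurable_fun D (f_ n)) -> measurable_fun D f ->
  (forall n x, D x -> `|f_ n x| <= M) ->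
  {ae m, forall x, D x -> f_ n x @[n --> \oo] --> f x} ->
  \int[m]_(x in D) f_ n x @[n --> \oo] --> \int[m]_(x in D) f x.
Proof.
move=> mf_ mf fM cf.
have [| | | | |/= i_f _ +] := @dominated_convergence _ _ _ m D mD
  (fun n => EFin \o f_ n) (EFin \o f) (EFin \o cst M).
- by move=> n; apply/measurable_EFinP.
- exact/measurable_EFinP.
- case: cf => N [mN N0 sN]; exists N; split => //.
  apply: subset_trans sN; apply: subsetC => x /= h Dx.
  by apply: cvg_EFin; [exact: nearW|exact: h].
- exact: (@bounded_integrable (cst M) `|M|).
- by apply/aeW => x n Dx /=; rewrite lee_fin; exact: fM.
rewrite /Rintegral => h; apply: fine_cvg; rewrite fineK; first exact: h.
exact: integrable_fin_num.
Qed.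

Lemma Rintegral_cvg (f_ : nat -> T -> R) (f : T -> R) M :
  (forall n, measurable_fun D (f_ n)) ->
  (forall n x, D x -> `|f_ n x| <= M) ->
  (forall x, D x -> f_ n x @[n --> \oo] --> f x) ->
  \int[m]_(x in D) f_ n x @[n --> \oo] --> \int[m]_(x in D) f x.
Proof.
move=> mf_ fM cf; apply: (@Rintegral_cvg_ae f_ f M) => //.
  exact: measurable_fun_cvg cf.
exact: aeW.
Qed.

(** Sequential continuity suffices in a normed space, so a parametric integral
    is continuous as soon as dominated convergence applies. *)
Lemma continuous_Rintegral (V : normedModType R) (f : V -> T -> R) M :
  (forall v, measurable_fun D (f v)) ->
  (forall v x, D x -> `|f v x| <= M) ->
  (forall x, D x -> continuous (f ^~ x)) ->
  continuous (fun v => \int[m]_(x in D) f v x).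
Proof.
move=> mf fM cf v; apply/cvgrPdist_lt => e e0; apply/nbhs_ballP.
apply: contrapT => h.
have {}h n : exists w, `|v - w| < n.+1%:R^-1 /\
    e <= `|\int[m]_(x in D) f v x - \int[m]_(x in D) f w x|.
  apply: contrapT => h'; apply: h; exists n.+1%:R^-1; first by rewrite /= invr_gt0 ltr0n.
  move=> w; rewrite /= -ball_normE/= => vw; rewrite ltNge; apply/negP => ew.
  by apply: h'; exists w.
have [w wP] := choice h.
have cw : w n @[n --> \oo] --> v.
  apply/cvgrPdist_lt => r r0.
  have := near_infty_natSinv_lt (PosNum r0); apply: filterS => n /=.
  exact: lt_trans (wP n).1.
have : \int[m]_(x in D) f (w n) x @[n --> \oo] --> \int[m]_(x in D) f v x.
  apply: (@Rintegral_cvg _ _ M) => [n|n x|x Dx]; [exact: mf|exact: fM|].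
  have := cvg_comp w (f ^~ x) cw (cf x Dx v); exact.
move=> /cvgrPdist_lt/(_ _ e0)[N _ /(_ N (leqnn N))] /=.
by rewrite ltNge (wP N).2.
Qed.

End bounded_integrals.

(** * Oscillatory integrals *)

Lemma norm_trig_le (R : realType) (a b t C : R) : `|a| <= C -> `|b| <= C ->
  `|a * cos t + b * sin t| <= C *+ 2.
Proof.
move=> aC bC; apply: (le_trans (ler_normD _ _)); rewrite mulr2n !normrM.
have C0 : 0 <= C by exact: le_trans aC.
have cos1 : `|cos t| <= 1 by rewrite ler_norml cos_geN1 cos_le1.
have sin1 : `|sin t| <= 1 by rewrite ler_norml sin_geN1 sin_le1.
by apply: lerD; rewrite -[leRHS]mulr1; apply: ler_pM.
Qed.

Lemma is_derive_trig (R : realType) (a b y s : R) :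
  is_derive s 1 (fun s => a * cos (s * y) + b * sin (s * y))
    (y * b * cos (s * y) + (- (y * a)) * sin (s * y)).
Proof.
have h : is_derive s 1 (fun s : R => s * y) y.
  by apply: is_derive_eq; rewrite scaler0 add0r /GRing.scale/= mulr1.
have hc : is_derive s 1 (fun s : R => cos (s * y)) (- sin (s * y) * y).
  by apply: (@is_derive1_comp _ cos (fun s => s * y)).
have hs : is_derive s 1 (fun s : R => sin (s * y)) (cos (s * y) * y).
  by apply: (@is_derive1_comp _ sin (fun s => s * y)).
apply: is_derive_eq; rewrite /GRing.scale/=; ring.
Qed.

Section oscillatory.
Context {R : realType} d {T : measurableType d} (m : {measure set T -> \bar R}).
Variable D : set T.
Hypothesis mD : measurable D.
Hypothesis mDoo : (m D < +oo)%E.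
Variable y : T -> R.
Hypothesis my : measurable_fun D y.
Variable M : R.
Hypothesis yM : forall x, D x -> `|y x| <= M.

(** The real part of the Fourier integral of the weight A - iB along y. *)
Definition osc (A B : T -> R) (s : R) : R :=
  \int[m]_(x in D) (A x * cos (s * y x) + B x * sin (s * y x)).

Lemma measurable_osc (A B : T -> R) s : measurable_fun D A -> measurable_fun D B ->
  measurable_fun D (fun x => A x * cos (s * y x) + B x * sin (s * y x)).
Proof.
move=> mA mB; apply: measurable_funD; apply: measurable_funM => //;
  (apply: measurableT_comp; last exact: measurable_funM);
  apply: continuous_measurable_fun.
  exact: continuous_cos.
exact: continuous_sin.
Qed.

Lemma norm_osc_le (A B : T -> R) (C s : R) :
  measurable_fun D A -> measurable_fun D B ->
  (forall x, D x -> `|A x| <= C) -> (forall x, D x -> `|B x| <= C) ->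
  `|osc A B s| <= C *+ 2 * fine (m D).
Proof.
move=> mA mB AC BC; apply: norm_Rintegral_le => //; first exact: measurable_osc.
by move=> x Dx; apply: norm_trig_le; [exact: AC|exact: BC].
Qed.

Lemma is_derive_osc (A B : T -> R) (C s : R) :
  measurable_fun D A -> measurable_fun D B ->
  (forall x, D x -> `|A x| <= C) -> (forall x, D x -> `|B x| <= C) ->
  is_derive s 1 (osc A B)
    (osc (fun x => y x * B x) (fun x => - (y x * A x)) s).
Proof.
move=> mA mB AC BC.
pose f (s : R) x := A x * cos (s * y x) + B x * sin (s * y x).
have fE s' x : partial1of2 f s' x =
    y x * B x * cos (s' * y x) + (- (y x * A x)) * sin (s' * y x).
  by rewrite partial1of2E; have := is_derive_trig (A x) (B x) (y x) s' => -[_ <-].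
have intf s' : m.-integrable D (EFin \o f s').
  apply: (@bounded_integrable _ _ _ _ _ mD mDoo _ (C *+ 2)); first exact: measurable_osc.
  by move=> x Dx; apply: norm_trig_le; [exact: AC|exact: BC].
have Is : `]s - 1, s + 1[%classic s by rewrite /= in_itv/= ltrBlDr !ltrDl ltr01.
pose G (_ : T) : R := `|M * C| *+ 2.
have iG : m.-integrable D (EFin \o G).
  apply: (@bounded_integrable _ _ _ _ _ mD mDoo _ (`| `|M * C| *+ 2 |)).
    exact: measurable_cst.
  by move=> x _; exact: lexx.
have G0 x : 0 <= G x by rewrite /G mulrn_wge0.
have Gub s' x : `]s - 1, s + 1[%classic s' -> D x -> `|partial1of2 f s' x| <= G x.
  move=> _ Dx; rewrite fE; apply: norm_trig_le; rewrite ?normrN normrM.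
    by rewrite normrM ler_pM// (le_trans _ (ler_norm _))// ?yM// BC.
  by rewrite normrM ler_pM// (le_trans _ (ler_norm _))// ?yM// AC.
have df s' x : `]s - 1, s + 1[%classic s' -> D x -> derivable (f ^~ x) s' 1.
  by move=> _ _; have := is_derive_trig (A x) (B x) (y x) s' => -[].
apply: DeriveDef.
  by apply: (@derivable_under_integral _ _ _ _ f _ mD _ _ _ Is _ df G).
rewrite -derive1E (@differentiation_under_integral _ _ _ _ f _ mD _ _ _ Is _ df G)//.
by apply: eq_Rintegral => x _; rewrite fE.
Qed.

End oscillatory.

Section flat.
Context {R : realType} d {T : measurableType d} (m : {measure set T -> \bar R}).
Variable D : set T.
Hypothesis mD : measurable D.
Hypothesis mDoo : (m D < +oo)%E.
Variable y : T -> R.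
Hypothesis my : measurable_fun D y.
Variable M : R.
Hypothesis yM : forall x, D x -> `|y x| <= M.
Variables (A B : T -> R) (C : R).
Hypotheses (mA : measurable_fun D A) (mB : measurable_fun D B).
Hypotheses (AC : forall x, D x -> `|A x| <= C) (BC : forall x, D x -> `|B x| <= C).

(** Differentiating in s multiplies the weight A - iB by iy. *)
Fixpoint osc_weights k : (T -> R) * (T -> R) :=
  if k is k'.+1 then
    (fun x => y x * (osc_weights k').2 x, fun x => - (y x * (osc_weights k').1 x))
  else (A, B).

Let G k := osc m D y (osc_weights k).1 (osc_weights k).2.
Let K : R := `|M| + 1.

Let K_gt0 : 0 < K. Proof. by rewrite ltr_wpDl. Qed.

Let weightsP k : [/\ measurable_fun D (osc_weights k).1,
  measurable_fun D (osc_weights k).2,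
  forall x, D x -> `|(osc_weights k).1 x| <= K ^+ k * C &
  forall x, D x -> `|(osc_weights k).2 x| <= K ^+ k * C].
Proof.
elim: k => [|k [m1 m2 b1 b2]] /=.
  by split => // x Dx; rewrite expr0 mul1r; [exact: AC|exact: BC].
have yK x : D x -> `|y x| <= K.
  by move=> Dx; rewrite (le_trans (yM Dx))// (le_trans (ler_norm _))// lerDl.
split.
- exact: measurable_funM.
- by apply: measurableT_comp => //; exact: measurable_funM.
- by move=> x Dx; rewrite normrM exprS -mulrA ler_pM// ?yK// b2.
- by move=> x Dx; rewrite normrN normrM exprS -mulrA ler_pM// ?yK// b1.
Qed.

Let dG k (s : R) : is_derive s 1 (G k) (G k.+1 s).
Proof.
have [m1 m2 b1 b2] := weightsP k.
exact: (is_derive_osc mD mDoo my yM s m1 m2 b1 b2).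
Qed.

Let continuous_G k : continuous (G k).
Proof.
by move=> s; apply: differentiable_continuous; apply/derivable1_diffP; have [] := dG k s.
Qed.

Let G_MVT k (a b r : R) : `|b - a| <= r ->
  exists2 c, `|c - a| <= r & `|G k b - G k a| = `|G k.+1 c| * `|b - a|.
Proof.
have cG x z : {within `[x, z], continuous (G k)}.
  exact/continuous_subspaceT/continuous_G.
case: (leP a b) => ab abr.
  have [c + E] := MVT_segment ab (fun x _ => dG k x) (cG a b).
  rewrite in_itv/= => /andP[ac cb]; exists c; last by rewrite E normrM.
  by rewrite ger0_norm ?subr_ge0// (le_trans _ abr)// ger0_norm ?subr_ge0// lerB.
have [c + E] := MVT_segment (ltW ab) (fun x _ => dG k x) (cG b a).
rewrite in_itv/= => /andP[bc ca]; exists c.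
  rewrite distrC ger0_norm ?subr_ge0// (le_trans _ abr)// distrC.
  by rewrite ger0_norm ?subr_ge0 ?lerB// ltW.
by rewrite distrC E normrM (distrC b a).
Qed.

(** The bounds |G k| <= E K^k on the derivatives make the radius of convergence
    of the Taylor series infinite. Iterating the mean value theorem on an
    interval of length 1/(2K) gains a factor 1/2 each time. *)
Let flat_step (s0 s : R) : (forall k, G k s0 = 0) -> `|s - s0| <= (K *+ 2)^-1 ->
  forall k, G k s = 0.
Proof.
move=> G0 ss0 k.
pose E : R := `|C *+ 2 * fine (m D)|.
have bound j : forall k s, `|s - s0| <= (K *+ 2)^-1 ->
    `|G k s| <= E * K ^+ k * 2^-1 ^+ j.
  elim: j => [|j IH] {}k {}s {}ss0.
    have [m1 m2 b1 b2] := weightsP k.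
    rewrite expr0 mulr1 (le_trans (norm_osc_le mD mDoo my s m1 m2 b1 b2))//.
    have -> : (K ^+ k * C) *+ 2 * fine (m D) = (C *+ 2 * fine (m D)) * K ^+ k by ring.
    by rewrite ler_wpM2r ?exprn_ge0 ?ler_norm// ltW.
  have [c cs0] := G_MVT k ss0; rewrite G0 subr0 => ->.
  apply: (@le_trans _ _ ((E * K ^+ k.+1 * 2^-1 ^+ j) * (K *+ 2)^-1)).
    by apply: ler_pM => //; exact: IH.
  rewrite -mulr_natr invfM// exprS exprSr.
  rewrite le_eqVlt; apply/orP; left; apply/eqP; field.
  by rewrite gt_eqF.
apply/normr0_eq0/eqP; rewrite eq_le normr_ge0 andbT.
have : geometric (E * K ^+ k) (2^-1 : R) n @[n --> \oo] --> 0.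
  by apply: cvg_geometric; rewrite ger0_norm ?invr_ge0// invf_lt1// ltr1n.
move=> /cvgr_to_ge; apply; apply: nearW => n; exact: bound.
Qed.

(** A Fourier integral along a bounded phase is entire, so it vanishes
    identically once it vanishes on an interval. *)
Lemma osc_flat (r : R) : 0 < r -> (forall s, `|s| < r -> osc m D y A B s = 0) ->
  forall s, osc m D y A B s = 0.
Proof.
move=> r0 G0.
have Gk k : forall s, `|s| < r -> G k s = 0.
  elim: k => // k IH s sr; have [_ <-] := dG k s.
  rewrite -(derive_cst (0 : R) s 1) ; apply: near_eq_derive.
  have : \forall t \near s, `|t| < r.
    by apply: (@cvgr_norm_lt _ _ _ (nbhs s) _ id s) => //; exact: cvg_id.
  by apply: filterS => t tr; rewrite IH.
have K20 : 0 < (K *+ 2)^-1 by rewrite invr_gt0 mulrn_wgt0.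
have Gi i : forall s, `|s| <= i%:R * (K *+ 2)^-1 -> forall k, G k s = 0.
  elim: i => [|i IH] s.
    by rewrite mul0r normr_le0 => /eqP -> k; apply: Gk; rewrite normr0.
  move=> si.
  have i0 : 0 < i.+1%:R :> R by rewrite ltr0n.
  have si' : `|s| / i.+1%:R <= (K *+ 2)^-1 by rewrite ler_pdivrMr// mulrC.
  apply: (@flat_step (s * (i%:R / i.+1%:R))).
    apply: IH; rewrite normrM [X in _ * X]ger0_norm ?divr_ge0 ?ler0n//.
    by rewrite mulrCA ler_wpM2l.
  have -> : s - s * (i%:R / i.+1%:R) = s / i.+1%:R.
    by rewrite -natr1; field; rewrite natr1 pnatr_eq0.
  by rewrite normrM normfV [X in _ / X]ger0_norm// ltW.
move=> s; pose i := (Num.truncn (`|s| * (K *+ 2))).+1.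
apply: (Gi i _ _ 0%N); rewrite ler_pdivlMr ?mulrn_wgt0//.
by apply: ltW; exact: truncnS_gt.
Qed.

End flat.

(** * The Fejer kernel *)

Section fejer.
Variable R : realType.
Implicit Types (x t : R) (N : nat).

(** Written as a square modulus, so that positivity is visible; [fejerE] gives the
    expansion into characters. *)
Definition fejer N t : R :=
  N%:R^-1 * ((\sum_(j < N) cos (j%:R * t)) ^+ 2 + (\sum_(j < N) sin (j%:R * t)) ^+ 2).

Lemma fejer_ge0 N t : 0 <= fejer N t.
Proof. by rewrite mulr_ge0 ?invr_ge0// addr_ge0 ?sqr_ge0. Qed.

Lemma fejerE N t :
  fejer N t = \sum_(j < N) \sum_(k < N) N%:R^-1 * cos ((j%:R - k%:R) * t).
Proof.
rewrite /fejer !expr2 !mulr_suml -big_split/= mulr_sumr; apply: eq_bigr => j _.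
rewrite !mulr_sumr -big_split/= mulr_sumr; apply: eq_bigr => k _.
by rewrite mulrBl cosB.
Qed.

(** Summing the geometric progression gives
    (2 - 2 cos t) |sum_(j < N) e^(ijt)|^2 = |1 - e^(iNt)|^2 <= 4. *)
Lemma fejer_decay N t : (2 - 2 * cos t) * fejer N t <= 4 / N%:R.
Proof.
rewrite /fejer mulrCA [leRHS]mulrC; apply: ler_wpM2l; first by rewrite invr_ge0.
set C := \sum_(j < N) _; set S := \sum_(j < N) sin _.
have [EC ES] : (1 - cos t) * C + sin t * S = 1 - cos (N%:R * t) /\
    (1 - cos t) * S - sin t * C = - sin (N%:R * t).
  rewrite /C /S; elim: N {C S} => [|N [IC IS]].
    by rewrite !big_ord0 mul0r cos0 sin0 !mulr0 subrr addr0 subr0 oppr0.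
  rewrite !big_ord_recr/= (_ : N.+1%:R * t = N%:R * t + t); last by rewrite -natr1; ring.
  rewrite cosD sinD.
  set c := \sum_(i < N) cos _ in IC IS *; set s := \sum_(i < N) sin _ in IC IS *.
  split.
  - transitivity (((1 - cos t) * c + sin t * s) + (1 - cos t) * cos (N%:R * t)
      + sin t * sin (N%:R * t)); [by ring|rewrite IC; by ring].
  - transitivity (((1 - cos t) * s - sin t * c) + (1 - cos t) * sin (N%:R * t)
      - sin t * cos (N%:R * t)); [by ring|rewrite IS; by ring].
have cs u : cos u ^+ 2 + sin u ^+ 2 = 1 :> R by exact: cos2Dsin2.
have -> : (2 - 2 * cos t) * (C ^+ 2 + S ^+ 2) =
    ((1 - cos t) * C + sin t * S) ^+ 2 + ((1 - cos t) * S - sin t * C) ^+ 2.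
  transitivity ((1 - 2 * cos t + (cos t ^+ 2 + sin t ^+ 2)) * (C ^+ 2 + S ^+ 2)).
    by rewrite cs; ring.
  by ring.
rewrite EC ES.
have -> : (1 - cos (N%:R * t)) ^+ 2 + (- sin (N%:R * t)) ^+ 2 = 2 - 2 * cos (N%:R * t).
  transitivity (1 - 2 * cos (N%:R * t) + (cos (N%:R * t) ^+ 2 + sin (N%:R * t) ^+ 2)).
    by ring.
  by rewrite cs; ring.
have := cos_geN1 (N%:R * t); lra.
Qed.

Lemma cos_shift x (j k : nat) : cos (x + (j%:R - k%:R) * (2 * pi)) = cos x.
Proof.
have P := periodicn (@cosD2pi R).
rewrite -(P k) -mulr_natr -[RHS](P j) -[pi *+ 2 *+ j]mulr_natr; congr cos.
rewrite -[pi *+ 2]mulr_natr; ring.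
Qed.

Lemma sin_shift x (j k : nat) : sin (x + (j%:R - k%:R) * (2 * pi)) = sin x.
Proof.
have P := periodicn (@sinD2pi R).
rewrite -(P k) -mulr_natr -[RHS](P j) -[pi *+ 2 *+ j]mulr_natr; congr sin.
rewrite -[pi *+ 2]mulr_natr; ring.
Qed.

Lemma fejer_periodic N t : fejer N (t + 2 * pi) = fejer N t.
Proof.
rewrite !fejerE; apply: eq_bigr => j _; apply: eq_bigr => k _; congr (_ * _).
by rewrite mulrDr cos_shift.
Qed.

Lemma continuous_fejer N : continuous (fejer N).
Proof.
have -> : fejer N = fun t => \sum_(j < N) \sum_(k < N) N%:R^-1 * cos ((j%:R - k%:R) * t).
  by apply/funext => t; exact: fejerE.
apply: continuous_big => [|j _]; first exact: add_continuous.
apply: continuous_big => [|k _ t]; first exact: add_continuous.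
apply: cvgMl_tmp; apply: (cvg_comp _ cos); last exact: continuous_cos.
by apply: cvgMl_tmp; exact: cvg_id.
Qed.


Lemma cos_eq1 t : `|t| < 2 * pi -> cos t = 1 -> t = 0.
Proof.
wlog t0 : t / 0 <= t.
  move=> h tpi ct; have [t0|/ltW t0] := leP 0 t; first exact: h.
  by apply/eqP; rewrite -oppr_eq0; apply/eqP; apply: h; rewrite ?oppr_ge0 ?normrN ?cosN.
rewrite ger0_norm// => tpi ct; apply/eqP; rewrite eq_le t0 andbT leNgt; apply/negP => tgt0.
have : 0 < sin (t / 2) by apply: sin_gt0_pi; lra.
have : cos (t / 2 *+ 2) = 1 by rewrite -mulr_natr divfK.
rewrite cos_mulr2n => c s; have : sin (t / 2) ^+ 2 = 0.
  by have := cos2Dsin2 (t / 2); move: c; rewrite mulr2n => *; lra.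
by move=> /eqP; rewrite sqrf_eq0 gt_eqF.
Qed.

End fejer.

(** * Approximate identities *)

(** The compactness argument behind every approximate identity below: it turns
    vanishing of f on the zeros of a penalty w into a quantitative bound, which
    is then integrated against kernels whose w-moments tend to 0. *)
Lemma penalty_bound {R : realType} {T : topologicalType} (K : set T) (f w : T -> R) (e : R) :
  compact K -> continuous f -> continuous w -> (forall x, K x -> 0 <= w x) ->
  (forall x, K x -> w x = 0 -> f x = 0) -> 0 < e ->
  exists2 M, 0 <= M & forall x, K x -> `|f x| <= e + M * w x.
Proof.
move=> cK cf cw w0 fw e0.
have cnf : continuous (fun x => `|f x|).
  by move=> x; apply: cvg_norm; exact: cf.
pose K' := K `&` [set x | e <= `|f x|].
have [[x0 K'x0]|K'0] := pselect (K' !=set0); last first.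
  exists 0 => // x Kx; rewrite mul0r addr0 leNgt; apply/negP => ex.
  by apply: K'0; exists x; split => //=; exact: ltW.
have cK' : compact K'.
  apply: compact_closedI => //.
  by apply: (@closed_comp _ _ (fun x => `|f x|) [set r | e <= r]) => //; exact: closed_ge.
have K'n : K' !=set0 by exists x0.
have [a aK' aP] := compact_EVT_min K'n cK' (continuous_subspaceT cw).
have [b bK' bP] := compact_EVT_max K'n cK' (continuous_subspaceT cnf).
move: aK'; rewrite inE => -[Ka fa].
have wa : 0 < w a.
  rewrite lt_neqAle w0// andbT eq_sym; apply/eqP => /(fw _ Ka) fa0.
  by move: fa; rewrite /= fa0 normr0 leNgt e0.
exists (`|f b| / w a); first by rewrite divr_ge0// ltW.
move=> x Kx; have [xe|ex] := ltP `|f x| e.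
  by rewrite (le_trans (ltW xe))// lerDl mulr_ge0// ?w0// divr_ge0// ltW.
have K'x : x \in K' by rewrite inE.
rewrite (le_trans (bP _ K'x))// -[leLHS]add0r lerD ?(ltW e0)//.
by rewrite mulrAC ler_pdivlMr// ler_wpM2l// aP.
Qed.

Section period_integral.
Variable R : realType.
Notation mu := (@lebesgue_measure R).

(** Over a whole number of periods all the characters but the trivial one
    integrate to 0. *)
Lemma integral_cos_period (a b w c : R) (j k q : nat) : a < b ->
  w * (b - a) = 2 * pi * q%:R -> w != 0 -> j != k ->
  \int[mu]_(x in `[a, b]) cos ((j%:R - k%:R) * (w * x + c)) = 0.
Proof.
move=> ab wab w0 jk; set l := _ - _.
have l0 : l * w != 0 by rewrite mulf_neq0// subr_eq0 eqr_nat.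
pose F (x : R) := (l * w)^-1 * sin (l * (w * x + c)).
have dF (x : R) : is_derive x 1 F (cos (l * (w * x + c))).
  have h : is_derive x 1 (fun x : R => l * (w * x + c)) (l * w).
    by apply: is_derive_eq; rewrite /GRing.scale/=; ring.
  have hs : is_derive x 1 (fun x => sin (l * (w * x + c))) (cos (l * (w * x + c)) * (l * w)).
    exact: (@is_derive1_comp _ sin (fun x => l * (w * x + c))).
  by apply: is_derive_eq; rewrite /GRing.scale/=; field; move: l0; rewrite mulf_eq0 negb_or => /andP[-> ->].
have cF : continuous F.
  move=> x; apply: differentiable_continuous; apply/derivable1_diffP; by have [] := dF x.
rewrite /Rintegral (@continuous_FTC2 _ _ F)//=.
- have -> : F b = F a.
    rewrite /F; congr (_ * _).
    have -> : l * (w * b + c) = l * (w * a + c) + ((j * q)%:R - (k * q)%:R) * (2 * pi).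
      by rewrite !natrM -mulrBl -/l -mulrA [q%:R * _]mulrC -wab; ring.
    exact: sin_shift.
  by rewrite subrr.
- apply: continuous_subspaceT => x; apply: (cvg_comp _ cos); last exact: continuous_cos.
  by apply: cvgMl_tmp; apply: cvgD; [apply: cvgMl_tmp; exact: cvg_id|exact: cvg_cst].
- split.
  + by move=> x _; have [] := dF x.
  + by apply: cvg_at_right_filter; exact: cF.
  + by apply: cvg_at_left_filter; exact: cF.
- by move=> x _; rewrite derive1E; exact: derive_val.
Qed.

Lemma integral_fejer_period N (a b w c : R) (q : nat) : (0 < N)%N -> a < b ->
  w * (b - a) = 2 * pi * q%:R -> w != 0 ->
  \int[mu]_(x in `[a, b]) fejer N (w * x + c) = b - a.
Proof.
move=> N0 ab wab w0.
have muoo : (mu `[a, b] < +oo)%E by rewrite /= lebesgue_measure_itv/= lte_fin ab -EFinB ltry.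
have mcos l : measurable_fun `[a, b] (fun x : R => cos (l * (w * x + c))).
  apply: measurable_funTS; apply: continuous_measurable_fun => x.
  apply: (cvg_comp _ cos); last exact: continuous_cos.
  by apply: cvgMl_tmp; apply: cvgD; [apply: cvgMl_tmp; exact: cvg_id|exact: cvg_cst].
have icos l : mu.-integrable `[a, b] (EFin \o fun x : R => N%:R^-1 * cos (l * (w * x + c))).
  apply: (@bounded_integrable _ _ _ _ _ _ muoo _ N%:R^-1) => //.
    by apply: measurable_funM => //; exact: mcos.
  move=> x _; rewrite normrM ger0_norm ?invr_ge0// ler_piMr ?invr_ge0//.
  by rewrite /= ler_norml cos_geN1 cos_le1.
have icos' l : mu.-integrable `[a, b] (EFin \o fun x : R => cos (l * (w * x + c))).
  apply: (@bounded_integrable _ _ _ _ _ _ muoo _ 1) => //; first exact: mcos.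
  by move=> x _; rewrite ler_norml cos_geN1 cos_le1.
under eq_Rintegral do rewrite fejerE.
rewrite Rintegral_sum//; last first.
  move=> j; rewrite (_ : _ \o _ = (fun x => \sum_(k < N) (N%:R^-1 * cos ((j%:R - k%:R) * (w * x + c)))%:E)%E).
    by apply: integrable_sum => // k _; exact: icos.
  by apply/funext => x /=; rewrite sumEFin.
transitivity (\sum_(j < N) N%:R^-1 * (b - a)).
  apply: eq_bigr => j _; rewrite Rintegral_sum//.
  rewrite (bigD1 j)//= [X in _ + X]big1 ?addr0.
    under eq_Rintegral do rewrite subrr mul0r cos0 mulr1.
    rewrite Rintegral_cst//= lebesgue_measure_itv/= lte_fin ab /=; ring.
  move=> k kj; rewrite RintegralZl// (@integral_cos_period _ _ _ _ _ _ q) ?mulr0//.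
  by rewrite eq_sym.
by rewrite sumr_const card_ord -[LHS]mulr_natr mulrAC mulVf ?mul1r// pnatr_eq0 -lt0n.
Qed.

End period_integral.

(** * Fejer means of periodic functions *)

Section fejer_mean.
Variables (R : realType) (P tau : R).
Hypotheses (P0 : 0 < P) (tauP : tau * P = 2 * pi).
Notation mu := (@lebesgue_measure R).

Let tau0 : 0 < tau.
Proof. by rewrite -(pmulr_lgt0 _ P0) tauP mulr_gt0// pi_gt0. Qed.

Let muoo : (mu `[0%R, P] < +oo)%E.
Proof. by rewrite /= lebesgue_measure_itv/= lte_fin P0 -EFinB ltry. Qed.

(** The N-th Fejer mean of the P-periodic function that agrees with g on [0, P]. *)
Definition fejer_mean (g : R -> R) N (z : R) : R :=
  P^-1 * \int[mu]_(x in `[0%R, P]) (g x * fejer N (tau * (x - z))).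

Let cf N z : continuous (fun x => fejer N (tau * (x - z))).
Proof.
move=> x; apply: (cvg_comp _ (fejer N)); last exact: continuous_fejer.
by apply: cvgMl_tmp; apply: cvgB; [exact: cvg_id|exact: cvg_cst].
Qed.

Let icont (g : R -> R) : continuous g -> mu.-integrable `[0%R, P] (EFin \o g).
Proof.
move=> cg; apply: continuous_compact_integrable; first exact: segment_compact.
exact: continuous_subspaceT.
Qed.

Let cM (f g : R -> R) : continuous f -> continuous g -> continuous (fun x => f x * g x).
Proof. by move=> cf' cg x; apply: cvgM; [exact: cf'|exact: cg]. Qed.

Let fejer_mass N z : (0 < N)%N ->
  \int[mu]_(x in `[0%R, P]) fejer N (tau * (x - z)) = P.
Proof.
move=> N0; under eq_Rintegral do rewrite mulrBr.
by rewrite (@integral_fejer_period _ _ _ _ _ _ 1)// ?subr0 ?mulr1 ?gt_eqF.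
Qed.

Lemma fejer_mean_le (g : R -> R) G N z : (0 < N)%N -> continuous g ->
  (forall x, 0 <= x <= P -> `|g x| <= G) -> `|fejer_mean g N z| <= G.
Proof.
move=> N0 cg gG; rewrite normrM gtr0_norm ?invr_gt0// mulrC ler_pdivrMr//.
have cgf : continuous (fun x => g x * fejer N (tau * (x - z))) by exact: cM.
apply: (le_trans (le_normr_Rintegral _ (icont cgf))) => //.
rewrite -[X in _ <= _ * X](fejer_mass z N0) -RintegralZl//; last exact: icont.
apply: le_Rintegral => //.
- by apply: icont => x; apply: cvg_norm; exact: cgf.
- by apply: icont; apply: cM => //; exact: cst_continuous.
- move=> x; rewrite /= in_itv/= => xP.
  by rewrite normrM [X in _ * X]ger0_norm ?fejer_ge0// ler_wpM2r ?fejer_ge0// gG.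
Qed.

(** Fejer's theorem at an interior point, by the approximate identity penalized
    by 2 - 2 cos (tau (x - z)), which on [0, P] vanishes only at z. *)
Lemma fejer_mean_cvg (g : R -> R) z : continuous g -> 0 < z < P ->
  fejer_mean g N z @[N --> \oo] --> g z.
Proof.
move=> cg /andP[z0 zP]; apply/cvgrPdist_le => e e0.
pose w (x : R) : R := 2 - 2 * cos (tau * (x - z)).
have cw : continuous w.
  move=> x; apply: cvgB; first exact: cvg_cst.
  apply: cvgMl_tmp; apply: (cvg_comp _ cos); last exact: continuous_cos.
  by apply: cvgMl_tmp; apply: cvgB; [exact: cvg_id|exact: cvg_cst].
have cgz : continuous (fun x => g x - g z).
  by move=> x; apply: cvgB; [exact: cg|exact: cvg_cst].
have w0 x : 0 <= w x by have := cos_le1 (tau * (x - z)); rewrite /w; lra.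
have wz x : `[0, P]%classic x -> w x = 0 -> g x - g z = 0.
  rewrite /= in_itv/= => /andP[x0 xP] wx.
  have : tau * (x - z) = 0.
    apply: cos_eq1; last by move: wx; rewrite /w; lra.
    by rewrite -tauP normrM gtr0_norm// ltr_pM2l// ltr_norml; apply/andP; split; lra.
  by move/eqP; rewrite mulf_eq0 gt_eqF//= subr_eq0 => /eqP ->; rewrite subrr.
have e20 : 0 < e / 2 by rewrite divr_gt0.
have [M M0 Mb] := penalty_bound (@segment_compact _ 0 P) cgz cw (fun x _ => w0 x) wz e20.
exists (Num.truncn (M * 8 / e)).+1 => // N /= NM.
have N0 : (0 < N)%N by exact: leq_trans NM.
have NR : 0 < N%:R :> R by rewrite ltr0n.
have MN : M * (4 / N%:R) <= e / 2.
  have : M * 8 / e < N%:R.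
    by apply: (lt_le_trans (truncnS_gt _)); rewrite ler_nat.
  rewrite ltr_pdivrMr// mulrA ler_pdivrMr// => ?; nra.
have -> : g z - fejer_mean g N z =
    - (P^-1 * \int[mu]_(x in `[0%R, P]) ((g x - g z) * fejer N (tau * (x - z)))).
  under eq_Rintegral do rewrite mulrBl.
  rewrite RintegralB//; last 2 first.
  - by apply: icont; exact: cM.
  - by apply: icont; apply: cM => //; exact: cst_continuous.
  rewrite (@RintegralZl _ _ _ mu _ _ (g z))//; last exact: icont.
  by rewrite fejer_mass// /fejer_mean; field; rewrite gt_eqF.
rewrite normrN normrM gtr0_norm ?invr_gt0// mulrC ler_pdivrMr//.
have cgf : continuous (fun x => (g x - g z) * fejer N (tau * (x - z))) by exact: cM.
apply: (le_trans (le_normr_Rintegral _ (icont cgf))) => //.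
apply: (@le_trans _ _ (\int[mu]_(x in `[0%R, P])
    (e / 2 * fejer N (tau * (x - z)) + M * (4 / N%:R)))).
  apply: le_Rintegral => //.
  - by apply: icont => x; apply: cvg_norm; exact: cgf.
  - apply: icont => x; apply: cvgD; last exact: cvg_cst.
    by apply: cvgMl_tmp; exact: cf.
  - move=> x Px; rewrite normrM [X in _ * X]ger0_norm ?fejer_ge0//.
    apply: (@le_trans _ _ ((e / 2 + M * w x) * fejer N (tau * (x - z)))).
      by rewrite ler_wpM2r ?fejer_ge0// Mb.
    by rewrite mulrDl lerD2l -mulrA ler_wpM2l// fejer_decay.
rewrite RintegralD//; last 2 first.
- by apply: icont; apply: cM => //; exact: cst_continuous.
- by apply: icont; exact: cst_continuous.
rewrite RintegralZl//; last exact: icont.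
rewrite fejer_mass// Rintegral_cst//= lebesgue_measure_itv/= lte_fin P0/= subr0.
nra.
Qed.

Lemma fejer_meanD (g : R -> R) N z : fejer_mean g N (z - P) = fejer_mean g N z.
Proof.
rewrite /fejer_mean; congr (_ * _); apply: eq_Rintegral => x _; congr (_ * _).
have -> : tau * (x - (z - P)) = tau * (x - z) + tau * P by ring.
by rewrite tauP fejer_periodic.
Qed.

Lemma fejer_mean_trig (g : R -> R) N : continuous g ->
  exists c s : nat -> nat -> R, forall z, fejer_mean g N z =
    \sum_(j < N) \sum_(k < N) (c j k * cos ((j%:R - k%:R) * (tau * z)) +
      s j k * sin ((j%:R - k%:R) * (tau * z))).
Proof.
move=> cg.
pose C l := \int[mu]_(x in `[0%R, P]) (g x * cos (l * (tau * x))).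
pose S l := \int[mu]_(x in `[0%R, P]) (g x * sin (l * (tau * x))).
have ccos l : continuous (fun x => g x * cos (l * (tau * x))).
  apply: cM => // x; apply: (cvg_comp _ cos); last exact: continuous_cos.
  by do 2 apply: cvgMl_tmp; exact: cvg_id.
have csin l : continuous (fun x => g x * sin (l * (tau * x))).
  apply: cM => // x; apply: (cvg_comp _ sin); last exact: continuous_sin.
  by do 2 apply: cvgMl_tmp; exact: cvg_id.
exists (fun j k => P^-1 * N%:R^-1 * C (j%:R - k%:R)), (fun j k => P^-1 * N%:R^-1 * S (j%:R - k%:R)) => z.
pose F (j k : nat) x := N%:R^-1 * cos ((j%:R - k%:R) * (tau * z)) * (g x * cos ((j%:R - k%:R) * (tau * x)))
  + N%:R^-1 * sin ((j%:R - k%:R) * (tau * z)) * (g x * sin ((j%:R - k%:R) * (tau * x))).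
have iF j k : mu.-integrable `[0%R, P] (EFin \o F j k).
  by apply: icont => x; apply: cvgD; apply: cvgMl_tmp; [exact: ccos|exact: csin].
transitivity (P^-1 * \int[mu]_(x in `[0%R, P]) (\sum_(j < N) \sum_(k < N) F j k x)).
  congr (_ * _); apply: eq_Rintegral => x _; rewrite fejerE mulr_sumr.
  apply: eq_bigr => j _; rewrite mulr_sumr; apply: eq_bigr => k _.
  by rewrite /F mulrBr [in LHS]mulrBr cosB; ring.
rewrite Rintegral_sum//; last first.
  move=> j; rewrite (_ : _ \o _ = (fun x => \sum_(k < N) (F j k x)%:E)%E).
    by apply: integrable_sum => // k _; exact: iF.
  by apply/funext => x /=; rewrite sumEFin.
rewrite mulr_sumr; apply: eq_bigr => j _.
rewrite Rintegral_sum// mulr_sumr; apply: eq_bigr => k _.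
rewrite RintegralD//; last 2 first.
- by apply: icont => x; apply: cvgMl_tmp; exact: ccos.
- by apply: icont => x; apply: cvgMl_tmp; exact: csin.
rewrite !RintegralZl//; [|exact: icont|exact: icont].
by rewrite /C /S; ring.
Qed.

End fejer_mean.

(** * Fourier integrals with double zeros along a lattice *)

Section interpolation.
Variables (R : realType) (P tau : R).
Hypotheses (P0 : 0 < P) (tauP : tau * P = 2 * pi).
Variable chi : R -> R.
Hypotheses (cchi : continuous chi) (chi1 : forall x, `|chi x| <= 1).

(* With these choices chi y = interp0 y + y * interp1 y holds on both halves of
   [-P, P] once interp0 and interp1 are extended from [0, P] by P-periodicity. *)
Let interp0 x := (1 - x / P) * chi x + x / P * chi (x - P).
Let interp1 x := (chi x - chi (x - P)) / P.

Definition interp N y := fejer_mean P tau interp0 N y + y * fejer_mean P tau interp1 N y.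

Let cshift : continuous (fun x => chi (x - P)).
Proof.
move=> x; apply: (cvg_comp _ chi); last exact: cchi.
by apply: cvgB; [exact: cvg_id|exact: cvg_cst].
Qed.

Let c0 : continuous interp0.
Proof.
move=> x; apply: cvgD; apply: cvgM; [|exact: cchi| |exact: cshift].
- by apply: cvgB; [exact: cvg_cst|apply: cvgMr_tmp; exact: cvg_id].
- by apply: cvgMr_tmp; exact: cvg_id.
Qed.

Let c1 : continuous interp1.
Proof. by move=> x; apply: cvgMr_tmp; apply: cvgB; [exact: cchi|exact: cshift]. Qed.

(** For y < 0 the Fejer means see the periodic extension, that is the point y + P. *)
Lemma interp_cvg y : 0 < `|y| < P -> interp N y @[N --> \oo] --> chi y.
Proof.
move=> /andP[y0 yP]; have Pn0 : P != 0 by rewrite gt_eqF.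
have [yge|ylt] := leP 0 y.
  have y0P : 0 < y < P by rewrite -(ger0_norm yge) y0.
  have -> : chi y = interp0 y + y * interp1 y by rewrite /interp0 /interp1; field.
  by apply: cvgD; [|apply: cvgMl_tmp]; exact: fejer_mean_cvg.
have y0P : 0 < y + P < P.
  by move: yP; rewrite ltr0_norm// => yP; apply/andP; split; lra.
have -> : chi y = interp0 (y + P) + y * interp1 (y + P).
  by rewrite /interp0 /interp1 addrK; field.
have -> : interp ^~ y = fun N => fejer_mean P tau interp0 N (y + P) +
    y * fejer_mean P tau interp1 N (y + P).
  by apply/funext => N; rewrite /interp -!(fejer_meanD tauP _ _ (y + P)) addrK.
by apply: cvgD; [|apply: cvgMl_tmp]; exact: fejer_mean_cvg.
Qed.

Lemma interp_le N y : (0 < N)%N -> `|y| <= P -> `|interp N y| <= 3.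
Proof.
move=> N0 yP; rewrite (_ : 3 = 1 + P * (2 / P)); last by field; rewrite gt_eqF.
apply: (le_trans (ler_normD _ _)); apply: lerD.
  apply: (fejer_mean_le P0 tauP) => // x /andP[x0 xP].
  have a0 : 0 <= x / P by rewrite divr_ge0// ltW.
  have a1 : x / P <= 1 by rewrite ler_pdivrMr// mul1r.
  apply: (le_trans (ler_normD _ _)); rewrite normrM [X in _ + X <= _]normrM.
  rewrite (ger0_norm a0) ger0_norm ?subr_ge0//.
  rewrite -[leRHS](subrK (x / P)); apply: lerD; rewrite -[leRHS]mulr1 ler_wpM2l// subr_ge0//.
rewrite normrM ler_pM//; apply: (fejer_mean_le P0 tauP) => // x _.
rewrite normrM normfV (gtr0_norm P0) ler_pM2r ?invr_gt0//.
by rewrite (le_trans (ler_normB _ _))// -[2]/(1 + 1) lerD.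
Qed.

Lemma interp_trig N : exists c s c' s' : nat -> nat -> R, forall y,
  interp N y = \sum_(j < N) \sum_(k < N)
    ((c j k * cos ((j%:R - k%:R) * (tau * y)) + s j k * sin ((j%:R - k%:R) * (tau * y))) +
     y * (c' j k * cos ((j%:R - k%:R) * (tau * y)) + s' j k * sin ((j%:R - k%:R) * (tau * y)))).
Proof.
have [c [s E0]] := fejer_mean_trig P tau N c0.
have [c' [s' E1]] := fejer_mean_trig P tau N c1.
exists c, s, c', s' => y; rewrite /interp E0 E1 mulr_sumr -big_split/=.
apply: eq_bigr => j _; rewrite mulr_sumr -big_split/=; exact: eq_bigr.
Qed.

End interpolation.

Section double_zeros.
Context {R : realType} d {T : measurableType d} (m : {measure set T -> \bar R}).
Variable D : set T.
Hypothesis mD : measurable D.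
Hypothesis mDoo : (m D < +oo)%E.
Variable y : T -> R.
Hypothesis my : measurable_fun D y.
Variables P tau : R.
Hypotheses (P0 : 0 < P) (tauP : tau * P = 2 * pi).
Hypothesis yP : forall x, D x -> `|y x| <= P.
Hypothesis y_ae : {ae m, forall x, D x -> 0 < `|y x| < P}.
Variables (A B : T -> R) (C : R).
Hypotheses (mA : measurable_fun D A) (mB : measurable_fun D B).
Hypotheses (AC : forall x, D x -> `|A x| <= C) (BC : forall x, D x -> `|B x| <= C).

Let null (f : T -> R) := m.-integrable D (EFin \o f) /\ \int[m]_(x in D) f x = 0.

Let nullD f g : null f -> null g -> null (fun x => f x + g x).
Proof.
move=> [If f0] [Ig g0]; split; first exact: (integrableD mD If Ig).
by rewrite RintegralD// f0 g0 addr0.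
Qed.

Let nullZ a f : null f -> null (fun x => a * f x).
Proof.
move=> [If f0]; split; first exact: (integrableZl mD a If).
by rewrite RintegralZl// f0 mulr0.
Qed.

Let null_sum N (h : 'I_N -> T -> R) : (forall j, null (h j)) ->
  null (fun x => \sum_(j < N) h j x).
Proof.
move=> nh; split; last first.
  rewrite Rintegral_sum//; last by move=> j; have [] := nh j.
  by rewrite big1// => j _; have [] := nh j.
rewrite (_ : _ \o _ = (fun x => \sum_(j < N) (h j x)%:E)%E).
  by apply: integrable_sum => // j _; have [] := nh j.
by apply/funext => x /=; rewrite sumEFin.
Qed.

Let norm_cos_le1 (t : R) : `|cos t| <= 1.
Proof. by rewrite ler_norml cos_geN1 cos_le1. Qed.

Let norm_sin_le1 (t : R) : `|sin t| <= 1.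
Proof. by rewrite ler_norml sin_geN1 sin_le1. Qed.

Let mcos (l : R) : measurable_fun D (fun x => cos (l * (tau * y x))).
Proof.
apply: measurableT_comp; first by apply: continuous_measurable_fun; exact: continuous_cos.
by apply: measurable_funM => //; exact: measurable_funM.
Qed.

Let msin (l : R) : measurable_fun D (fun x => sin (l * (tau * y x))).
Proof.
apply: measurableT_comp; first by apply: continuous_measurable_fun; exact: continuous_sin.
by apply: measurable_funM => //; exact: measurable_funM.
Qed.

Let prod_le (u v a b : R) : `|u| <= a -> `|v| <= b -> `|u * v| <= a * b.
Proof. by move=> ua vb; rewrite normrM; apply: ler_pM. Qed.

(** For eps = 1 the hypotheses concern the even and for eps = -1 the odd part of
    the interpolants of chi, whose limit is chi. *)
Let annihilates (eps : R) (W : T -> R) (chi : R -> R) :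
  eps ^+ 2 = 1 -> measurable_fun D W -> (forall x, D x -> `|W x| <= C) ->
  continuous chi -> (forall u, `|chi u| <= 1) -> (forall u, chi (- u) = eps * chi u) ->
  (forall j k : nat, \int[m]_(x in D) (W x * ((1 + eps) * cos ((j%:R - k%:R) * (tau * y x)))) = 0) ->
  (forall j k : nat, \int[m]_(x in D) (W x * ((1 - eps) * sin ((j%:R - k%:R) * (tau * y x)))) = 0) ->
  (forall j k : nat, \int[m]_(x in D) (W x * (y x * ((1 - eps) * cos ((j%:R - k%:R) * (tau * y x))))) = 0) ->
  (forall j k : nat, \int[m]_(x in D) (W x * (y x * ((1 + eps) * sin ((j%:R - k%:R) * (tau * y x))))) = 0) ->
  \int[m]_(x in D) (W x * chi (y x)) = 0.
Proof.
move=> eps2 mW WC cchi chi1 chiN Wc Ws Wyc Wys.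
have neps : `|eps| = 1.
  by apply/eqP; rewrite -(@pexpr_eq1 _ _ 2)// -normrX eps2 normr1.
pose E N x := 2^-1 * (interp P tau chi N.+1 (y x) + eps * interp P tau chi N.+1 (- y x)).
have trigE N : exists c s c' s' : nat -> nat -> R, forall x, W x * E N x =
    \sum_(j < N.+1) \sum_(k < N.+1) (
      2^-1 * c j k * (W x * ((1 + eps) * cos ((j%:R - k%:R) * (tau * y x)))) +
      2^-1 * s j k * (W x * ((1 - eps) * sin ((j%:R - k%:R) * (tau * y x)))) +
      2^-1 * c' j k * (W x * (y x * ((1 - eps) * cos ((j%:R - k%:R) * (tau * y x))))) +
      2^-1 * s' j k * (W x * (y x * ((1 + eps) * sin ((j%:R - k%:R) * (tau * y x)))))).
  have [c [s [c' [s' H]]]] := interp_trig P tau cchi N.+1.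
  exists c, s, c', s' => x; rewrite /E !H [eps * _]mulr_sumr -big_split/= !mulr_sumr.
  apply: eq_bigr => j _; rewrite [eps * _]mulr_sumr -big_split/= !mulr_sumr.
  apply: eq_bigr => k _; rewrite !mulrN cosN sinN; ring.
have nWE N : null (fun x => W x * E N x).
  have [c [s [c' [s' H]]]] := trigE N.
  rewrite (funext H).
  apply: null_sum => j; apply: null_sum => k.
  have iW (f : T -> R) M : measurable_fun D f -> (forall x, D x -> `|f x| <= M) ->
      m.-integrable D (EFin \o (fun x => W x * f x)).
    move=> mf fM; apply: (bounded_integrable mD mDoo (M := C * M)).
      exact: measurable_funM.
    by move=> x Dx; apply: prod_le; [exact: WC|exact: fM].
  have bt (a t : R) : `|t| <= 1 -> `|a * t| <= `|a|.
    by move=> t1; rewrite normrM ler_piMr.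
  apply: nullD; first (apply: nullD; first apply: nullD); apply: nullZ; split => //.
  - apply: (iW _ `|1 + eps|); first exact: measurable_funM.
    by move=> x _; exact: bt.
  - apply: (iW _ `|1 - eps|); first exact: measurable_funM.
    by move=> x _; exact: bt.
  - apply: (iW _ (P * `|1 - eps|)).
      by apply: measurable_funM => //; exact: measurable_funM.
    by move=> x Dx; apply: prod_le; [exact: yP|exact: bt].
  - apply: (iW _ (P * `|1 + eps|)).
      by apply: measurable_funM => //; exact: measurable_funM.
    by move=> x Dx; apply: prod_le; [exact: yP|exact: bt].
have WE_cvg : \int[m]_(x in D) (W x * E N x) @[N --> \oo] --> \int[m]_(x in D) (W x * chi (y x)).
  apply: (Rintegral_cvg_ae mD mDoo (M := C * 3)).
  - by move=> N; have [/integrableP[/measurable_EFinP]] := nWE N.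
  - apply: measurable_funM => //; apply: measurableT_comp => //.
    exact: continuous_measurable_fun.
  - move=> N x Dx; apply: prod_le; first exact: WC.
    rewrite normrM ger0_norm ?invr_ge0// -ler_pdivlMl ?invr_gt0// invrK.
    apply: (le_trans (ler_normD _ _)); rewrite normrM neps mul1r.
    rewrite (_ : 2 * 3 = 3 + 3); last by ring.
    by apply: lerD; apply: interp_le => //; rewrite ?normrN yP.
  - move: y_ae; apply: filterS => x yx Dx; have {}yx := yx Dx.
    apply: cvgM; first exact: cvg_cst.
    have -> : chi (y x) = 2^-1 * (chi (y x) + eps * chi (- y x)).
      by rewrite chiN mulrA -expr2 eps2; field.
    have cS u : 0 < `|u| < P -> interp P tau chi N.+1 u @[N --> \oo] --> chi u.
      by move=> uP; rewrite (@cvg_shiftS _ (interp P tau chi ^~ u)); exact: interp_cvg.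
    apply: cvgM; first exact: cvg_cst.
    apply: cvgD; first exact: cS.
    by apply: cvgM; [exact: cvg_cst|apply: cS; rewrite normrN].
have WE0 : \int[m]_(x in D) (W x * E N x) @[N --> \oo] --> (0 : R).
  rewrite (_ : (fun N => _) = cst 0); first exact: cvg_cst.
  by apply/funext => N; have [] := nWE N.
exact: (cvg_unique _ WE_cvg WE0).
Qed.

(** Vanishing on the lattice tau Z only says that the weight cancels after
    folding the frequency y modulo P = 2 pi/tau. Inside ]-P, P[ folding identifies
    a frequency y > 0 with y - P alone, and the zeros of the derivative, which
    weighs the two by y and y - P, separate them. The frequencies 0 and +-P, which
    would all be identified (as for the transform of sin^2), are excluded by
    nullity. *)
Lemma osc_double_zeros :
  (forall j k : nat, osc m D y A B ((j%:R - k%:R) * tau) = 0) ->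
  (forall j k : nat,
    osc m D y (fun x => y x * B x) (fun x => - (y x * A x)) ((j%:R - k%:R) * tau) = 0) ->
  forall s, osc m D y A B s = 0.
Proof.
move=> H0 H1 s.
have iWM (W f : T -> R) K M : measurable_fun D W -> (forall x, D x -> `|W x| <= K) ->
    measurable_fun D f -> (forall x, D x -> `|f x| <= M) ->
    m.-integrable D (EFin \o (fun x => W x * f x)).
  move=> mW WK mf fM; apply: (bounded_integrable mD mDoo (M := K * M)).
    exact: measurable_funM.
  by move=> x Dx; apply: prod_le; [exact: WK|exact: fM].
have mcs (l : R) : measurable_fun D (fun x => cos (l * y x)).
  apply: measurableT_comp; first by apply: continuous_measurable_fun; exact: continuous_cos.
  exact: measurable_funM.
have msn (l : R) : measurable_fun D (fun x => sin (l * y x)).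
  apply: measurableT_comp; first by apply: continuous_measurable_fun; exact: continuous_sin.
  exact: measurable_funM.
have split_osc (W V : T -> R) K l : measurable_fun D W -> (forall x, D x -> `|W x| <= K) ->
    measurable_fun D V -> (forall x, D x -> `|V x| <= K) ->
    osc m D y W V l = \int[m]_(x in D) (W x * cos (l * y x)) + \int[m]_(x in D) (V x * sin (l * y x)).
  move=> mW WK mV VK; rewrite /osc RintegralD//.
  - by apply: (iWM W _ K 1).
  - by apply: (iWM V _ K 1).
have separate (W V : T -> R) K : measurable_fun D W -> (forall x, D x -> `|W x| <= K) ->
    measurable_fun D V -> (forall x, D x -> `|V x| <= K) ->
    (forall j k : nat, osc m D y W V ((j%:R - k%:R) * tau) = 0) -> forall j k : nat,
    \int[m]_(x in D) (W x * cos ((j%:R - k%:R) * (tau * y x))) = 0 /\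
    \int[m]_(x in D) (V x * sin ((j%:R - k%:R) * (tau * y x))) = 0.
  move=> mW WK mV VK H j k; set l := j%:R - k%:R.
  have E1 : \int[m]_(x in D) (W x * cos (l * (tau * y x))) +
      \int[m]_(x in D) (V x * sin (l * (tau * y x))) = 0.
    rewrite -[RHS](H j k) (split_osc _ _ K)//.
    by congr (_ + _); apply: eq_Rintegral => x _; rewrite mulrA.
  have E2 : \int[m]_(x in D) (W x * cos (l * (tau * y x))) -
      \int[m]_(x in D) (V x * sin (l * (tau * y x))) = 0.
    transitivity (\int[m]_(x in D) (W x * cos (l * (tau * y x))) +
        \int[m]_(x in D) (-1 * (V x * sin (l * (tau * y x))))).
      by rewrite RintegralZl ?mulN1r//; apply: (iWM V _ K 1).
    rewrite -[RHS](H k j) (split_osc _ _ K)//.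
    congr (_ + _); apply: eq_Rintegral => x _; rewrite -[k%:R - _]opprB -/l.
      by rewrite !mulNr cosN mulrA.
    by rewrite !mulNr sinN mulrN mul1r !mulrA.
  by split; lra.
have [K yAK yBK] : exists2 K, forall x, D x -> `|y x * A x| <= K &
    forall x, D x -> `|y x * B x| <= K.
  by exists (P * C) => x Dx; apply: prod_le; rewrite ?yP ?AC ?BC.
have SA := separate _ _ _ mA AC mB BC H0.
have mNyA : measurable_fun D (fun x => - (y x * A x)).
  by apply: measurableT_comp => //; exact: measurable_funM.
have NyAK x : D x -> `|- (y x * A x)| <= K by rewrite normrN; exact: yAK.
have SB := separate _ _ _ (measurable_funM my mB) yBK mNyA NyAK H1.
rewrite (split_osc A B C)//.
have -> : \int[m]_(x in D) (A x * cos (s * y x)) = 0.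
  apply: (annihilates (eps := 1) (chi := fun u => cos (s * u))) => //.
  - by rewrite expr1n.
  - move=> u; apply: (cvg_comp _ cos); last exact: continuous_cos.
    by apply: cvgMl_tmp; exact: cvg_id.
  - by move=> u; rewrite mulrN cosN mul1r.
  - move=> j k; have [E _] := SA j k.
    under eq_Rintegral do rewrite mulrCA.
    by rewrite RintegralZl// ?E ?mulr0//; apply: (iWM A _ C 1).
  - move=> j k; under eq_Rintegral do rewrite subrr mul0r mulr0.
    by rewrite Rintegral_cst// mul0r.
  - move=> j k; under eq_Rintegral do rewrite subrr mul0r !mulr0.
    by rewrite Rintegral_cst// mul0r.
  - move=> j k; have [_ E] := SB j k.
    transitivity (- (1 + 1) * \int[m]_(x in D) (- (y x * A x) * sin ((j%:R - k%:R) * (tau * y x)))).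
      rewrite -RintegralZl//; first by apply: eq_Rintegral => x _; ring.
      by apply: (iWM _ _ K 1).
    by rewrite E mulr0.
have -> : \int[m]_(x in D) (B x * sin (s * y x)) = 0.
  apply: (annihilates (eps := -1) (chi := fun u => sin (s * u))) => //.
  - by rewrite sqrrN expr1n.
  - move=> u; apply: (cvg_comp _ sin); last exact: continuous_sin.
    by apply: cvgMl_tmp; exact: cvg_id.
  - by move=> u; rewrite mulrN sinN mulN1r.
  - move=> j k; under eq_Rintegral do rewrite subrr mul0r mulr0.
    by rewrite Rintegral_cst// mul0r.
  - move=> j k; have [_ E] := SA j k.
    under eq_Rintegral do rewrite mulrCA.
    by rewrite RintegralZl// ?E ?mulr0//; apply: (iWM B _ C 1).
  - move=> j k; have [E _] := SB j k.
    transitivity ((1 - -1) * \int[m]_(x in D) (y x * B x * cos ((j%:R - k%:R) * (tau * y x)))).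
      rewrite -RintegralZl//; first by apply: eq_Rintegral => x _; ring.
      by apply: (iWM _ _ K 1) => //; exact: measurable_funM.
    by rewrite E mulr0.
  - move=> j k; under eq_Rintegral do rewrite subrr mul0r !mulr0.
    by rewrite Rintegral_cst// mul0r.
by rewrite addr0.
Qed.

End double_zeros.

(** * Lebesgue measure on R^n *)

Section rV_toolkit.
Context {R : realType}.
Notation mu := (@lebesgue_measure R).
Notation lam := (@lebesgue_rV R).

Lemma continuous_measurable_rV n (f : 'rV[R]_n -> R) : continuous f -> measurable_fun setT f.
Proof.
move=> cf; apply: (measurability _ (RGenOpens.measurableE R)).
move=> _ [_ [a [b ->]] <-]; rewrite setTI; apply: open_measurable_rV.
by apply: open_comp => [x _|]; [exact: cf|exact: itv_open].
Qed.

Lemma ge0_integral_rV_succ n (f : 'rV[R]_n.+1 -> \bar R) :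
  measurable_fun setT f -> (forall x, 0 <= f x)%E ->
  (\int[lam n.+1]_x f x = \int[mu]_z \int[lam n]_x f (cons_rV (z, x)))%E.
Proof.
move=> mf f0.
have mfc : measurable_fun setT (f \o @cons_rV R n).
  by apply: measurableT_comp => //; exact: measurable_cons_rV.
rewrite -(@fubini_tonelli1 _ _ _ _ _ mu (lam n) (f \o @cons_rV R n))//; last by move=> x; exact: f0.
transitivity (\int[pushforward (mu \x lam n)%E (@cons_rV R n)]_x f x)%E; first by [].
by rewrite ge0_integral_pushforward//; exact: measurable_cons_rV.
Qed.

Lemma integral_rV_succ n (f : 'rV[R]_n.+1 -> \bar R) :
  (lam n.+1).-integrable setT f ->
  (\int[lam n.+1]_x f x = \int[mu]_z \int[lam n]_x f (cons_rV (z, x)))%E.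
Proof.
move=> If; have mf := measurable_int _ If.
have mfc : measurable_fun setT (f \o @cons_rV R n).
  by apply: measurableT_comp => //; exact: measurable_cons_rV.
have Ifc : (mu \x lam n)%E.-integrable setT (f \o @cons_rV R n).
  apply/integrableP; split => //.
  have /integrableP[_] := If; rewrite ge0_integral_rV_succ//; last exact: measurableT_comp.
  rewrite (@fubini_tonelli1 _ _ _ _ _ mu (lam n) (fun x => `|(f \o @cons_rV R n) x|)%E)//.
  exact: measurableT_comp.
rewrite (integral12_prod_meas1 Ifc).
transitivity (\int[pushforward (mu \x lam n)%E (@cons_rV R n)]_x f x)%E; first by [].
by rewrite integral_pushforward//; exact: measurable_cons_rV.
Qed.

Lemma integral_prod_rV n (g : 'I_n -> R -> R) :
  (forall k x, 0 <= g k x) -> (forall k, measurable_fun setT (g k)) ->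
  (\int[lam n]_x (\prod_k g k (x 0 k))%:E = \prod_k \int[mu]_x (g k x)%:E)%E.
Proof.
elim: n g => [|n IH] g g0 mg.
  rewrite big_ord0; under eq_integral do rewrite big_ord0.
  by rewrite integral_cst//= diracT mule1.
have mprod : measurable_fun setT (fun x : 'rV[R]_n => \prod_(i < n) g (lift ord0 i) (x 0 i)).
  apply: measurable_prod => i _; apply: measurableT_comp => //; exact: measurable_coord_rV.
rewrite ge0_integral_rV_succ//; last 2 first.
- apply/measurable_EFinP; apply: measurable_prod => i _; apply: measurableT_comp => //.
  exact: measurable_coord_rV.
- by move=> x; rewrite lee_fin prodr_ge0.
rewrite big_ord_recl -IH//.
transitivity (\int[mu]_z ((g ord0 z)%:E *
    \int[lam n]_x (\prod_(i < n) g (lift ord0 i) (x 0 i))%:E))%E.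
  apply: eq_integral => z _; rewrite -ge0_integralZl_EFin//; last 2 first.
  - by move=> x _; rewrite lee_fin prodr_ge0.
  - by apply/measurable_EFinP; exact: mprod.
  apply: eq_integral => x _; rewrite big_ord_recl cons_rV0 -EFinM; congr (_ * _)%:E.
  by apply: eq_bigr => i _; rewrite cons_rV_lift.
rewrite ge0_integralZr//=.
- by apply/measurable_EFinP; exact: mg.
- by move=> x _; rewrite lee_fin.
- by apply: integral_ge0 => x _; rewrite lee_fin prodr_ge0.
Qed.

Definition box n (a b : 'rV[R]_n) : set 'rV[R]_n := [set x | forall k, a 0 k <= x 0 k <= b 0 k].

Lemma measurable_box n (a b : 'rV[R]_n) : measurable (box a b).
Proof.
rewrite (_ : box a b = \bigcap_(k in [set: 'I_n])
    ((fun x : 'rV[R]_n => x 0 k) @^-1` `[a 0 k, b 0 k])); last first.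
  by apply/seteqP; split=> x /= H k; [move=> _ /=|]; have := H k; rewrite /= in_itv//; exact.
apply: fin_bigcap_measurable => // k _.
by rewrite -[X in measurable X]setTI; exact: measurable_coord_rV.
Qed.

Lemma integral_prod_box n (g : 'I_n -> R -> R) (a b : 'rV[R]_n) :
  (forall k x, 0 <= g k x) -> (forall k, measurable_fun setT (g k)) ->
  (\int[lam n]_(x in box a b) (\prod_k g k (x 0 k))%:E =
   \prod_k \int[mu]_(x in `[a 0%R k, b 0%R k]) (g k x)%:E)%E.
Proof.
move=> g0 mg; rewrite integral_mkcond.
pose h k := g k \_ (`[a 0 k, b 0 k]).
transitivity (\int[lam n]_x (\prod_k h k (x 0 k))%:E)%E.
  apply: eq_integral => x _; rewrite restrict_EFin; congr EFin.
  rewrite /patch; case: ifPn => [|nx].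
    rewrite inE => xab; apply: eq_bigr => k _.
    by rewrite /h /patch mem_set//= in_itv/=.
  have [k xk] : exists k, ~ (a 0 k <= x 0 k <= b 0 k).
    apply: contrapT => H; move: nx; rewrite notin_setE; apply => k.
    by apply: contrapT => xk; apply: H; exists k.
  rewrite (bigD1 k)//= /h /patch memNset ?mul0r//= in_itv/=; exact/negP.
rewrite integral_prod_rV.
- by apply: eq_bigr => k _; rewrite [RHS]integral_mkcond; apply: eq_integral => x _; rewrite restrict_EFin.
- by move=> k x; rewrite /h /patch; case: ifP.
- by move=> k; apply/(measurable_restrictT _ _).1 => //; exact: measurable_funTS.
Qed.

Lemma box_finite n (a b : 'rV[R]_n) : (lam n (box a b) < +oo)%E.
Proof.
have -> : lam n (box a b) = (\int[lam n]_(x in box a b) (\prod_(k < n) cst 1 (x 0 k))%:E)%E.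
  transitivity (\int[lam n]_(x in box a b) (cst 1%:E x))%E.
    by rewrite integral_cst ?mul1e//; exact: measurable_box.
  by apply: eq_integral => x _; rewrite big1.
rewrite (@integral_prod_box n (fun=> cst 1))// -ge0_fin_numE; last first.
  by apply: prode_ge0 => k _; apply: integral_ge0 => x _; rewrite lee_fin.
apply: prode_fin_num => k _; rewrite (integral_cst _ _ 1%:E)// mul1e /= lebesgue_measure_itv/=.
by case: ifP.
Qed.

Lemma box_hyperplane_null n (a b : 'rV[R]_n) k c :
  lam n (box a b `&` [set x | x 0 k = c]) = 0%E.
Proof.
have mc : measurable [set x : R | x = c] by rewrite (_ : mkset _ = [set c]).
have mH : measurable [set x : 'rV[R]_n | x 0 k = c].
  rewrite -[X in measurable X]setTI.
  exact: (measurable_coord_rV k measurableT mc).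
pose g (i : 'I_n) : R -> R := if i == k then \1_[set c] else cst 1.
have g0 i x : 0 <= g i x by rewrite /g; case: ifP.
have mg i : measurable_fun setT (g i).
  by rewrite /g; case: ifP => _ //; exact: measurable_indic.
rewrite setIC -integral_indic//; last exact: measurable_box.
transitivity (\int[lam n]_(x in box a b) (\prod_i g i (x 0 i))%:E)%E.
  apply: eq_integral => x _; rewrite (bigD1 k)//= /g eqxx big1 ?mulr1//.
  by move=> i /negbTE ->.
rewrite integral_prod_box// (bigD1 k)//= /g eqxx.
have -> : (\int[mu]_(x in `[a 0%R k, b 0%R k]) (\1_[set c] x)%:E)%E = 0%E.
  rewrite integral_indic//; apply/eqP; rewrite -measure_le0 -(lebesgue_measure_set1 c).
  by apply: le_measure; rewrite ?inE//; exact: measurableI.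
by rewrite mul0e.
Qed.

End rV_toolkit.

(** * Fejer summation over a lattice of R^n *)

Section expi_sums.
Variable R : realType.

Let normsq (z : R[i]) : R := complex.Re z ^+ 2 + complex.Im z ^+ 2.

Let normsqM z w : normsq (z * w) = normsq z * normsq w.
Proof. by case: z w => [a b] [c d]; rewrite /normsq /=; ring. Qed.

Lemma expiD (a b : R) : expi (a + b) = expi a * expi b.
Proof.
by rewrite /expi cosD sinD; apply/eqP; rewrite eq_complex /=; apply/andP; split; apply/eqP; ring.
Qed.

Let Re_sum (I : finType) (F : I -> R[i]) : complex.Re (\sum_i F i) = \sum_i complex.Re (F i).
Proof. by elim/big_rec2: _ => // i y z _ <-; case: (F i) z => [? ?] []. Qed.

Let Im_sum (I : finType) (F : I -> R[i]) : complex.Im (\sum_i F i) = \sum_i complex.Im (F i).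
Proof. by elim/big_rec2: _ => // i y z _ <-; case: (F i) z => [? ?] []. Qed.

(** The double sum is |sum_p e^(i p.th)|^2 times the leading phase, and the
    exponential sum factors over the coordinates. *)
Lemma trig_double_sum n N (al : R) (th : 'I_n -> R) :
  \sum_(p : {ffun 'I_n -> 'I_N}) \sum_(q : {ffun 'I_n -> 'I_N})
    cos (al + \sum_k th k * ((p k)%:R - (q k)%:R)) =
    cos al * \prod_k (N%:R * fejer N (th k)) /\
  \sum_(p : {ffun 'I_n -> 'I_N}) \sum_(q : {ffun 'I_n -> 'I_N})
    sin (al + \sum_k th k * ((p k)%:R - (q k)%:R)) =
    sin al * \prod_k (N%:R * fejer N (th k)).
Proof.
pose ph (p : {ffun 'I_n -> 'I_N}) := \sum_k th k * (p k)%:R.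
set C := \sum_(p : {ffun 'I_n -> 'I_N}) cos (ph p).
set S := \sum_(p : {ffun 'I_n -> 'I_N}) sin (ph p).
have CS : C ^+ 2 + S ^+ 2 = \prod_k (N%:R * fejer N (th k)).
  transitivity (normsq (\sum_(p : {ffun 'I_n -> 'I_N}) expi (ph p))).
    by rewrite /normsq Re_sum Im_sum.
  have -> : \sum_(p : {ffun 'I_n -> 'I_N}) expi (ph p) =
      \prod_k \sum_(j < N) expi (th k * j%:R).
    rewrite bigA_distr_bigA; apply: eq_bigr => p _.
    rewrite /ph; elim/big_rec2: _ => [|k z y _ E]; last by rewrite expiD E.
    by rewrite /expi cos0 sin0.
  have -> : forall F : 'I_n -> R[i], normsq (\prod_k F k) = \prod_k normsq (F k).
    move=> F; elim/big_rec2: _ => [|k y z _ E]; last by rewrite normsqM E.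
    by rewrite /normsq /= expr1n expr0n addr0.
  apply: eq_bigr => k _; rewrite /normsq Re_sum Im_sum /fejer.
  have [->|N0] := eqVneq N 0%N; first by rewrite !big_ord0 mul0r expr0n addr0.
  rewrite mulrA mulfV ?pnatr_eq0// mul1r; congr (_ ^+ 2 + _ ^+ 2);
    by apply: eq_bigr => j _; rewrite mulrC.
have E (p q : {ffun 'I_n -> 'I_N}) : al + \sum_k th k * ((p k)%:R - (q k)%:R) = al + ph p - ph q.
  rewrite -addrA; congr (_ + _); rewrite /ph -sumrB; apply: eq_bigr => k _; ring.
rewrite -CS; split.
  transitivity (\sum_(p : {ffun 'I_n -> 'I_N}) (cos (al + ph p) * C + sin (al + ph p) * S)).
    apply: eq_bigr => p _; rewrite /C /S !mulr_sumr -big_split/=.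
    by apply: eq_bigr => q _; rewrite E cosB.
  rewrite big_split/= -!mulr_suml.
  have -> : \sum_(p : {ffun 'I_n -> 'I_N}) cos (al + ph p) = cos al * C - sin al * S.
    by rewrite /C /S !mulr_sumr -sumrB; apply: eq_bigr => p _; rewrite cosD.
  have -> : \sum_(p : {ffun 'I_n -> 'I_N}) sin (al + ph p) = sin al * C + cos al * S.
    by rewrite /C /S !mulr_sumr -big_split/=; apply: eq_bigr => p _; rewrite sinD.
  ring.
transitivity (\sum_(p : {ffun 'I_n -> 'I_N}) (sin (al + ph p) * C - cos (al + ph p) * S)).
  apply: eq_bigr => p _; rewrite /C /S !mulr_sumr -sumrB.
  by apply: eq_bigr => q _; rewrite E sinB.
rewrite sumrB -!mulr_suml.
have -> : \sum_(p : {ffun 'I_n -> 'I_N}) cos (al + ph p) = cos al * C - sin al * S.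
  by rewrite /C /S !mulr_sumr -sumrB; apply: eq_bigr => p _; rewrite cosD.
have -> : \sum_(p : {ffun 'I_n -> 'I_N}) sin (al + ph p) = sin al * C + cos al * S.
  by rewrite /C /S !mulr_sumr -big_split/=; apply: eq_bigr => p _; rewrite sinD.
ring.
Qed.

End expi_sums.

Section rV_fejer.
Variables (R : realType) (n : nat).
Notation mu := (@lebesgue_measure R).
Notation lam := (@lebesgue_rV R n).
Variable tau : 'rV[R]_n.
Hypothesis tau_gt0 : forall k, 0 < tau 0 k.

Let P k : R := 2 * pi / tau 0 k.

Let P0 k : 0 < P k. Proof. by rewrite divr_gt0// mulr_gt0// pi_gt0. Qed.

Definition period_box : set 'rV[R]_n := box (\row_k (- (2 * pi / tau 0 k))) (\row_k (2 * pi / tau 0 k)).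

Lemma compact_box (a b : 'rV[R]_n) : compact (box a b).
Proof.
rewrite (_ : box a b = [set v | forall i, `[a 0 i, b 0 i]%classic (v ord0 i)]).
  by apply: (@rV_compact _ _ (fun i => `[a 0 i, b 0 i]%classic)) => i; exact: segment_compact.
by apply/seteqP; split => x /= H k; have := H k; rewrite in_itv/=.
Qed.

Lemma continuous_coord (k : 'I_n) : continuous (fun x : 'rV[R]_n => x 0 k).
Proof. exact: coord_continuous. Qed.

Let kernel N (x : 'rV[R]_n) := \prod_k fejer N (tau 0 k * x 0 k).

Let kernel_ge0 N x : 0 <= kernel N x.
Proof. by apply: prodr_ge0 => k _; exact: fejer_ge0. Qed.

Let cmul k : continuous (fun x : R => tau 0 k * x).
Proof. by move=> x; apply: cvgMl_tmp; exact: cvg_id. Qed.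

Let cfejer N k : continuous (fun x : R => fejer N (tau 0 k * x)).
Proof. by move=> x; apply: (cvg_comp _ (fejer N)); [exact: cmul|exact: continuous_fejer]. Qed.

Let ckernel N : continuous (kernel N).
Proof.
apply: continuous_big => [|k _ x]; first exact: mul_continuous.
by apply: (cvg_comp _ (fun x => fejer N (tau 0 k * x))); [exact: continuous_coord|exact: cfejer].
Qed.

Let mbox : measurable period_box. Proof. exact: measurable_box. Qed.
Let boxoo : (lam period_box < +oo)%E. Proof. exact: box_finite. Qed.

Let icont (f : 'rV[R]_n -> R) : continuous f -> lam.-integrable period_box (EFin \o f).
Proof.
move=> cf; have [p bp] : period_box !=set0.
  by exists 0 => k; rewrite !mxE; apply/andP; split; rewrite ?oppr_le0; exact: ltW (P0 k).
have cn : continuous (fun x : 'rV[R]_n => `|f x|).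
  by move=> x; exact: (cvg_norm (cf x)).
have [c _ cP] := compact_EVT_max (ex_intro _ p bp) (@compact_box _ _) (continuous_subspaceT cn).
apply: (@bounded_integrable _ _ _ _ _ mbox boxoo _ `|f c|).
  by apply: measurable_funTS; exact: continuous_measurable_rV.
by move=> x bx; apply: cP; rewrite inE.
Qed.

Let prod_factor (h : 'I_n -> R -> R) : (forall k, continuous (h k)) -> (forall k x, 0 <= h k x) ->
  (forall k, \int[mu]_(x in `[- P k, P k]) h k x = 2 * P k) ->
  \int[lam]_(x in period_box) (\prod_k h k (x 0 k)) = \prod_k (2 * P k).
Proof.
move=> ch h0 hP; rewrite /Rintegral integral_prod_box//; last first.
  by move=> k; exact: continuous_measurable_fun.
rewrite (eq_bigr (fun k => (2 * P k)%:E)); first by rewrite prodEFin.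
move=> k _; rewrite !mxE -[in RHS](hP k) /Rintegral fineK//.
apply: integrable_fin_num => //; apply: continuous_compact_integrable; first exact: segment_compact.
exact: continuous_subspaceT.
Qed.

Let mass_fejer N k : (0 < N)%N -> \int[mu]_(x in `[- P k, P k]) fejer N (tau 0 k * x) = 2 * P k.
Proof.
move=> N0; under eq_Rintegral => x _ do rewrite -[tau 0 k * x]addr0.
rewrite (@integral_fejer_period _ _ _ _ _ _ 2)//.
- by rewrite opprK mulr_natl mulr2n.
- by rewrite gtrN// P0.
- by rewrite opprK /P; field; rewrite gt_eqF.
- by rewrite gt_eqF.
Qed.

Lemma kernel_mass N : (0 < N)%N -> \int[lam]_(x in period_box) kernel N x = \prod_k (2 * P k).
Proof.
move=> N0; apply: (prod_factor (h := fun k x => fejer N (tau 0 k * x))) => [k|k x|k]; [exact: cfejer|exact: fejer_ge0|exact: mass_fejer].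
Qed.

Let penalty (x : 'rV[R]_n) := \sum_k (2 - 2 * cos (tau 0 k * x 0 k)).

Let cpenalty1 k : continuous (fun x : 'rV[R]_n => 2 - 2 * cos (tau 0 k * x 0 k)).
Proof.
move=> x; apply: (cvg_comp _ (fun r => 2 - 2 * cos (tau 0 k * r))); first exact: continuous_coord.
apply: cvgB; first exact: cvg_cst.
apply: cvgMl_tmp; apply: (cvg_comp _ cos); [exact: cmul|exact: continuous_cos].
Qed.

Let cpenalty : continuous penalty.
Proof. by apply: continuous_big => [|k _]; [exact: add_continuous|exact: cpenalty1]. Qed.

Let penalty1_ge0 k (x : 'rV[R]_n) : 0 <= 2 - 2 * cos (tau 0 k * x 0 k).
Proof. by have := cos_le1 (tau 0 k * x 0 k); lra. Qed.

Lemma kernel_penalty N : (0 < N)%N ->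
  \int[lam]_(x in period_box) (penalty x * kernel N x) <= n%:R * (4 / N%:R) * \prod_k (2 * P k).
Proof.
move=> N0.
have cpk k : continuous (fun x : 'rV[R]_n => (2 - 2 * cos (tau 0 k * x 0 k)) * kernel N x).
  by move=> x; exact: (cvgM (@cpenalty1 k x) (@ckernel N x)).
rewrite (_ : \int[_]_(x in _) _ =
    \int[lam]_(x in period_box) (\sum_k (2 - 2 * cos (tau 0 k * x 0 k)) * kernel N x)); last first.
  by apply: eq_Rintegral => x _; rewrite mulr_suml.
rewrite Rintegral_sum//; last by move=> k; exact: icont.
rewrite [leRHS](_ : _ = \sum_(k < n) 4 / N%:R * \prod_k (2 * P k)); last first.
  by rewrite sumr_const card_ord -[RHS]mulr_natl !mulrA.
apply: ler_sum => k _.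
pose h j : R -> R := if j == k then cst 1 else fun x => fejer N (tau 0 j * x).
have ch j : continuous (h j).
  by rewrite /h; case: ifP => _; [exact: cst_continuous|exact: cfejer].
have h0 j x : 0 <= h j x by rewrite /h; case: ifP => _ //; exact: fejer_ge0.
have hP j : \int[mu]_(x in `[- P j, P j]) h j x = 2 * P j.
  rewrite /h; case: ifP => _; last exact: mass_fejer.
  rewrite (Rintegral_cst mu)// mul1r /= lebesgue_measure_itv/= lte_fin gtrN//=.
  by rewrite opprK mulr_natl mulr2n.
have cph : continuous (fun x : 'rV[R]_n => \prod_j h j (x 0 j)).
  apply: continuous_big => [|j _ x]; first exact: mul_continuous.
  by apply: (cvg_comp _ (h j)); [exact: continuous_coord|exact: ch].
rewrite -(prod_factor ch h0 hP) -RintegralZl//; last exact: icont.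
apply: le_Rintegral => //.
- exact: icont.
- exact: (integrableZl mbox _ (icont cph)).
move=> x _; rewrite /kernel (bigD1 k)//= [in leRHS](bigD1 k)//= {1}/h eqxx mul1r mulrA.
rewrite [X in _ <= _ * X](eq_bigr (fun j => fejer N (tau 0 j * x 0 j))); last by move=> j /negbTE jk; rewrite /h jk.
by rewrite ler_wpM2r ?fejer_decay//; apply: prodr_ge0 => j _; exact: fejer_ge0.
Qed.


(** The product kernels concentrate at the points of period_box that are
    congruent to 0 modulo the periods, where g vanishes. *)
Lemma integral_kernel_small (g : 'rV[R]_n -> R) e : continuous g ->
  (forall x, period_box x -> (forall k, x 0 k = 0 \/ `|x 0 k| = 2 * pi / tau 0 k) -> g x = 0) ->
  0 < e -> exists2 N, (0 < N)%N &
    `|\int[lam]_(x in period_box) (g x * \prod_k fejer N (tau 0 k * x 0 k))| <= e.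
Proof.
move=> cg gz e0; pose V := \prod_k (2 * P k).
have V0 : 0 < V by apply: prodr_gt0 => k _; rewrite mulr_gt0.
have e20 : 0 < e / 2 / V by rewrite !divr_gt0.
have penalty_ge0 x : 0 <= penalty x by apply: sumr_ge0 => k _; exact: penalty1_ge0.
have gpen x : period_box x -> penalty x = 0 -> g x = 0.
  move=> bx /eqP; rewrite psumr_eq0; last by move=> k _; exact: penalty1_ge0.
  move=> /allP pk; apply: gz => // k.
  have := pk k (mem_index_enum _) => /eqP ck.
  have {}ck : cos (tau 0 k * x 0 k) = 1 by lra.
  have := bx k; rewrite !mxE => xk.
  have [->|xkP] := eqVneq `|x 0 k| (P k); first by right.
  left; have : tau 0 k * x 0 k = 0.
    apply: cos_eq1 => //; rewrite normrM gtr0_norm//.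
    have -> : 2 * pi = tau 0 k * P k by rewrite /P; field; rewrite gt_eqF.
    by rewrite ltr_pM2l// lt_neqAle xkP ler_norml.
  by move/eqP; rewrite mulf_eq0 gt_eqF//= => /eqP.
have [M M0 Mb] := penalty_bound (@compact_box _ _) cg cpenalty (fun x _ => penalty_ge0 x) gpen e20.
pose N := (Num.truncn (M * n%:R * 8 * V / e)).+1.
have N0 : (0 < N)%N by [].
exists N => //.
have NR : 0 < N%:R :> R by rewrite ltr0n.
have cgk : continuous (fun x : 'rV[R]_n => g x * kernel N x).
  by move=> x; exact: (cvgM (cg x) (@ckernel N x)).
have cpk : continuous (fun x : 'rV[R]_n => penalty x * kernel N x).
  by move=> x; exact: (cvgM (@cpenalty x) (@ckernel N x)).
apply: (le_trans (le_normr_Rintegral mbox (icont cgk))).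
apply: (@le_trans _ _ (\int[lam]_(x in period_box)
    (e / 2 / V * kernel N x + M * (penalty x * kernel N x)))).
  apply: le_Rintegral => //.
  - by apply: icont => x; exact: (cvg_norm (cgk x)).
  - exact: (integrableD mbox (integrableZl mbox (e / 2 / V) (icont (@ckernel N)))
      (integrableZl mbox M (icont cpk))).
  - move=> x bx; rewrite normrM [X in _ * X]ger0_norm//.
    by rewrite mulrA -mulrDl ler_wpM2r// Mb.
rewrite RintegralD//; last 2 first.
- exact: (integrableZl mbox _ (icont (@ckernel N))).
- exact: (integrableZl mbox _ (icont cpk)).
rewrite RintegralZl//; last exact: icont.
rewrite RintegralZl//; last exact: icont.
rewrite kernel_mass// -/V.
have -> : e / 2 / V * V = e / 2 by field; rewrite gt_eqF.
rewrite [leRHS](splitr e) lerD2l.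
apply: (@le_trans _ _ (M * (n%:R * (4 / N%:R) * V))); first by rewrite ler_wpM2l// kernel_penalty.
have : M * n%:R * 8 * V / e < N%:R by exact: truncnS_gt.
rewrite ltr_pdivrMr// => h.
rewrite (_ : M * _ = (M * n%:R * 8 * V) / 2 / N%:R); last by field; rewrite gt_eqF.
by rewrite ler_pdivrMr//; lra.
Qed.

End rV_fejer.

(** * Fourier integrals of weights supported in a cube *)

Section fourier_cube.
Variables (R : realType) (n : nat) (sigma : R).
Notation lam := (@lebesgue_rV R n).
Hypothesis sigma_gt0 : 0 < sigma.

Lemma dotrvDr (x s t : 'rV[R]_n) : dotrv x (s + t) = dotrv x s + dotrv x t.
Proof. by rewrite /dotrv -big_split/=; apply: eq_bigr => k _; rewrite mxE mulrDr. Qed.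

Lemma dotrvZr (x t : 'rV[R]_n) c : dotrv x (c *: t) = c * dotrv x t.
Proof. by rewrite /dotrv mulr_sumr; apply: eq_bigr => k _; rewrite mxE mulrCA. Qed.

Lemma dotrvC (x t : 'rV[R]_n) : dotrv x t = dotrv t x.
Proof. by apply: eq_bigr => k _; rewrite mulrC. Qed.

Lemma continuous_dotrv (t : 'rV[R]_n) : continuous (fun x => dotrv x t).
Proof.
apply: continuous_big => [|k _ x]; first exact: add_continuous.
apply: (cvg_comp _ (fun r => r * t 0 k)); first exact: continuous_coord.
by apply: cvgMr_tmp; exact: cvg_id.
Qed.

Lemma cubeE : cube sigma = box (\row_(k < n) - sigma) (\row_k sigma).
Proof. by apply/seteqP; split => x /= H k; have := H k; rewrite !mxE ler_norml. Qed.

Lemma measurable_cube : measurable (cube sigma : set 'rV[R]_n).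
Proof. by rewrite cubeE; exact: measurable_box. Qed.

Lemma cube_finite : (lam (cube sigma) < +oo)%E.
Proof. by rewrite cubeE; exact: box_finite. Qed.

Lemma dotrv_cube_le (x t : 'rV[R]_n) : cube sigma x -> `|dotrv x t| <= \sum_k sigma * `|t 0 k|.
Proof.
move=> cx; rewrite /dotrv (le_trans (ler_norm_sum _ _ _))// ler_sum// => k _.
by rewrite normrM ler_wpM2r// cx.
Qed.

(** The real part of the inverse Fourier transform of A - iB, unnormalized. *)
Definition fint (A B : 'rV[R]_n -> R) (t : 'rV[R]_n) : R :=
  \int[lam]_(x in cube sigma) (A x * cos (dotrv x t) + B x * sin (dotrv x t)).

Section weights.
Variables (A B : 'rV[R]_n -> R) (C : R).
Hypotheses (mA : measurable_fun setT A) (mB : measurable_fun setT B).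
Hypotheses (AC : forall x, cube sigma x -> `|A x| <= C).
Hypotheses (BC : forall x, cube sigma x -> `|B x| <= C).

Lemma measurable_dotrv D t : measurable_fun D (fun x : 'rV[R]_n => dotrv x t).
Proof. by apply: measurable_funTS; apply: continuous_measurable_rV; exact: continuous_dotrv. Qed.

Lemma measurable_fint_integrand t : measurable_fun (cube sigma)
  (fun x => A x * cos (dotrv x t) + B x * sin (dotrv x t)).
Proof.
rewrite (_ : (fun x => _) = (fun x => A x * cos (1 * dotrv x t) + B x * sin (1 * dotrv x t))).
  by apply: measurable_osc; [exact: measurable_dotrv|exact: measurable_funTS|exact: measurable_funTS].
by apply/funext => x; rewrite mul1r.
Qed.

Lemma fint_integrand_le t x : cube sigma x ->
  `|A x * cos (dotrv x t) + B x * sin (dotrv x t)| <= C *+ 2.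
Proof. by move=> cx; apply: norm_trig_le; [exact: AC|exact: BC]. Qed.

(** Moving along a line turns the Fourier integral into a one-parameter
    oscillatory integral, with the weight modulated by the base point. *)
Lemma fint_line (t v : 'rV[R]_n) (s : R) : fint A B (t + s *: v) =
  osc lam (cube sigma) (fun x => dotrv x v)
    (fun x => A x * cos (dotrv x t) + B x * sin (dotrv x t))
    (fun x => B x * cos (dotrv x t) - A x * sin (dotrv x t)) s.
Proof.
by apply: eq_Rintegral => x _; rewrite dotrvDr dotrvZr cosD sinD; ring.
Qed.

Lemma continuous_fint : continuous (fint A B).
Proof.
apply: (continuous_Rintegral measurable_cube cube_finite (M := C *+ 2)).
- exact: measurable_fint_integrand.
- by move=> t x; exact: fint_integrand_le.
move=> x _ t; have ct : dotrv x s @[s --> t] --> dotrv x t.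
  rewrite (_ : dotrv x = (fun t => dotrv t x)); first exact: continuous_dotrv.
  by apply/funext => ?; exact: dotrvC.
exact: (cvgD (cvgMl_tmp (cvg_comp _ cos ct (@continuous_cos _ _)))
  (cvgMl_tmp (cvg_comp _ sin ct (@continuous_sin _ _)))).
Qed.

End weights.

Section lattice.
Variables (A B : 'rV[R]_n -> R).
Hypotheses (cA : continuous A) (cB : continuous B).
Hypotheses (A_cube : forall x, ~ cube sigma x -> A x = 0) (B_cube : forall x, ~ cube sigma x -> B x = 0).
Hypotheses (A0 : A 0 = 0) (B0 : B 0 = 0).
Variable tau : 'rV[R]_n.
Hypotheses (tau_gt0 : forall k, 0 < tau 0 k) (tau_le : forall k, tau 0 k <= 2 * pi / sigma).

(** Continuity carries the vanishing to the faces of the cube, on which the dual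
    lattice points lie in the critical case tau_k = 2 pi/sigma. *)
Lemma cube_boundary_eq0 (f : 'rV[R]_n -> R) (x : 'rV[R]_n) k : continuous f ->
  (forall x, ~ cube sigma x -> f x = 0) -> sigma <= `|x 0 k| -> f x = 0.
Proof.
move=> cf f0 xk; pose y (j : nat) : 'rV[R]_n := (1 + j.+1%:R^-1) *: x.
have cy : y j @[j --> \oo] --> x.
  rewrite -[X in _ --> X]scale1r; apply: cvgZr_tmp.
  rewrite -[X in _ --> X]addr0; apply: cvgD; first exact: cvg_cst.
  exact: cvg_harmonic.
have := cvg_comp y f cy (cf x).
have -> : f \o y = cst 0.
  apply/funext => j; apply: f0 => /(_ k); apply/negP; rewrite -ltNge mxE normrM.
  have j0 : 0 < j.+1%:R^-1 :> R by rewrite invr_gt0 ltr0n.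
  rewrite gtr0_norm ?addr_gt0// mulrDl mul1r.
  by rewrite (le_lt_trans xk)// ltrDl mulr_gt0// (lt_le_trans sigma_gt0).
by move=> /(cvg_unique _ (cvg_cst 0)) => <-.
Qed.

Let half_period_ge k : sigma <= 2 * pi / tau 0 k.
Proof. by rewrite ler_pdivlMr// mulrC -ler_pdivlMr. Qed.

Let sub_cube : cube sigma `<=` period_box tau.
Proof.
move=> x cx k; rewrite !mxE -ler_norml; exact: le_trans (half_period_ge k).
Qed.

(** The Fejer means of the values at a lattice tend to the sum of A - iB over
    the dual lattice, which vanishes; if no value is positive, all are 0. *)
Lemma fint_lattice_eq0 a :
  (forall p q : 'I_n -> nat,
    fint A B (a + \row_k (tau 0 k * ((p k)%:R - (q k)%:R))) <= 0) ->
  fint A B a = 0.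
Proof.
move=> neg.
have ua0 : fint A B a <= 0.
  have := neg (fun=> 0%N) (fun=> 0%N); rewrite (_ : \row_k _ = 0) ?addr0//.
  by apply/rowP => k; rewrite !mxE subrr mulr0.
pose g (x : 'rV[R]_n) := A x * cos (dotrv x a) + B x * sin (dotrv x a).
have cg : continuous g.
  move=> x; have ct : dotrv y a @[y --> x] --> dotrv x a by exact: continuous_dotrv.
  have cc : cos (dotrv y a) @[y --> x] --> cos (dotrv x a).
    by apply: (cvg_comp _ cos ct); exact: continuous_cos.
  have cs : sin (dotrv y a) @[y --> x] --> sin (dotrv x a).
    by apply: (cvg_comp _ sin ct); exact: continuous_sin.
  exact: (cvgD (cvgM (@cA x) cc) (cvgM (@cB x) cs)).
have mA := continuous_measurable_rV cA; have mB := continuous_measurable_rV cB.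
have bounded_cube (f : 'rV[R]_n -> R) : continuous f -> exists M, forall x, cube sigma x -> `|f x| <= M.
  move=> cf; have cn : continuous (fun x : 'rV[R]_n => `|f x|).
    by move=> x; exact: (cvg_norm (cf x)).
  have ne : (cube sigma : set 'rV[R]_n) !=set0.
    by exists 0 => k; rewrite mxE normr0 ltW.
  have cc : compact (cube sigma : set 'rV[R]_n) by rewrite cubeE; exact: compact_box.
  have [c _ cP] := compact_EVT_max ne cc (continuous_subspaceT cn).
  by exists `|f c| => x cx; apply: cP; rewrite inE.
have [M1 M1P] := bounded_cube A cA; have [M2 M2P] := bounded_cube B cB.
pose M := Num.max M1 M2.
have AM x : cube sigma x -> `|A x| <= M by move=> /M1P h; rewrite le_max h.
have BM x : cube sigma x -> `|B x| <= M by move=> /M2P h; rewrite le_max h orbT.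
apply/eqP; rewrite eq_le ua0/= leNgt; apply/negP => ua_lt0.
have e0 : 0 < - fint A B a / 2 by rewrite divr_gt0// oppr_gt0.
have gz (x : 'rV[R]_n) : period_box tau x -> (forall k, x 0 k = 0 \/ `|x 0 k| = 2 * pi / tau 0 k) -> g x = 0.
  move=> _ xz; have [[k xk]|x0] := pselect (exists k, x 0 k != 0); last first.
    have -> : x = 0.
      apply/rowP => k; rewrite mxE; apply/eqP; apply: contrapT => xk.
      by apply: x0; exists k; exact/negP.
    by rewrite /g A0 B0 !mul0r addr0.
  have sk : sigma <= `|x 0 k| by case: (xz k) => [xk0|-> //]; move: xk; rewrite xk0 eqxx.
  by rewrite /g (cube_boundary_eq0 cA A_cube sk) (cube_boundary_eq0 cB B_cube sk) !mul0r addr0.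
have [N N0 small] := integral_kernel_small tau_gt0 cg gz e0.
have NN0 : 0 < \prod_(k < n) (N%:R : R) by apply: prodr_gt0 => k _; rewrite ltr0n.
pose K (x : 'rV[R]_n) := \prod_k fejer N (tau 0 k * x 0 k).
have cgK : continuous (fun x => g x * K x).
  have cK : continuous K.
    apply: continuous_big => [|k _ x]; first exact: mul_continuous.
    apply: (cvg_comp _ (fun r => fejer N (tau 0 k * r))); first exact: continuous_coord.
    apply: (cvg_comp _ (fejer N)); last exact: continuous_fejer.
    by apply: cvgMl_tmp; exact: cvg_id.
  by move=> x; exact: (cvgM (cg x) (@cK x)).
have KE : \int[lam]_(x in cube sigma) (g x * K x) = \int[lam]_(x in period_box tau) (g x * K x).
  rewrite Rintegral_mkcond [RHS]Rintegral_mkcond; apply: eq_Rintegral => x _.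
  rewrite /patch; case: ifPn => [|ncx]; first by rewrite inE => /sub_cube bx; rewrite mem_set.
  case: ifPn => // _; rewrite /g A_cube ?B_cube ?mul0r ?addr0 ?mul0r//; rewrite notin_setE in ncx; exact: ncx.
have iu t : lam.-integrable (cube sigma)
    (EFin \o (fun x => A x * cos (dotrv x t) + B x * sin (dotrv x t))).
  apply: (bounded_integrable measurable_cube cube_finite (M := M *+ 2)).
    exact: measurable_fint_integrand.
  by move=> x cx; exact: fint_integrand_le.
have sumE : \sum_(p : {ffun 'I_n -> 'I_N}) \sum_(q : {ffun 'I_n -> 'I_N})
    fint A B (a + \row_k (tau 0 k * ((p k)%:R - (q k)%:R))) =
    (\prod_(k < n) N%:R) * \int[lam]_(x in period_box tau) (g x * K x).
  have mc := measurable_cube.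
  pose F (p q : {ffun 'I_n -> 'I_N}) x :=
    A x * cos (dotrv x (a + \row_k (tau 0 k * ((p k)%:R - (q k)%:R)))) +
    B x * sin (dotrv x (a + \row_k (tau 0 k * ((p k)%:R - (q k)%:R)))).
  transitivity (\int[lam]_(x in cube sigma) (\sum_p \sum_q F p q x)).
    rewrite Rintegral_sum//; last first.
      move=> p; rewrite (_ : _ \o _ = (fun x => \sum_q (F p q x)%:E)%E).
        by apply: integrable_sum => // q _; exact: iu.
      by apply/funext => x /=; rewrite sumEFin.
    by apply: eq_bigr => p _; rewrite Rintegral_sum// => q; exact: iu.
  rewrite -KE -RintegralZl//.
    apply: eq_Rintegral => x _.
    have [Ec Es] := trig_double_sum N (dotrv x a) (fun k => tau 0 k * x 0 k).
    transitivity (A x * (\sum_(p : {ffun 'I_n -> 'I_N}) \sum_(q : {ffun 'I_n -> 'I_N})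
          cos (dotrv x a + \sum_k (tau 0 k * x 0 k) * ((p k)%:R - (q k)%:R))) +
        B x * (\sum_(p : {ffun 'I_n -> 'I_N}) \sum_(q : {ffun 'I_n -> 'I_N})
          sin (dotrv x a + \sum_k (tau 0 k * x 0 k) * ((p k)%:R - (q k)%:R)))).
      rewrite !mulr_sumr -big_split/=; apply: eq_bigr => p _.
      rewrite !mulr_sumr -big_split/=; apply: eq_bigr => q _.
      rewrite /F dotrvDr.
      have -> : dotrv x (\row_k (tau 0 k * ((p k)%:R - (q k)%:R))) =
          \sum_k (tau 0 k * x 0 k) * ((p k)%:R - (q k)%:R); last by [].
      by apply: eq_bigr => k _; rewrite mxE; ring.
    by rewrite Ec Es big_split/= /g /K; ring.
  have [M3 M3P] := bounded_cube _ cgK.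
  apply: (bounded_integrable measurable_cube cube_finite (M := M3)) => //.
  by apply: measurable_funTS; exact: continuous_measurable_rV.
have : \sum_(p : {ffun 'I_n -> 'I_N}) \sum_(q : {ffun 'I_n -> 'I_N})
    fint A B (a + \row_k (tau 0 k * ((p k)%:R - (q k)%:R))) <=
    (\prod_(k < n) N%:R) * fint A B a.
  (* only the diagonal q = p is kept *)
  apply: (@le_trans _ _ (\sum_(p : {ffun 'I_n -> 'I_N}) fint A B a)).
    apply: ler_sum => p _; rewrite (bigD1 p)//= -[leRHS]addr0; apply: lerD.
      rewrite (_ : \row_k _ = 0) ?addr0//; apply/rowP => k; by rewrite !mxE subrr mulr0.
    by apply: sumr_le0 => q _; exact: (neg (fun k => p k) (fun k => q k)).
  by rewrite sumr_const prodr_const card_ffun !card_ord -natrX mulr_natl lexx.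
rewrite sumE ler_pM2l// => h; move: small; rewrite ler_norml => /andP[h' _].
by have := le_trans h' h; lra.
Qed.

End lattice.

End fourier_cube.

(** * The Laplace kernel and its Fourier transform *)

Section laplace.
Variable R : realType.
Notation mu := (@lebesgue_measure R).
Variable e : R.
Hypothesis e0 : 0 < e.

(** The kernel exp (- e |x|) is chosen because its Fourier transform, the Poisson
    kernel, is positive and has the arctangent as a primitive. *)
Definition laplace (x : R) : R := expR (- (e * `|x|)).

Definition poisson (t : R) : R := 2 * e / (e ^+ 2 + t ^+ 2).

Let den_gt0 t : 0 < e ^+ 2 + t ^+ 2.
Proof. by rewrite ltr_pwDl ?exprn_gt0 ?sqr_ge0. Qed.

Let ge0_integral_half (f : R -> R) : (forall x, 0 <= f x) -> continuous f ->
  (\int[mu]_x (f x)%:E = \int[mu]_(x in `[0%R, +oo[) (f x + f (- x))%:E)%E.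
Proof.
move=> f0 cf.
have mf : measurable_fun [set: R] f by exact: continuous_measurable_fun.
have cfN : continuous (f \o -%R).
  by move=> x; apply: (cvg_comp _ f); [exact: opp_continuous|exact: cf].
have mfN : measurable_fun [set: R] (f \o -%R) by exact: continuous_measurable_fun.
rewrite -(setUv `[0%R, +oo[%classic) ge0_integral_setU//=; last 4 first.
- exact: measurableC.
- by apply/measurable_EFinP; rewrite setUv.
- by move=> x _; rewrite lee_fin.
- exact/disj_setPCl.
rewrite setCitvr integral_itv_bndo_bndc; last exact/measurable_EFinP/measurable_funTS.
rewrite -{2}oppr0 ge0_integration_by_substitutionNy//; last exact: continuous_subspaceT.
rewrite -ge0_integralD//.
- by move=> x _; rewrite lee_fin.
- exact/measurable_EFinP/measurable_funTS.
- by move=> x _; rewrite lee_fin; exact: f0.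
- exact/measurable_EFinP/measurable_funTS.
Qed.

Let integral_half_line (b t : R) : `|b| <= 1 ->
  (\int[mu]_(x in `[0%R, +oo[) (expR (- (e * x)) * (1 + b * cos (x * t)))%:E =
   (e^-1 + b * (e / (e ^+ 2 + t ^+ 2)))%:E)%E.
Proof.
move=> b1.
pose F (x : R) := expR (- (e * x)) * (- e^-1 + b * ((t * sin (x * t) - e * cos (x * t)) / (e ^+ 2 + t ^+ 2))).
have dF (x : R) : is_derive x 1 F (expR (- (e * x)) * (1 + b * cos (x * t))).
  have h1 : is_derive x 1 (fun x : R => - (e * x)) (- e).
    by apply: is_derive_eq; rewrite /GRing.scale/=; ring.
  have hE : is_derive x 1 (fun x : R => expR (- (e * x))) (expR (- (e * x)) * - e).
    exact: (@is_derive1_comp _ expR (fun x => - (e * x))).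
  have hx : is_derive x 1 (fun s : R => s * t) t.
    by apply: is_derive_eq; rewrite scaler0 add0r /GRing.scale/= mulr1.
  have hc : is_derive x 1 (fun s : R => cos (s * t)) (- sin (x * t) * t).
    exact: (@is_derive1_comp _ cos (fun s => s * t)).
  have hs : is_derive x 1 (fun s : R => sin (s * t)) (cos (x * t) * t).
    exact: (@is_derive1_comp _ sin (fun s => s * t)).
  apply: is_derive_eq; rewrite /GRing.scale/=; field.
  by rewrite !gt_eqF.
have cF : continuous F.
  move=> x; apply: differentiable_continuous; apply/derivable1_diffP; by have [] := dF x.
rewrite (@ge0_continuous_FTC2y _ _ F 0 0).
- by rewrite /F mul0r sin0 cos0 mulr0 oppr0 expR0 -EFinB; congr EFin; field; rewrite !gt_eqF.
- move=> x _; rewrite mulr_ge0 ?expR_ge0//.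
  have : `|b * cos (x * t)| <= 1.
    by rewrite normrM mulr_ile1// ler_norml cos_geN1 cos_le1.
  by rewrite ler_norml => /andP[+ _]; rewrite -subr_ge0 opprK addrC.
- apply: continuous_subspaceT => x; apply: cvgM.
    apply: (cvg_comp _ expR); last exact: continuous_expR.
    by apply: cvgN; apply: cvgMl_tmp; exact: cvg_id.
  apply: cvgD; first exact: cvg_cst.
  apply: cvgMl_tmp; apply: (cvg_comp _ cos); last exact: continuous_cos.
  by apply: cvgMr_tmp; exact: cvg_id.
- pose c := e^-1 + (`|t| + e) / (e ^+ 2 + t ^+ 2).
  apply: norm_cvg0.
  have : expR (- (e * x)) * c @[x --> +oo] --> 0.
    rewrite -[X in _ --> X](mul0r c); apply: cvgMr_tmp.
    apply: (cvg_comp (fun x => e * x) (fun x => expR (- x))); last exact: cvgr_expR.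
    by apply: gt0_cvgMry => //; exact: cvg_id.
  apply: (squeeze_cvgr _ (cvg_cst 0)); apply: nearW => x.
  rewrite normr_ge0/= /F normrM (ger0_norm (expR_ge0 _)) ler_wpM2l ?expR_ge0//.
  rewrite (le_trans (ler_normD _ _))// normrN (gtr0_norm (x := e^-1)) ?invr_gt0// lerD2l.
  rewrite normrM -[leRHS]mul1r ler_pM// normrM normfV (gtr0_norm (den_gt0 t)).
  rewrite ler_wpM2r ?invr_ge0 ?(ltW (den_gt0 t))// (le_trans (ler_normB _ _))// !normrM (gtr0_norm e0).
  by apply: lerD; rewrite -[leRHS]mulr1 ler_wpM2l ?(ltW e0)// ler_norml ?sin_geN1 ?sin_le1 ?cos_geN1 ?cos_le1.
- by move=> x _; have [] := dF x.
- by apply: cvg_at_right_filter; exact: cF.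
- by move=> x _; rewrite derive1E; exact: derive_val.
Qed.

Let claplace : continuous laplace.
Proof.
move=> x; apply: (cvg_comp _ expR); last exact: continuous_expR.
by apply: cvgN; apply: cvgMl_tmp; apply: cvg_norm; exact: cvg_id.
Qed.

Lemma measurable_laplace : measurable_fun setT laplace.
Proof. exact: continuous_measurable_fun. Qed.

Lemma laplace_ge0 x : 0 <= laplace x.
Proof. exact: expR_ge0. Qed.

Lemma laplace_le1 x : laplace x <= 1.
Proof. by rewrite -expR0 ler_expR oppr_le0 mulr_ge0// ltW. Qed.

Let laplaceN x : laplace (- x) = laplace x.
Proof. by rewrite /laplace normrN. Qed.

(* The factor 1 + b cos + c sin is nonnegative, which makes the signed integrals
   differences of nonnegative ones. *)
Let laplace_trig (b c t : R) : `|b| <= 1 -> `|c| <= 1 -> b * c = 0 ->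
  (\int[mu]_x (laplace x * (1 + b * cos (x * t) + c * sin (x * t)))%:E =
   (2 / e + b * poisson t)%:E)%E.
Proof.
move=> b1 c1 bc0.
have ccos : continuous (fun x : R => cos (x * t)).
  move=> x; apply: (cvg_comp _ cos); last exact: continuous_cos.
  by apply: cvgMr_tmp; exact: cvg_id.
have csin : continuous (fun x : R => sin (x * t)).
  move=> x; apply: (cvg_comp _ sin); last exact: continuous_sin.
  by apply: cvgMr_tmp; exact: cvg_id.
rewrite ge0_integral_half.
- transitivity (\int[mu]_(x in `[0%R, +oo[) (2%:E * (expR (- (e * x)) * (1 + b * cos (x * t)))%:E))%E.
    apply: eq_integral => x; rewrite inE/= in_itv/= andbT => x0.
    rewrite laplaceN mulNr cosN sinN /laplace ger0_norm// -EFinM; congr EFin; ring.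
  rewrite ge0_integralZl_EFin//.
  + by rewrite integral_half_line// -EFinM /poisson; congr EFin; field; rewrite !gt_eqF.
  + move=> x _; rewrite lee_fin mulr_ge0 ?expR_ge0//.
    have : `|b * cos (x * t)| <= 1.
      by rewrite normrM mulr_ile1// ler_norml cos_geN1 cos_le1.
    by rewrite ler_norml => /andP[+ _]; rewrite -subr_ge0 opprK addrC.
  + apply/measurable_EFinP; apply: measurable_funTS; apply: continuous_measurable_fun => x.
    apply: cvgM.
      apply: (cvg_comp _ expR); last exact: continuous_expR.
      by apply: cvgN; apply: cvgMl_tmp; exact: cvg_id.
    by apply: cvgD; [exact: cvg_cst|apply: cvgMl_tmp; exact: ccos].
- move=> x; rewrite mulr_ge0 ?laplace_ge0//.
  have b2 : `|b * cos (x * t)| <= 1.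
    by rewrite normrM mulr_ile1// ler_norml cos_geN1 cos_le1.
  have c2 : `|c * sin (x * t)| <= 1.
    by rewrite normrM mulr_ile1// ler_norml sin_geN1 sin_le1.
  move: b2 c2; rewrite !ler_norml => /andP[b2 _] /andP[c2 _].
  by have /eqP := bc0; rewrite mulf_eq0 => /orP[/eqP b0|/eqP c0]; move: b2 c2; rewrite ?b0 ?c0; lra.
- move=> x; apply: cvgM; first exact: claplace.
  apply: cvgD; last by apply: cvgMl_tmp; exact: csin.
  by apply: cvgD; [exact: cvg_cst|apply: cvgMl_tmp; exact: ccos].
Qed.

Lemma integral_laplace : (\int[mu]_x (laplace x)%:E = (2 / e)%:E)%E.
Proof.
rewrite -[RHS](_ : (2 / e + 0 * poisson 0)%:E = _); last by rewrite mul0r addr0.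
rewrite -(@laplace_trig 0 0 0) ?normr0 ?mul0r//.
by apply: eq_integral => x _; rewrite !mul0r !addr0 mulr1.
Qed.

Lemma integrable_laplace_trig (f : R -> R) : measurable_fun setT f -> (forall x, `|f x| <= 1) ->
  mu.-integrable setT (EFin \o (fun x => laplace x * f x)).
Proof.
move=> mf f1; apply: (@le_integrable _ _ _ mu _ measurableT _ (EFin \o laplace)).
- by apply/measurable_EFinP/measurable_funM => //; exact: measurable_laplace.
- by move=> x _ /=; rewrite lee_fin normrM ler_piMr.
- apply/integrableP; split; first by apply/measurable_EFinP; exact: measurable_laplace.
  rewrite (_ : (\int[_]_(x in _) _)%E = (\int[mu]_x (laplace x)%:E)%E).
    by rewrite integral_laplace ltry.
  by apply: eq_integral => x _ /=; rewrite ger0_norm ?laplace_ge0.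
Qed.

Let mtrig (t : R) : measurable_fun setT (fun x : R => cos (x * t)) /\ measurable_fun setT (fun x : R => sin (x * t)).
Proof.
have ct : continuous (fun x : R => x * t) by move=> x; apply: cvgMr_tmp; exact: cvg_id.
split; apply: continuous_measurable_fun => x.
  by apply: (cvg_comp _ cos); [exact: ct|exact: continuous_cos].
by apply: (cvg_comp _ sin); [exact: ct|exact: continuous_sin].
Qed.

Lemma Rintegral_laplace_cos t : \int[mu]_x (laplace x * cos (x * t)) = poisson t.
Proof.
have [mc ms] := mtrig t.
have i1 : mu.-integrable setT (EFin \o (fun x => laplace x * 1)).
  by apply: integrable_laplace_trig => // x; rewrite normr1.
have ic : mu.-integrable setT (EFin \o (fun x => laplace x * cos (x * t))).
  by apply: integrable_laplace_trig => // x; rewrite ler_norml cos_geN1 cos_le1.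
have E1 : \int[mu]_x (laplace x * 1) = 2 / e.
  by rewrite /Rintegral; under eq_integral do rewrite mulr1; rewrite integral_laplace.
have : \int[mu]_x (laplace x * 1 + laplace x * cos (x * t)) = 2 / e + poisson t.
  rewrite /Rintegral -[RHS]/(fine (2 / e + poisson t)%:E); congr fine.
  rewrite -[poisson t]mul1r -(@laplace_trig 1 0 t) ?normr1 ?normr0 ?mulr0//.
  by apply: eq_integral => x _; rewrite mul0r addr0 mul1r mulrDr.
by rewrite RintegralD// E1 => /addrI.
Qed.

Lemma Rintegral_laplace_sin t : \int[mu]_x (laplace x * sin (x * t)) = 0.
Proof.
have [mc ms] := mtrig t.
have i1 : mu.-integrable setT (EFin \o (fun x => laplace x * 1)).
  by apply: integrable_laplace_trig => // x; rewrite normr1.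
have ic : mu.-integrable setT (EFin \o (fun x => laplace x * sin (x * t))).
  by apply: integrable_laplace_trig => // x; rewrite ler_norml sin_geN1 sin_le1.
have E1 : \int[mu]_x (laplace x * 1) = 2 / e.
  by rewrite /Rintegral; under eq_integral do rewrite mulr1; rewrite integral_laplace.
have : \int[mu]_x (laplace x * 1 + laplace x * sin (x * t)) = 2 / e + 0.
  rewrite /Rintegral -[RHS]/(fine (2 / e + 0)%:E); congr fine.
  rewrite -[X in (_ + X)%:E](mul0r (poisson t)) -(@laplace_trig 0 1 t) ?normr1 ?normr0 ?mul0r//.
  by apply: eq_integral => x _; rewrite mul0r addr0 mul1r mulrDr.
by rewrite RintegralD// E1 => /addrI.
Qed.

Lemma integral_poisson (a b s : R) : a <= b ->
  (\int[mu]_(x in `[a, b]) (poisson (x - s))%:E =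
   (2 * (atan ((b - s) / e) - atan ((a - s) / e)))%:E)%E.
Proof.
rewrite le_eqVlt => /predU1P[->|ab].
  by rewrite set_itv1 integral_set1 subrr mulr0.
pose F (x : R) := 2 * atan ((x - s) / e).
have dF (x : R) : is_derive x 1 F (poisson (x - s)).
  have h : is_derive x 1 (fun x : R => (x - s) / e) e^-1.
    by apply: is_derive_eq; rewrite /GRing.scale/=; ring.
  have ha : is_derive x 1 (fun x => atan ((x - s) / e)) ((1 + ((x - s) / e) ^+ 2)^-1 * e^-1).
    apply: (@is_derive1_comp _ atan (fun x => (x - s) / e)).
  apply: is_derive_eq; rewrite /GRing.scale/= /poisson; field.
  rewrite !gt_eqF//; have := den_gt0 (x - s); nra.
have cF : continuous F.
  move=> x; apply: differentiable_continuous; apply/derivable1_diffP; by have [] := dF x.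
rewrite (@continuous_FTC2 _ _ F)//.
- by rewrite /F -EFinB mulrBr.
- apply: continuous_subspaceT => x; apply: cvgM; first exact: cvg_cst.
  apply: cvgV; first by rewrite gt_eqF.
  apply: cvgD; first exact: cvg_cst.
  have cx : x - s @[x --> x] --> x - s by apply: cvgB; [exact: cvg_id|exact: cvg_cst].
  by rewrite expr2; under eq_fun do rewrite expr2; apply: cvgM.
- split.
  + by move=> x _; have [] := dF x.
  + by apply: cvg_at_right_filter; exact: cF.
  + by apply: cvg_at_left_filter; exact: cF.
- by move=> x _; rewrite derive1E; exact: derive_val.
Qed.

Lemma poisson_ge0 t : 0 <= poisson t.
Proof. by rewrite divr_ge0 ?mulr_ge0// ltW. Qed.

Lemma poisson_le t : poisson t <= 2 / e.
Proof.
rewrite ler_pdivrMr//; have -> : 2 / e * (e ^+ 2 + t ^+ 2) = 2 * e + 2 / e * t ^+ 2.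
  by field; rewrite gt_eqF.
by rewrite lerDl mulr_ge0 ?sqr_ge0// divr_ge0// ltW.
Qed.

Lemma continuous_poisson : continuous poisson.
Proof.
move=> t; apply: cvgM; first exact: cvg_cst.
apply: cvgV; first by rewrite gt_eqF.
apply: cvgD; first exact: cvg_cst.
by rewrite expr2; under eq_fun do rewrite expr2; apply: cvgM; exact: cvg_id.
Qed.

Lemma measurable_poisson : measurable_fun setT poisson.
Proof. exact: continuous_measurable_fun continuous_poisson. Qed.

End laplace.

(** * Inversion of the Fourier transform on boxes *)

Section kappa.
Variable R : realType.
Notation mu := (@lebesgue_measure R).
Notation lam := (@lebesgue_rV R).
Variable e : R.
Hypothesis e0 : 0 < e.

(** The product kernel has an explicit Fourier transform, the product of the
    Poisson kernels, which is nonnegative and integrates in closed form over boxes. *)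
Definition kappa n (x : 'rV[R]_n) : R := \prod_k laplace e (x 0 k).

Lemma kappa_ge0 n (x : 'rV[R]_n) : 0 <= kappa x.
Proof. by apply: prodr_ge0 => k _; exact: laplace_ge0. Qed.

Lemma kappa_le1 n (x : 'rV[R]_n) : kappa x <= 1.
Proof.
suff /andP[] : 0 <= kappa x <= 1 by [].
rewrite /kappa; elim/big_ind: _ => [|a b /andP[a0 a1] /andP[b0 b1]|k _].
- by rewrite ler01 lexx.
- by rewrite mulr_ge0//= mulr_ile1.
- by rewrite laplace_ge0 laplace_le1.
Qed.

Lemma measurable_kappa n : measurable_fun setT (@kappa n).
Proof.
apply: measurable_prod => k _; apply: measurableT_comp; first exact: measurable_laplace.
exact: measurable_coord_rV.
Qed.

Lemma integral_kappa n : (\int[lam n]_x (kappa x)%:E < +oo)%E.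
Proof.
rewrite (@integral_prod_rV _ n (fun=> laplace e));
  [|by move=> *; exact: laplace_ge0|by move=> *; exact: measurable_laplace].
rewrite -ge0_fin_numE; last by apply: prode_ge0 => k _; rewrite integral_laplace// lee_fin divr_ge0// ltW.
by apply: prode_fin_num => k _; rewrite integral_laplace.
Qed.

Lemma integrable_kappa n (f : 'rV[R]_n -> R) M : measurable_fun setT f -> (forall x, `|f x| <= M) ->
  (lam n).-integrable setT (EFin \o (fun x => kappa x * f x)).
Proof.
move=> mf fM; have Ik : (lam n).-integrable setT (EFin \o @kappa n).
  apply/integrableP; split; first by apply/measurable_EFinP; exact: measurable_kappa.
  rewrite (_ : (\int[_]_(x in _) _)%E = (\int[lam n]_x (kappa x)%:E)%E); first exact: integral_kappa.
  by apply: eq_integral => x _ /=; rewrite ger0_norm ?kappa_ge0.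
apply: (@le_integrable _ _ _ (lam n) _ measurableT _ (fun x => M%:E * (EFin \o @kappa n) x)%E).
- by apply/measurable_EFinP/measurable_funM => //; exact: measurable_kappa.
- move=> x _ /=; rewrite lee_fin !normrM mulrC ler_wpM2r//.
  by rewrite (le_trans (fM x))// ler_norm.
- exact: integrableZl.
Qed.

Let mcos n (t : 'rV[R]_n) : measurable_fun setT (fun x : 'rV[R]_n => cos (dotrv x t)).
Proof.
apply: measurableT_comp; first by apply: continuous_measurable_fun; exact: continuous_cos.
exact: measurable_dotrv.
Qed.

Let msin n (t : 'rV[R]_n) : measurable_fun setT (fun x : 'rV[R]_n => sin (dotrv x t)).
Proof.
apply: measurableT_comp; first by apply: continuous_measurable_fun; exact: continuous_sin.
exact: measurable_dotrv.
Qed.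

Let icos n (t : 'rV[R]_n) : (lam n).-integrable setT (EFin \o (fun x => kappa x * cos (dotrv x t))).
Proof. by apply: (integrable_kappa (M := 1)) => // x; rewrite ler_norml cos_geN1 cos_le1. Qed.

Let isin n (t : 'rV[R]_n) : (lam n).-integrable setT (EFin \o (fun x => kappa x * sin (dotrv x t))).
Proof. by apply: (integrable_kappa (M := 1)) => // x; rewrite ler_norml sin_geN1 sin_le1. Qed.

Lemma fourier_kappa n (t : 'rV[R]_n) :
  \int[lam n]_x (kappa x * cos (dotrv x t)) = \prod_k poisson e (t 0 k) /\
  \int[lam n]_x (kappa x * sin (dotrv x t)) = 0.
Proof.
elim: n t => [|n IH] t.
  have d0 (x : 'rV[R]_0) : dotrv x t = 0 by rewrite /dotrv big_ord0.
  split.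
    transitivity (\int[lam 0]_x (cst 1 x : R)).
      by apply: eq_Rintegral => x _; rewrite /kappa big_ord0 d0 cos0 mulr1.
    have l0 : lam 0 setT = 1%E by rewrite /= diracT.
    by rewrite (Rintegral_cst (lam 0))// big_ord0 mul1r; exact: (congr1 fine l0).
  transitivity (\int[lam 0]_x (cst 0 x : R)).
    by apply: eq_Rintegral => x _; rewrite d0 sin0 mulr0.
  by rewrite (Rintegral_cst (lam 0))// mul0r.
pose t' := (uncons_rV t).2; have [IHc IHs] := IH t'.
have kappaE z x : kappa (cons_rV (z, x)) = laplace e z * kappa x.
  rewrite /kappa big_ord_recl cons_rV0; congr (_ * _).
  by apply: eq_bigr => i _; rewrite cons_rV_lift.
have dE z x : dotrv (cons_rV (z, x)) t = z * t 0 ord0 + dotrv x t'.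
  rewrite /dotrv big_ord_recl cons_rV0; congr (_ + _).
  by apply: eq_bigr => i _; rewrite cons_rV_lift /t' mxE.
have inner (c d : R) : (\int[lam n]_x (c * (kappa x * cos (dotrv x t')) +
    d * (kappa x * sin (dotrv x t')))%:E)%E = (c * \prod_k poisson e (t' 0 k))%:E.
  have Ic := integrableZl measurableT c (icos t'); have Is := integrableZl measurableT d (isin t').
  rewrite (integral_integrable_EFin measurableT (integrableD measurableT Ic Is)).
  by rewrite RintegralD// !RintegralZl// IHc IHs mulr0 addr0.
have mc : measurable_fun setT (fun z : R => cos (z * t 0 ord0)).
  apply: continuous_measurable_fun => z; apply: (cvg_comp _ cos); last exact: continuous_cos.
  by apply: cvgMr_tmp; exact: cvg_id.
have ms : measurable_fun setT (fun z : R => sin (z * t 0 ord0)).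
  apply: continuous_measurable_fun => z; apply: (cvg_comp _ sin); last exact: continuous_sin.
  by apply: cvgMr_tmp; exact: cvg_id.
split.
  rewrite /Rintegral (integral_rV_succ (icos t)).
  transitivity (\int[mu]_z (\prod_k poisson e (t' 0 k) * (laplace e z * cos (z * t 0 ord0)))).
    congr fine; apply: eq_integral => z _.
    rewrite mulrC -(inner _ (- (laplace e z * sin (z * t 0 ord0)))).
    by apply: eq_integral => x _ /=; rewrite kappaE dE cosD; congr EFin; ring.
  rewrite RintegralZl//; last first.
    by apply: integrable_laplace_trig => // z; rewrite ler_norml cos_geN1 cos_le1.
  by rewrite Rintegral_laplace_cos// big_ord_recl mulrC; congr (_ * _); apply: eq_bigr => k _; rewrite mxE.
rewrite /Rintegral (integral_rV_succ (isin t)).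
transitivity (\int[mu]_z (\prod_k poisson e (t' 0 k) * (laplace e z * sin (z * t 0 ord0)))).
  congr fine; apply: eq_integral => z _.
  rewrite mulrC -(inner _ (laplace e z * cos (z * t 0 ord0))).
  by apply: eq_integral => x _ /=; rewrite kappaE dE sinD; congr EFin; ring.
rewrite RintegralZl//; last first.
  by apply: integrable_laplace_trig => // z; rewrite ler_norml sin_geN1 sin_le1.
by rewrite Rintegral_laplace_sin// mulr0.
Qed.

Section mixture.
Variables (n : nat) (m : probability 'rV[R]_n R).

(** The characteristic function of m is cchar - i schar. *)
Definition cchar (x : 'rV[R]_n) : R := \int[m]_t cos (dotrv x t).
Definition schar (x : 'rV[R]_n) : R := \int[m]_t sin (dotrv x t).

Let moo : (m setT < +oo)%E. Proof. by rewrite probability_setT ltry. Qed.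

Let mcos' (x : 'rV[R]_n) : measurable_fun setT (fun t : 'rV[R]_n => cos (dotrv x t)).
Proof. by under eq_fun do rewrite dotrvC; exact: mcos. Qed.

Let msin' (x : 'rV[R]_n) : measurable_fun setT (fun t : 'rV[R]_n => sin (dotrv x t)).
Proof. by under eq_fun do rewrite dotrvC; exact: msin. Qed.

Let norm_cos (r : R) : `|cos r| <= 1. Proof. by rewrite ler_norml cos_geN1 cos_le1. Qed.
Let norm_sin (r : R) : `|sin r| <= 1. Proof. by rewrite ler_norml sin_geN1 sin_le1. Qed.

Let icos' (x : 'rV[R]_n) : m.-integrable setT (EFin \o (fun t => cos (dotrv x t))).
Proof. exact: (bounded_integrable measurableT moo (M := 1)). Qed.

Let isin' (x : 'rV[R]_n) : m.-integrable setT (EFin \o (fun t => sin (dotrv x t))).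
Proof. exact: (bounded_integrable measurableT moo (M := 1)). Qed.

Lemma norm_cchar_le1 x : `|cchar x| <= 1.
Proof.
have E : fine (m setT) = 1 := congr1 fine (probability_setT m).
rewrite -[leRHS]E -[leRHS]mul1r.
exact: (norm_Rintegral_le measurableT moo (mcos' x) (fun t _ => norm_cos _)).
Qed.

Lemma norm_schar_le1 x : `|schar x| <= 1.
Proof.
have E : fine (m setT) = 1 := congr1 fine (probability_setT m).
rewrite -[leRHS]E -[leRHS]mul1r.
exact: (norm_Rintegral_le measurableT moo (msin' x) (fun t _ => norm_sin _)).
Qed.

Lemma continuous_cchar : continuous cchar.
Proof.
apply: (continuous_Rintegral measurableT moo (M := 1)) => // t _ x.
by apply: (cvg_comp _ cos); [exact: continuous_dotrv|exact: continuous_cos].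
Qed.

Lemma continuous_schar : continuous schar.
Proof.
apply: (continuous_Rintegral measurableT moo (M := 1)) => // t _ x.
by apply: (cvg_comp _ sin); [exact: continuous_dotrv|exact: continuous_sin].
Qed.

(** Fubini exchanges the regularized inversion integral of the characteristic
    function with the convolution of the measure by the Poisson kernel. *)
Lemma regularized_inversion s :
  \int[lam n]_x (kappa x * (cchar x * cos (dotrv x s) + schar x * sin (dotrv x s))) =
  \int[m]_t (\prod_k poisson e (s 0 k - t 0 k)).
Proof.
pose f (z : 'rV[R]_n * 'rV[R]_n) : R := kappa z.1 * cos (dotrv z.1 s - dotrv z.1 z.2).
have md : measurable_fun setT (fun z : 'rV[R]_n * 'rV[R]_n => dotrv z.1 z.2).
  apply: measurable_sum => k; apply: measurable_funM.
    exact: (measurableT_comp (measurable_coord_rV k) measurable_fst).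
  exact: (measurableT_comp (measurable_coord_rV k) measurable_snd).
have mf : measurable_fun setT f.
  apply: measurable_funM.
    exact: (measurableT_comp (@measurable_kappa n) measurable_fst).
  apply: measurableT_comp; first by apply: continuous_measurable_fun; exact: continuous_cos.
  apply: measurable_funB => //.
  exact: (measurableT_comp (@measurable_dotrv _ _ setT s) measurable_fst).
have If : (lam n \x m)%E.-integrable setT (EFin \o f).
  apply/integrable12ltyP; first exact/measurable_EFinP.
  apply: le_lt_trans (integral_kappa n).
  apply: ge0_le_integral => //.
  - by move=> x _; apply: integral_ge0 => t _.
  - apply: (@measurable_fun_fubini_tonelli_F _ _ _ _ _ m (fun z => `|(f z)%:E|)%E) => //.
    by apply: measurableT_comp => //; exact/measurable_EFinP.
  - by apply/measurable_EFinP; exact: measurable_kappa.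
  move=> x _; apply: (@le_trans _ _ (\int[m]_t (cst (kappa x)%:E t))%E).
    apply: ge0_le_integral => //.
    + apply: measurableT_comp => //; apply/measurable_EFinP.
      exact: (measurableT_comp mf (pair1_measurable x)).
    + by move=> t _; rewrite /= lee_fin /f normrM (ger0_norm (kappa_ge0 _)) ler_piMr ?kappa_ge0.
  rewrite integral_cst// [X in (_ * X <= _)%E](_ : _ = 1%E) ?mule1//.
  exact: (probability_setT m).
have E := Fubini If.
transitivity (fine (\int[lam n]_x \int[m]_y (EFin \o f) (x, y))%E).
  congr fine; apply: eq_integral => x _.
  transitivity (\int[m]_t ((kappa x * cos (dotrv x s)) * cos (dotrv x t) +
      (kappa x * sin (dotrv x s)) * sin (dotrv x t))%:E)%E.
    have Ic := integrableZl measurableT (kappa x * cos (dotrv x s)) (icos' x).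
    have Is := integrableZl measurableT (kappa x * sin (dotrv x s)) (isin' x).
    rewrite (integral_integrable_EFin measurableT (integrableD measurableT Ic Is)).
    by rewrite RintegralD// !RintegralZl//; congr EFin; rewrite /cchar /schar; ring.
  by apply: eq_integral => t _; rewrite /= /f /= cosB; congr EFin; ring.
rewrite E; congr fine; apply: eq_integral => t _.
transitivity (\int[lam n]_x (kappa x * cos (dotrv x (s - t)))%:E)%E.
  apply: eq_integral => x _ /=; rewrite /f /=; congr (_ * cos _)%:E.
  by rewrite dotrvDr -(scaleN1r t) dotrvZr mulN1r.
rewrite (integral_integrable_EFin measurableT (icos (s - t))).
have [-> _] := fourier_kappa (s - t).
by congr EFin; apply: eq_bigr => k _; rewrite !mxE.
Qed.

End mixture.

End kappa.

Section saturation.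
Variable R : realType.

Let cvg_linear (c : R) : 0 < c -> c * j.+1%:R @[j --> \oo] --> +oo.
Proof.
move=> c0; apply/cvgryPge => A; exists (Num.truncn (A / c)) => // j /= Aj.
rewrite mulrC -ler_pdivrMr// ltW// (lt_le_trans (truncnS_gt _))// ler_nat ltnS.
exact: Aj.
Qed.

(** Boxes shrunk by c r on each side are tested against a kernel of scale r^2,
    with r = 1/(j+1): the scale being negligible against the distance to the faces,
    the smoothed indicators converge to the indicator of the open box at every
    point, faces included. In these units u and c are the distances t - b (or
    a - t) and (b - a)/2. *)
Lemma atan_saturation (u c : R) : 0 < c ->
  atan (u * j.+1%:R ^+ 2 + c * j.+1%:R) @[j --> \oo] --> if u < 0 then - (pi / 2) else pi / 2.
Proof.
move=> c0; case: ifPn => [u0|]; last first.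
  rewrite -leNgt => u0; apply: (cvg_comp _ (@atan R)); last exact: cvgy_atan.
  apply: ger_cvgy (cvg_linear c0); apply: nearW => j.
  by rewrite lerDr mulr_ge0// sqr_ge0.
rewrite (_ : (fun j => _) = (fun j => - atan (- (u * j.+1%:R ^+ 2 + c * j.+1%:R)))); last first.
  by apply/funext => j; rewrite atanN opprK.
apply: cvgN; apply: (cvg_comp _ (@atan R)); last exact: cvgy_atan.
have u1 : 0 < - u / 2 by rewrite divr_gt0// oppr_gt0.
have key : (- u / 2) * j.+1%:R @[j --> \oo] --> +oo by exact: cvg_linear.
apply: ger_cvgy key; move/cvgryPge : (cvg_linear u1) => /(_ c); apply: filterS => j cj.
have j1 : 1 <= j.+1%:R :> R by rewrite ler1n.
nra.
Qed.

Variables a b : R.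
Hypothesis ab : a < b.

Definition inner_left (j : nat) : R := a + (b - a) / 2 * j.+1%:R^-1.
Definition inner_right (j : nat) : R := b - (b - a) / 2 * j.+1%:R^-1.
Definition poisson_mass (j : nat) (t : R) : R :=
  2 * (atan ((inner_right j - t) / j.+1%:R^-1 ^+ 2) - atan ((inner_left j - t) / j.+1%:R^-1 ^+ 2)).

Lemma inner_left_gt j : a < inner_left j.
Proof. by rewrite ltrDl mulr_gt0 ?invr_gt0 ?ltr0n// divr_gt0// subr_gt0. Qed.

Lemma inner_right_lt j : inner_right j < b.
Proof. by rewrite gtrBl mulr_gt0 ?invr_gt0 ?ltr0n// divr_gt0// subr_gt0. Qed.

Lemma inner_le j : inner_left j <= inner_right j.
Proof.
rewrite /inner_left /inner_right.
have r1 : 0 <= 1 - j.+1%:R^-1 :> R by rewrite subr_ge0 invf_le1 ?ler1n ?ltr0n.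
have := mulr_ge0 (ltW (etrans (subr_gt0 a b) ab)) r1.
by move: (j.+1%:R^-1) => r; lra.
Qed.

Lemma cvg_inner_left : inner_left j @[j --> \oo] --> a.
Proof.
rewrite -[X in _ --> X]addr0; apply: cvgD; first exact: cvg_cst.
by rewrite -[X in _ --> X](mulr0 ((b - a) / 2)); apply: cvgMl_tmp; exact: cvg_harmonic.
Qed.

Lemma cvg_inner_right : inner_right j @[j --> \oo] --> b.
Proof.
rewrite -[X in _ --> X]subr0; apply: cvgB; first exact: cvg_cst.
by rewrite -[X in _ --> X](mulr0 ((b - a) / 2)); apply: cvgMl_tmp; exact: cvg_harmonic.
Qed.

Lemma cvg_poisson_mass t :
  poisson_mass j t @[j --> \oo] --> (if a < t < b then 2 * pi else 0 : R).
Proof.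
have c0 : 0 < (b - a) / 2 by rewrite divr_gt0// subr_gt0.
rewrite (_ : poisson_mass ^~ t = fun j =>
    2 * (- atan ((t - b) * j.+1%:R ^+ 2 + (b - a) / 2 * j.+1%:R) -
         atan ((a - t) * j.+1%:R ^+ 2 + (b - a) / 2 * j.+1%:R))); last first.
  apply/funext => j; rewrite /poisson_mass /inner_left /inner_right.
  have j0 : j.+1%:R != 0 :> R by rewrite pnatr_eq0.
  by rewrite -[- atan ((t - b) * _ + _)]atanN; congr (2 * (atan _ - atan _)); field.
have -> : (if a < t < b then 2 * pi else 0 : R) =
    2 * (- (if t - b < 0 then - (pi / 2) else pi / 2) - (if a - t < 0 then - (pi / 2) else pi / 2)).
  rewrite !subr_lt0; case: (ltP a t) => at_; case: (ltP t b) => tb /=; try by field.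
  by have := lt_le_trans ab (le_trans tb at_); rewrite ltxx.
by apply: cvgMl_tmp; apply: cvgB; [apply: cvgN|]; exact: atan_saturation.
Qed.

Lemma poisson_mass_ge0 j t : 0 <= poisson_mass j t.
Proof.
by rewrite mulr_ge0// subr_ge0 le_atan// ler_wpM2r ?lerB ?inner_le.
Qed.

Lemma poisson_mass_le j t : poisson_mass j t <= 2 * pi.
Proof.
rewrite /poisson_mass ler_wpM2l//.
have := @atan_gtNpi2 R ((inner_left j - t) / j.+1%:R^-1 ^+ 2).
have := @atan_ltpi2 R ((inner_right j - t) / j.+1%:R^-1 ^+ 2).
by move: (atan _) (atan _) => x y; lra.
Qed.

End saturation.

Section inversion.
Variables (R : realType) (n : nat).
Notation lam := (@lebesgue_rV R n).

Definition obox (a b : 'rV[R]_n) : set 'rV[R]_n := [set x | forall k, a 0 k < x 0 k < b 0 k].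

Lemma measurable_obox a b : measurable (obox a b).
Proof.
rewrite (_ : obox a b = \bigcap_(k in [set: 'I_n])
    ((fun x : 'rV[R]_n => x 0 k) @^-1` `]a 0 k, b 0 k[)); last first.
  by apply/seteqP; split=> x /= H k; [move=> _ /=|]; have := H k; rewrite /= in_itv//; exact.
apply: fin_bigcap_measurable => // k _.
by rewrite -[X in measurable X]setTI; exact: measurable_coord_rV.
Qed.

Section box_mass.
Variables (m : probability 'rV[R]_n R) (e : R).
Hypothesis e0 : 0 < e.

Let moo : (m setT < +oo)%E. Proof. by rewrite probability_setT ltry. Qed.

Let density_le (s t : 'rV[R]_n) : `|\prod_k poisson e (s 0 k - t 0 k)| <= (2 / e) ^+ n.
Proof.
rewrite ger0_norm; last by apply: prodr_ge0 => k _; exact: poisson_ge0.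
rewrite -[in leRHS](card_ord n) -prodr_const; apply: ler_prod => k _.
by rewrite poisson_ge0 ?poisson_le.
Qed.

Let mdensity (s : 'rV[R]_n) : measurable_fun setT (fun t : 'rV[R]_n => \prod_k poisson e (s 0 k - t 0 k)).
Proof.
apply: measurable_prod => k _; apply: measurableT_comp; first exact: measurable_poisson.
by apply: measurable_funB => //; exact: measurable_coord_rV.
Qed.

Lemma continuous_mixture :
  continuous (fun s : 'rV[R]_n => \int[m]_t (\prod_k poisson e (s 0 k - t 0 k))).
Proof.
apply: (continuous_Rintegral measurableT moo (M := (2 / e) ^+ n)) => // t _.
apply: continuous_big => [|k _ s]; first exact: mul_continuous.
apply: (cvg_comp _ (fun x => poisson e (x - t 0 k))); first exact: continuous_coord.
apply: (cvg_comp _ (poisson e)); last exact: continuous_poisson.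
by apply: cvgB; [exact: cvg_id|exact: cvg_cst].
Qed.

Lemma norm_mixture_le (s : 'rV[R]_n) :
  `|\int[m]_t (\prod_k poisson e (s 0 k - t 0 k))| <= (2 / e) ^+ n * fine (m setT).
Proof. exact: norm_Rintegral_le. Qed.

Lemma integral_box_mixture (a b : 'rV[R]_n) : (forall k, a 0 k <= b 0 k) ->
  \int[lam]_(s in box a b) (\int[m]_t (\prod_k poisson e (s 0 k - t 0 k))) =
  \int[m]_t (\prod_k (2 * (atan ((b 0 k - t 0 k) / e) - atan ((a 0 k - t 0 k) / e)))).
Proof.
move=> ab.
pose p (z : 'rV[R]_n * 'rV[R]_n) : R := \prod_k poisson e (z.1 0 k - z.2 0 k).
have p0 z : 0 <= p z by apply: prodr_ge0 => k _; exact: poisson_ge0.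
have mp : measurable_fun setT p.
  apply: measurable_prod => k _; apply: measurableT_comp; first exact: measurable_poisson.
  apply: measurable_funB.
    exact: (measurableT_comp (measurable_coord_rV k) measurable_fst).
  exact: (measurableT_comp (measurable_coord_rV k) measurable_snd).
have mb : measurable (box a b) by exact: measurable_box.
pose F (z : 'rV[R]_n * 'rV[R]_n) : \bar R := (\1_(box a b) z.1 * p z)%:E.
have F0 z : (0 <= F z)%E by rewrite lee_fin mulr_ge0.
have mF : measurable_fun setT F.
  apply/measurable_EFinP/measurable_funM => //.
  by apply: measurableT_comp => //; exact: measurable_indic.
transitivity (fine (\int[lam]_s \int[m]_t F (s, t))%E).
  rewrite /Rintegral integral_mkcond; congr fine; apply: eq_integral => s _.
  rewrite /patch /F /=; case: ifPn => [sb|nsb].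
    transitivity (\int[m]_t (p (s, t))%:E)%E; last first.
      by apply: eq_integral => t _; rewrite /= indicE sb /= mul1r.
    exact/esym/(integral_integrable_EFin measurableT
      (bounded_integrable measurableT moo (mdensity s) (fun t _ => density_le s t))).
  by rewrite integral0_eq// => t _; rewrite /= indicE (negbTE nsb) /= mul0r.
rewrite (fubini_tonelli F)//; congr fine; apply: eq_integral => t _.
transitivity (\int[lam]_(s in box a b) (\prod_k poisson e (s 0 k - t 0 k))%:E)%E.
  rewrite [RHS]integral_mkcond; apply: eq_integral => s _.
  by rewrite /F /= indicE /patch; case: ifP => _; rewrite ?mul1r ?mul0r.
rewrite (@integral_prod_box _ n (fun k x => poisson e (x - t 0 k))).
- rewrite -prodEFin; apply: eq_bigr => k _; exact: integral_poisson.
- by move=> k x; exact: poisson_ge0.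
- move=> k; apply: measurableT_comp; first exact: measurable_poisson.
  exact: measurable_funB.
Qed.

End box_mass.

End inversion.

Section inversion_limit.
Variables (R : realType) (n : nat) (sigma : R).
Notation lam := (@lebesgue_rV R n).
Variables m1 m2 : probability 'rV[R]_n R.

Definition cdiff (x : 'rV[R]_n) : R := cchar m1 x - cchar m2 x.
Definition sdiff (x : 'rV[R]_n) : R := schar m1 x - schar m2 x.

Hypothesis cdiff_cube : forall x, ~ cube sigma x -> cdiff x = 0.
Hypothesis sdiff_cube : forall x, ~ cube sigma x -> sdiff x = 0.

Lemma continuous_cdiff : continuous cdiff.
Proof. by move=> x; exact: (cvgB (@continuous_cchar _ _ m1 x) (@continuous_cchar _ _ m2 x)). Qed.

Lemma continuous_sdiff : continuous sdiff.
Proof. by move=> x; exact: (cvgB (@continuous_schar _ _ m1 x) (@continuous_schar _ _ m2 x)). Qed.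

Lemma norm_cdiff_le x : `|cdiff x| <= 2.
Proof. by rewrite (le_trans (ler_normB _ _))// -[2]/(1 + 1) lerD// norm_cchar_le1. Qed.

Lemma norm_sdiff_le x : `|sdiff x| <= 2.
Proof. by rewrite (le_trans (ler_normB _ _))// -[2]/(1 + 1) lerD// norm_schar_le1. Qed.

Let mc := continuous_measurable_rV continuous_cdiff.
Let ms := continuous_measurable_rV continuous_sdiff.

(** Up to the factor (2 pi)^n, the density of m1 - m2. *)
Definition density_diff : 'rV[R]_n -> R := fint sigma cdiff sdiff.

Let moo (m : probability 'rV[R]_n R) : (m setT < +oo)%E. Proof. by rewrite probability_setT ltry. Qed.

Let mkw (e : R) (f : 'rV[R]_n -> R) : 0 < e -> measurable_fun setT f ->
  measurable_fun setT (fun x => kappa e x * f x).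
Proof. by move=> e0 mf; apply: measurable_funM => //; exact: measurable_kappa. Qed.

Let kw_le (e : R) (f : 'rV[R]_n -> R) M x : 0 < e -> `|f x| <= M -> `|kappa e x * f x| <= M.
Proof.
move=> e0 fM; rewrite normrM ger0_norm ?kappa_ge0// (le_trans _ fM)//.
by rewrite ler_piMl// kappa_le1.
Qed.

Let regular e := fint sigma (fun x => kappa e x * cdiff x) (fun x => kappa e x * sdiff x).

Let regularE e s : 0 < e -> regular e s =
  \int[m1]_t (\prod_k poisson e (s 0 k - t 0 k)) - \int[m2]_t (\prod_k poisson e (s 0 k - t 0 k)).
Proof.
move=> e0; rewrite -!(regularized_inversion e0).
have mtrig : measurable_fun setT (fun x : 'rV[R]_n => cos (dotrv x s)) /\
    measurable_fun setT (fun x : 'rV[R]_n => sin (dotrv x s)).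
  split; apply: measurableT_comp; try exact: measurable_dotrv.
    by apply: continuous_measurable_fun; exact: continuous_cos.
  by apply: continuous_measurable_fun; exact: continuous_sin.
have I (m : probability 'rV[R]_n R) : lam.-integrable setT
    (EFin \o (fun x => kappa e x * (cchar m x * cos (dotrv x s) + schar m x * sin (dotrv x s)))).
  apply: (integrable_kappa e0 (M := 1 *+ 2)).
    apply: measurable_funD; apply: measurable_funM; try exact: mtrig.1; try exact: mtrig.2.
      by apply: continuous_measurable_rV; exact: continuous_cchar.
    by apply: continuous_measurable_rV; exact: continuous_schar.
  by move=> x; apply: norm_trig_le; [exact: norm_cchar_le1|exact: norm_schar_le1].
rewrite -RintegralB//.
rewrite /regular /fint Rintegral_mkcond; apply: eq_Rintegral => x _.
rewrite /patch; case: ifPn => [_|]; first by rewrite /cdiff /sdiff; ring.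
rewrite notin_setE => ncx.
have := cdiff_cube ncx; have := sdiff_cube ncx; rewrite /cdiff /sdiff => /eqP + /eqP.
rewrite !subr_eq0 => /eqP -> /eqP ->; rewrite subrr//.
Qed.

Let r j : R := j.+1%:R^-1.
Let rj_gt0 j : 0 < r j ^+ 2. Proof. by rewrite exprn_gt0// invr_gt0 ltr0n. Qed.

Let kappa_cvg (x : 'rV[R]_n) : kappa (r j ^+ 2) x @[j --> \oo] --> (1 : R).
Proof.
have -> : (1 : R) = \prod_(k < n) 1 by rewrite big1.
apply: cvg_big => [|k _]; first exact: mul_continuous.
have h : - (r j ^+ 2 * `|x 0 k|) @[j --> \oo] --> (0 : R).
  rewrite -[X in _ --> X]oppr0; apply: cvgN; rewrite -[X in _ --> X](mul0r `|x 0 k|).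
  apply: cvgMr_tmp; rewrite -[X in _ --> X](mulr0 0).
  by under eq_fun do rewrite expr2; apply: cvgM; exact: cvg_harmonic.
by rewrite -[X in _ --> X](expR0 R); exact: (cvg_comp _ (@expR R) h (@continuous_expR R 0)).
Qed.

Let regular_cvg s : regular (r j ^+ 2) s @[j --> \oo] --> density_diff s.
Proof.
apply: (Rintegral_cvg (@measurable_cube R n sigma) (@cube_finite R n sigma) (M := 2 *+ 2)).
- by move=> j; apply: measurable_fint_integrand; exact: mkw.
- by move=> j x _; apply: norm_trig_le; apply: kw_le => //; [exact: norm_cdiff_le|exact: norm_sdiff_le].
move=> x _; rewrite -[cdiff x in X in _ --> X]mul1r -[sdiff x in X in _ --> X]mul1r.
by apply: cvgD; apply: cvgMr_tmp; apply: cvgMr_tmp; exact: kappa_cvg.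
Qed.

Variables a b : 'rV[R]_n.
Hypothesis ab : forall k, a 0 k < b 0 k.

Let lo j : 'rV[R]_n := \row_k inner_left (a 0 k) (b 0 k) j.
Let hi j : 'rV[R]_n := \row_k inner_right (a 0 k) (b 0 k) j.

Let mass_cvg (m : probability 'rV[R]_n R) :
  \int[m]_t (\prod_k poisson_mass (a 0 k) (b 0 k) j (t 0 k)) @[j --> \oo] -->
  (2 * pi) ^+ n * fine (m (obox a b)).
Proof.
have -> : (2 * pi) ^+ n * fine (m (obox a b)) =
    \int[m]_t (\prod_k (if a 0 k < t 0 k < b 0 k then 2 * pi else 0)).
  rewrite -(Rintegral_cst m); last exact: measurable_obox.
  rewrite Rintegral_mkcond; apply: eq_Rintegral => t _; rewrite /patch.
  case: ifPn => [|nt].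
    rewrite inE => abt; rewrite (eq_bigr (fun=> 2 * pi)); last by move=> k _; rewrite abt.
    by rewrite prodr_const card_ord.
  have [k xk] : exists k, ~ (a 0 k < t 0 k < b 0 k).
    apply: contrapT => H; move: nt; rewrite notin_setE; apply => k.
    by apply: contrapT => xk; apply: H; exists k.
  by rewrite (bigD1 k)//=; move/negP/negbTE : xk => ->; rewrite mul0r.
apply: (Rintegral_cvg measurableT (moo m) (M := (2 * pi) ^+ n)).
- move=> j; apply: measurable_prod => k _.
  apply: (measurableT_comp (f := poisson_mass (a 0 k) (b 0 k) j)); last exact: measurable_coord_rV.
  apply: continuous_measurable_fun => t.
  have c1 (u : R) : atan ((u - t') / j.+1%:R^-1 ^+ 2) @[t' --> t] --> atan ((u - t) / j.+1%:R^-1 ^+ 2).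
    apply: (cvg_comp _ (@atan R)); last exact: continuous_atan.
    by apply: cvgMr_tmp; apply: cvgB; [exact: cvg_cst|exact: cvg_id].
  by apply: cvgMl_tmp; apply: cvgB; exact: c1.
- move=> j t _; rewrite ger0_norm; last by apply: prodr_ge0 => k _; exact: poisson_mass_ge0.
  rewrite -[in leRHS](card_ord n) -prodr_const; apply: ler_prod => k _.
  by rewrite poisson_mass_ge0//= poisson_mass_le.
move=> t _; apply: cvg_big => [|k _]; first exact: mul_continuous.
exact: cvg_poisson_mass.
Qed.

(** The difference of the two regularized inversion integrals involves the
    characteristic functions on the cube only, where the regularization can be
    removed by dominated convergence. *)
Lemma box_inversion : (2 * pi) ^+ n * (fine (m1 (obox a b)) - fine (m2 (obox a b))) =
  \int[lam]_(s in obox a b) density_diff s.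
Proof.
have lohi j k : lo j 0 k <= hi j 0 k by rewrite !mxE inner_le.
have L : \int[lam]_(s in box (lo j) (hi j)) regular (r j ^+ 2) s @[j --> \oo] -->
    (2 * pi) ^+ n * (fine (m1 (obox a b)) - fine (m2 (obox a b))).
  rewrite mulrBr (_ : (fun j => _) = (fun j =>
      \int[m1]_t (\prod_k poisson_mass (a 0 k) (b 0 k) j (t 0 k)) -
      \int[m2]_t (\prod_k poisson_mass (a 0 k) (b 0 k) j (t 0 k)))); last first.
    apply/funext => j; have ej := rj_gt0 j.
    have Im (m : probability 'rV[R]_n R) : lam.-integrable (box (lo j) (hi j))
        (EFin \o (fun s => \int[m]_t (\prod_k poisson (r j ^+ 2) (s 0 k - t 0 k)))).
      apply: (bounded_integrable (measurable_box _ _) (box_finite _ _)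
        (M := (2 / r j ^+ 2) ^+ n * fine (m setT))).
        by apply: measurable_funTS; apply: continuous_measurable_rV; exact: continuous_mixture.
      by move=> s _; exact: norm_mixture_le.
    have Em (m : probability 'rV[R]_n R) :
        \int[m]_t (\prod_k poisson_mass (a 0 k) (b 0 k) j (t 0 k)) =
        \int[lam]_(s in box (lo j) (hi j)) (\int[m]_t (\prod_k poisson (r j ^+ 2) (s 0 k - t 0 k))).
      rewrite integral_box_mixture//; apply: eq_Rintegral => t _.
      by apply: eq_bigr => k _; rewrite !mxE.
    rewrite !Em -(RintegralB (measurable_box _ _) (Im m1) (Im m2)).
    by apply: eq_Rintegral => s _; rewrite regularE.
  by apply: cvgB; exact: mass_cvg.
suff L' : \int[lam]_(s in box (lo j) (hi j)) regular (r j ^+ 2) s @[j --> \oo] -->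
    \int[lam]_(s in obox a b) density_diff s by exact: (cvg_unique _ L L').
have -> : (fun j => \int[lam]_(s in box (lo j) (hi j)) regular (r j ^+ 2) s) =
    (fun j => \int[lam]_(s in box a b) (regular (r j ^+ 2) \_ (box (lo j) (hi j))) s).
  apply/funext => j; rewrite -Rintegral_mkcondr; congr (Rintegral _ _ _).
  apply/seteqP; split => [s sj|s []//]; split => // k.
  have /andP[s1 s2] := sj k; move: s1 s2; rewrite !mxE => s1 s2.
  by rewrite (le_trans (ltW (inner_left_gt (ab k) j)) s1)/= (le_trans s2 (ltW (inner_right_lt (ab k) j))).
have -> : \int[lam]_(s in obox a b) density_diff s =
    \int[lam]_(s in box a b) (density_diff \_ (obox a b)) s.
  rewrite -Rintegral_mkcondr; congr (Rintegral _ _ _).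
  apply/seteqP; split => [s sj|s []//]; split => // k.
  by have /andP[s1 s2] := sj k; rewrite !ltW.
have cr j : continuous (regular (r j ^+ 2)).
  apply: (continuous_fint (C := 2)) => //; try exact: mkw.
  - by move=> x _; apply: kw_le => //; exact: norm_cdiff_le.
  - by move=> x _; apply: kw_le => //; exact: norm_sdiff_le.
apply: (Rintegral_cvg (measurable_box a b) (box_finite a b)
  (M := 2 *+ 2 * fine (lam (cube sigma)))).
- move=> j; apply: measurable_funTS; apply/(measurable_restrictT _ _).1.
    exact: measurable_box.
  by apply: measurable_funTS; apply: continuous_measurable_rV; exact: cr.
- move=> j s _; rewrite /patch; case: ifPn => _; last first.
    by rewrite normr0 mulr_ge0// fine_ge0.
  apply: (norm_Rintegral_le (@measurable_cube R n sigma) (@cube_finite R n sigma)).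
    by apply: measurable_fint_integrand; exact: mkw.
  by move=> x _; apply: norm_trig_le; apply: kw_le => //; [exact: norm_cdiff_le|exact: norm_sdiff_le].
move=> s _; rewrite /patch; case: ifPn => [|ns].
  rewrite inE => sQ; apply: (cvg_trans _ (@regular_cvg s)); apply: near_eq_cvg.
  have : \forall j \near \oo, forall k, lo j 0 k <= s 0 k <= hi j 0 k.
    apply: filter_forall => k; have /andP[ak bk] := sQ k.
    have hl := cvgr_lt (a 0 k) (@cvg_inner_left R (a 0 k) (b 0 k)) _ ak.
    have hr := cvgr_gt (b 0 k) (@cvg_inner_right R (a 0 k) (b 0 k)) _ bk.
    near=> j; rewrite !mxE !ltW//; first by near: j; exact: hr.
    by near: j; exact: hl.
  by apply: filterS => j sj; rewrite mem_set.
rewrite (_ : (fun j => _) = cst 0); first exact: cvg_cst.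
apply/funext => j; case: ifPn => //; rewrite inE => sj; exfalso; move: ns.
rewrite notin_setE; apply => k; have := sj k; rewrite !mxE => /andP[s1 s2].
by rewrite (lt_le_trans (inner_left_gt (ab k) j) s1) (le_lt_trans s2 (inner_right_lt (ab k) j)).
Unshelve. all: by end_near. Qed.

End inversion_limit.

(** * Measures on R^n are determined by their values on open boxes *)

Section box_unique.
Variables (R : realType) (n : nat).
Implicit Types a b : 'rV[R]_n.

Definition oboxes : set (set 'rV[R]_n) := [set Q | exists a b, Q = obox a b].

Lemma obox_setI a b c d : obox a b `&` obox c d =
  obox (\row_k Num.max (a 0 k) (c 0 k)) (\row_k Num.min (b 0 k) (d 0 k)).
Proof.
apply/seteqP; split => [x [x1 x2] k|x h].
  by rewrite !mxE gt_max lt_min; have /andP[-> ->] := x1 k; have /andP[-> ->] := x2 k.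
by split=> k; have := h k; rewrite !mxE gt_max lt_min => /andP[/andP[? ?] /andP[? ?]]; apply/andP.
Qed.

Lemma setI_closed_oboxes : setI_closed oboxes.
Proof. by move=> _ _ [a [b ->]] [c [d ->]]; rewrite obox_setI; eexists; eexists. Qed.

Lemma obox_eq0 a b k : b 0 k <= a 0 k -> obox a b = set0.
Proof.
move=> ba; apply/seteqP; split => // x /(_ k) /andP[ax xb].
by have := lt_trans ax xb; rewrite ltNge ba.
Qed.

Definition centered_box (j : nat) : set 'rV[R]_n := obox (\row_k - j%:R) (\row_k j%:R).

Lemma centered_box_cover : \bigcup_j centered_box j = setT.
Proof.
apply/seteqP; split => // x _.
pose f (k : 'I_n) := (Num.truncn `|x 0 k|).+1.
exists (\max_k f k)%N => // k; rewrite !mxE -ltr_norml.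
apply: (lt_le_trans (truncnS_gt _)); rewrite ler_nat.
exact: (@leq_bigmax _ f).
Qed.

(** The identity is measurable from the sigma-algebra of boxes to the Borel one,
    since its coordinates are. *)
Lemma measurable_oboxesE : @measurable _ 'rV[R]_n = <<s oboxes >>.
Proof.
apply/seteqP; split; last first.
  apply: smallest_sub; first exact: sigma_algebra_measurable.
  by move=> _ [a [b ->]]; exact: measurable_obox.
move=> A mA.
pose T := g_sigma_algebraType oboxes.
have mid : measurable_fun (T := T) setT (fun x : T => (x : 'rV[R]_n)).
  apply: measurable_fun_rVP => i.
  apply: (measurability _ (RGenOpens.measurableE R)).
  move=> _ [_ [c [d ->]] <-]; rewrite setTI.
  pose a (j : nat) : 'rV[R]_n := \row_k (if k == i then c else - j%:R).
  pose b (j : nat) : 'rV[R]_n := \row_k (if k == i then d else j%:R).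
  rewrite (_ : _ @^-1` _ = \bigcup_j obox (a j) (b j)).
    apply: bigcupT_measurable => j; apply: sub_sigma_algebra.
    by exists (a j), (b j).
  apply/seteqP; split => [x /=|x [j _ /(_ i)]]; last by rewrite !mxE eqxx /= in_itv.
  rewrite in_itv/= => cxd.
  have [j _ xj] : (\bigcup_j centered_box j) x by rewrite centered_box_cover.
  exists j => // k; rewrite !mxE; case: eqP => [->//|_].
  by have := xj k; rewrite !mxE.
have := mid measurableT A mA; rewrite setTI; exact.
Qed.

Lemma measure_eq_oboxes (m1 m2 : {measure set 'rV[R]_n -> \bar R}) :
  (m1 setT < +oo)%E -> (forall a b, m1 (obox a b) = m2 (obox a b)) ->
  forall A, measurable A -> m1 A = m2 A.
Proof.
move=> m1oo E; apply: (measure_unique oboxes centered_box) => //.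
- exact: measurable_oboxesE.
- exact: setI_closed_oboxes.
- by move=> j; eexists; eexists.
- exact: centered_box_cover.
- by move=> _ [a [b ->]]; exact: E.
- move=> j; apply: le_lt_trans m1oo; apply: le_measure; rewrite ?inE//; exact: measurable_obox.
Qed.

End box_unique.

Section weighted_measure.
Context {R : realType} d {T : measurableType d} (m : {measure set T -> \bar R}).
Variable g : T -> R.
Hypotheses (mg : measurable_fun setT g) (g0 : forall x, 0 <= g x).

(** The two proofs are arguments of the set function in order to carry the
    measure structure below. *)
Definition weighted (_ : measurable_fun setT g) (_ : forall x, 0 <= g x) (A : set T) : \bar R :=
  (\int[m]_(x in A) (g x)%:E)%E.

Local Notation w := (weighted mg g0).

Let w0 : w set0 = 0%E. Proof. by rewrite /w integral_set0. Qed.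

Let w_ge0 A : (0 <= w A)%E. Proof. by apply: integral_ge0 => x _; rewrite lee_fin. Qed.

Let w_sigma_additive : semi_sigma_additive w.
Proof.
move=> F mF tF mUF; rewrite /w ge0_integral_bigcup//.
- apply: is_cvg_ereal_nneg_natsum_cond => k _ _.
  by apply: integral_ge0 => x _; rewrite lee_fin.
- by apply/measurable_EFinP; exact: measurable_funTS.
- by move=> x _; rewrite lee_fin.
Qed.

HB.instance Definition _ := isMeasure.Build _ _ _ w w0 w_ge0 w_sigma_additive.

End weighted_measure.

(** * The sign of the density difference where the density vanishes *)

Section nonpos.
Variables (R : realType) (n : nat) (sigma : R).
Notation lam := (@lebesgue_rV R n).
Variables m1 m2 : probability 'rV[R]_n R.
Hypothesis cdiff_cube : forall x, ~ cube sigma x -> cdiff m1 m2 x = 0.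
Hypothesis sdiff_cube : forall x, ~ cube sigma x -> sdiff m1 m2 x = 0.

Let u := density_diff sigma m1 m2.
Let c : R := (2 * pi) ^+ n.
Let c0 : 0 < c. Proof. by rewrite exprn_gt0// mulr_gt0// pi_gt0. Qed.

Lemma continuous_density_diff : continuous u.
Proof.
apply: (continuous_fint (C := 2)) => //.
- by apply: continuous_measurable_rV; exact: continuous_cdiff.
- by apply: continuous_measurable_rV; exact: continuous_sdiff.
- by move=> x _; exact: norm_cdiff_le.
- by move=> x _; exact: norm_sdiff_le.
Qed.

Let mu_ : measurable_fun setT u.
Proof. by apply: continuous_measurable_rV; exact: continuous_density_diff. Qed.

Lemma norm_density_diff_le s : `|u s| <= 2 *+ 2 * fine (lam (cube sigma)).
Proof.
apply: (norm_Rintegral_le (@measurable_cube R n sigma) (@cube_finite R n sigma)).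
  apply: measurable_fint_integrand; apply: continuous_measurable_rV.
    exact: continuous_cdiff.
  exact: continuous_sdiff.
by move=> x _; apply: norm_trig_le; [exact: norm_cdiff_le|exact: norm_sdiff_le].
Qed.

Lemma obox_sub_box (a b : 'rV[R]_n) : obox a b `<=` box a b.
Proof. by move=> x xab k; have /andP[? ?] := xab k; rewrite !ltW. Qed.

Lemma obox_finite (a b : 'rV[R]_n) : (lam (obox a b) < +oo)%E.
Proof.
apply: le_lt_trans (box_finite a b); apply: le_measure; rewrite ?inE.
- exact: measurable_obox.
- exact: measurable_box.
- exact: obox_sub_box.
Qed.

Let finP (m : probability 'rV[R]_n R) A : measurable A -> m A = (fine (m A))%:E.
Proof. by move=> mA; rewrite fineK//; exact: fin_num_measure. Qed.

Lemma box_inversion_EFin (a b : 'rV[R]_n) :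
  (c%:E * m1 (obox a b) = c%:E * m2 (obox a b) + \int[lam]_(s in obox a b) (u s)%:E)%E.
Proof.
have mQ := measurable_obox a b.
have [ab|/existsNP[k /negP]] := pselect (forall k, a 0 k < b 0 k); last first.
  by rewrite -leNgt => /obox_eq0 ->; rewrite !measure0 integral_set0 !mule0 adde0.
rewrite (integral_EFin_Rintegral mQ (obox_finite a b) (measurable_funTS mu_)
  (fun s _ => norm_density_diff_le s)).
rewrite -box_inversion// finP// [X in (_ * X + _)%E]finP//.
by rewrite -!EFinM -EFinD; congr EFin; rewrite -/c; ring.
Qed.

Section on_box.
Variables a b : 'rV[R]_n.
Hypothesis u_ge0 : forall s, obox a b s -> 0 <= u s.

Let B := obox a b.
Let mB : measurable B. Proof. exact: measurable_obox. Qed.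
Let g := u \_ B.

Let mg : measurable_fun setT g.
Proof. by apply/(measurable_restrictT _ _).1 => //; exact: measurable_funTS. Qed.

Let g0 s : 0 <= g s.
Proof. by rewrite /g /patch; case: ifPn => //; rewrite inE; exact: u_ge0. Qed.

Let cn : {nonneg R} := NngNum (ltW c0).

(** Where the density difference u is nonnegative, m1 and m2 + u are measures,
    and their equality passes from boxes to Borel sets. *)
Lemma local_inversion A : measurable A ->
  (c%:E * m1 (A `&` B) = c%:E * m2 (A `&` B) + \int[lam]_(s in A `&` B) (u s)%:E)%E.
Proof.
pose w1 : {measure set 'rV[R]_n -> \bar R} := mscale cn (mrestr m1 mB).
pose w2 : {measure set 'rV[R]_n -> \bar R} :=
  measure_add (mscale cn (mrestr m2 mB)) (weighted lam mg g0).
have w2E A' : (w2 A' = c%:E * m2 (A' `&` B) + \int[lam]_(s in A' `&` B) (u s)%:E)%E.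
  transitivity (mscale cn (mrestr m2 mB) A' + weighted lam mg g0 A')%E.
    exact: measure_addE.
  rewrite /weighted integral_mkcondr; congr (_ + _)%E.
  by apply: eq_integral => s _; rewrite /g restrict_EFin.
have w1E A' : w1 A' = (c%:E * m1 (A' `&` B))%E by [].
move=> mA; rewrite -w2E -w1E; apply: (measure_eq_oboxes (m1 := w1)) => //.
  by rewrite w1E setTI finP// -EFinM ltry.
by move=> a' b'; rewrite w2E w1E /B obox_setI; exact: box_inversion_EFin.
Qed.

End on_box.

Let measure_null_sub (m : {measure set 'rV[R]_n -> \bar R}) X Y : measurable X -> measurable Y ->
  X `<=` Y -> m Y = 0%E -> m X = 0%E.
Proof.
by move=> mX mY XY Y0; apply/eqP; rewrite -measure_le0 -Y0; apply: le_measure; rewrite ?inE.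
Qed.

(** Off a null set carrying its singular part, m1 has no mass where its density
    vanishes; there the density of m1 - m2 is that of - m2. *)
Lemma density_diff_le0 (m_ac m_s : {measure set 'rV[R]_n -> \bar R}) (phi : 'rV[R]_n -> R) a b :
  lebesgue_decomposition m1 m_ac m_s -> has_density m_ac phi ->
  (forall s, obox a b s -> phi s = 0) -> forall s, obox a b s -> u s <= 0.
Proof.
move=> [m1E _ [N [mN N0 sN]]] dens phi0 s abs; rewrite leNgt; apply/negP => us0.
pose de := u s / 2; have de0 : 0 < de by rewrite divr_gt0.
have deu : de < u s by rewrite /de; lra.
have FF : Filter (nbhs s) by exact: (@nbhs_filter 'rV[R]_n s).
have near_s : \forall y \near s, de < u y /\ obox a b y.
  have n1 : \forall y \near s, de < u y.
    exact: (@cvgr_gt R _ (nbhs s) FF u (u s) (@continuous_density_diff s) de deu).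
  have n2 : \forall y \near s, forall k : 'I_n, a 0 k < (y : 'rV[R]_n) 0 k < b 0 k.
    apply: (@filter_forall _ _ (fun k (y : 'rV[R]_n) => is_true (a 0 k < y 0 k < b 0 k)) (nbhs s) FF) => k.
    have /andP[ak bk] := abs k.
    have l : \forall y \near s, a 0 k < (y : 'rV[R]_n) 0 k.
      exact: (@cvgr_gt R _ (nbhs s) FF _ (s 0 k) (@continuous_coord R n k s) (a 0 k) ak).
    have h : \forall y \near s, (y : 'rV[R]_n) 0 k < b 0 k.
      exact: (@cvgr_lt R _ (nbhs s) FF _ (s 0 k) (@continuous_coord R n k s) (b 0 k) bk).
    exact: (@filterS2 _ (nbhs s) FF _ _ _ (fun y l h => introT andP (conj l h)) l h).
  exact: (@filterI _ (nbhs s) FF _ _ n1 n2).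
have [r /= r0 rP] := (nbhs_ballP _ _).1 near_s.
pose a' : 'rV[R]_n := \row_k (s 0 k - r); pose b' : 'rV[R]_n := \row_k (s 0 k + r).
have BP y : obox a' b' y -> de < u y /\ obox a b y.
  move=> By; apply: rP; split => // i k; rewrite ord1 /ball /= distrC.
  by have := By k; rewrite !mxE ltr_distl.
have mB := measurable_obox a' b'.
pose X := ~` N `&` obox a' b'; have mX : measurable X by apply: measurableI => //; exact: measurableC.
have m1X : m1 X = 0%E.
  rewrite m1E// (dens _ mX) integral0_eq ?add0e.
    by apply: measure_null_sub sN => //; [exact: measurableC|exact: subIsetl].
  by move=> x [_ /BP[_ /phi0 ->]].
have := local_inversion (a := a') (b := b') (fun y By => ltW (lt_trans de0 (BP y By).1)) (measurableC mN).
rewrite -/X m1X mule0 => /esym/eqP.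
have iX0 : (0 <= \int[lam]_(s in X) (u s)%:E)%E.
  by apply: integral_ge0 => y [_ /BP[h _]]; rewrite lee_fin ltW// (lt_trans de0).
rewrite padde_eq0//; last by rewrite mule_ge0// lee_fin ltW.
move=> /andP[_ /eqP iX].
have lX : lam X = 0%E.
  apply/eqP; rewrite -measure_le0 -(@lee_pmul2l _ de%:E)// ?lte_fin// mule0 -[leRHS]iX.
  rewrite -integral_cst//; apply: ge0_le_integral => //.
  - by move=> y _; rewrite lee_fin ltW.
  - by apply/measurable_EFinP; exact: measurable_funTS.
  - by move=> y [_ /BP[h _]]; rewrite lee_fin ltW.
have lB : lam (obox a' b') = 0%E.
  apply/eqP; rewrite -measure_le0.
  apply: (@le_trans _ _ (lam (N `|` X))).
    apply: le_measure; rewrite ?inE//; first exact: measurableU.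
    by move=> y By; have [Ny|nNy] := pselect (N y); [left|right].
  by rewrite (le_trans (measureU2 _ _ _))// [X in (X + _)%E]N0 add0e [leLHS]lX.
have : lam (box (\row_k (s 0 k - r / 2)) (\row_k (s 0 k + r / 2))) = 0%E.
  apply: measure_null_sub lB => //; first exact: measurable_box.
  by move=> y yb k; have := yb k; rewrite !mxE => /andP[h1 h2]; apply/andP; split; lra.
rewrite lebesgue_rV_box => [|k]; last by rewrite !mxE; lra.
move/eqP; rewrite eqe; apply/negP; rewrite gt_eqF//; apply: prodr_gt0 => k _.
by rewrite !mxE; lra.
Qed.

Lemma density_diff_eq0 : (forall s, u s = 0) -> forall A, measurable A -> m1 A = m2 A.
Proof.
have oo : (m1 setT < +oo)%E by rewrite probability_setT ltry.
move=> u0; apply: measure_eq_oboxes => //.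
move=> a b; have := box_inversion_EFin a b.
rewrite integral0_eq ?adde0; last by move=> s _; rewrite u0.
rewrite finP; last exact: measurable_obox.
rewrite [in RHS]finP; last exact: measurable_obox.
move=> /eqP; rewrite -!EFinM eqe => /eqP/(mulfI (lt0r_neq0 c0)) E.
have mQ := measurable_obox a b.
exact: etrans (finP m1 mQ) (etrans (congr1 EFin E) (esym (finP m2 mQ))).
Qed.

End nonpos.

(** * From sign near the lattice to identical vanishing *)

Section chain.
Variables (R : realType) (n : nat) (sigma : R).
Notation lam := (@lebesgue_rV R n).
Hypothesis sigma_gt0 : 0 < sigma.
Variables (A B : 'rV[R]_n -> R) (C : R).
Hypotheses (cA : continuous A) (cB : continuous B).
Hypotheses (A_cube : forall x, ~ cube sigma x -> A x = 0) (B_cube : forall x, ~ cube sigma x -> B x = 0).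
Hypotheses (A0 : A 0 = 0) (B0 : B 0 = 0).
Hypotheses (AC : forall x, cube sigma x -> `|A x| <= C) (BC : forall x, cube sigma x -> `|B x| <= C).
Variables a tau : 'rV[R]_n.
Hypotheses (tau_gt0 : forall k, 0 < tau 0 k) (tau_le : forall k, tau 0 k <= 2 * pi / sigma).

Notation u := (fint sigma A B).

Hypothesis neg : forall p : 'rV[R]_n, shifted_lattice a tau p ->
  exists2 r, 0 < r & forall y : 'rV[R]_n, (forall k, `|y 0 k - p 0 k| < r) -> u y <= 0.

Let mA := continuous_measurable_rV cA.
Let mB := continuous_measurable_rV cB.
Let mcube := @measurable_cube R n sigma.
Let cubeoo := @cube_finite R n sigma.

(** Weights of the Fourier integral after translation to the base point t. *)
Let cosw (W V : 'rV[R]_n -> R) (t x : 'rV[R]_n) := W x * cos (dotrv x t) + V x * sin (dotrv x t).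
Let sinw (W V : 'rV[R]_n -> R) (t x : 'rV[R]_n) := V x * cos (dotrv x t) - W x * sin (dotrv x t).

Let weight_bounds (W V : 'rV[R]_n -> R) (K : R) (t : 'rV[R]_n) : measurable_fun setT W -> measurable_fun setT V ->
  (forall x, cube sigma x -> `|W x| <= K) -> (forall x, cube sigma x -> `|V x| <= K) ->
  [/\ measurable_fun (cube sigma) (cosw W V t), measurable_fun (cube sigma) (sinw W V t),
    forall x, cube sigma x -> `|cosw W V t x| <= K *+ 2 &
    forall x, cube sigma x -> `|sinw W V t x| <= K *+ 2].
Proof.
move=> mW mV WK VK.
have sE : sinw W V t = cosw V (fun x => - W x) t.
  by apply/funext => x; rewrite /sinw /cosw mulNr.
have mNW : measurable_fun setT (fun x => - W x) by apply: measurableT_comp.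
split.
- exact: measurable_fint_integrand.
- by rewrite sE; exact: measurable_fint_integrand.
- by move=> x cx; apply: norm_trig_le; [exact: WK|exact: VK].
- by move=> x cx; rewrite sE; apply: norm_trig_le; rewrite ?normrN; [exact: VK|exact: WK].
Qed.

(* u vanishes wherever the coordinates of index >= j belong to the lattice. *)
Let slice_zero j := forall t : 'rV[R]_n,
  (forall k : 'I_n, (j <= k)%N -> exists m : int, t 0 k = a 0 k + tau 0 k * m%:~R) -> u t = 0.

Let slice_zero0 : slice_zero 0.
Proof.
move=> t tL; apply: (fint_lattice_eq0 sigma_gt0 cA cB A_cube B_cube A0 B0 tau_gt0 tau_le) => p q.
have [|r r0] := neg (p := t + \row_k (tau 0 k * ((p k)%:R - (q k)%:R))).
  have /choice[m mE] : forall k, exists m : int, t 0 k = a 0 k + tau 0 k * m%:~R by move=> k; exact: tL.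
  exists (\row_k (m k + ((p k)%:Z - (q k)%:Z))) => k.
  by rewrite !mxE mE intrD intrB -!pmulrn; ring.
by apply=> k; rewrite subrr normr0.
Qed.

Section step.
Variable i : 'I_n.
Hypothesis Zi : slice_zero i.

Let v : 'rV[R]_n := delta_mx 0 i.

Let dotv (x : 'rV[R]_n) : dotrv x v = x 0 i.
Proof.
rewrite /dotrv (bigD1 i)//= big1 ?addr0; first by rewrite mxE !eqxx mulr1.
by move=> k ki; rewrite mxE (negbTE ki) andbF mulr0.
Qed.

Let yle (x : 'rV[R]_n) : cube sigma x -> `|dotrv x v| <= sigma. Proof. by rewrite dotv; exact. Qed.

(** Weights of the Fourier integral of the i-th partial derivative of u. *)
Let dA (x : 'rV[R]_n) : R := dotrv x v * B x.
Let dB (x : 'rV[R]_n) : R := - (dotrv x v * A x).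

Let mdA : measurable_fun setT dA.
Proof. by apply: measurable_funM => //; exact: measurable_dotrv. Qed.

Let mdB : measurable_fun setT dB.
Proof. by apply: measurableT_comp => //; apply: measurable_funM => //; exact: measurable_dotrv. Qed.

Let dAC (x : 'rV[R]_n) : cube sigma x -> `|dA x| <= sigma * C.
Proof. by move=> cx; rewrite normrM ler_pM ?yle ?BC. Qed.

Let dBC (x : 'rV[R]_n) : cube sigma x -> `|dB x| <= sigma * C.
Proof. by move=> cx; rewrite normrN normrM ler_pM ?yle ?AC. Qed.

Let is_derive_u (t : 'rV[R]_n) (s : R) : is_derive s 1 (fun s => u (t + s *: v)) (fint sigma dA dB (t + s *: v)).
Proof.
have [m1 m2 b1 b2] := weight_bounds t mA mB AC BC.
have := is_derive_osc mcube cubeoo (@measurable_dotrv R n (cube sigma) v) yle s m1 m2 b1 b2.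
have -> : osc lam (cube sigma) (fun x => dotrv x v) (cosw A B t) (sinw A B t) = (fun s => u (t + s *: v)).
  by apply/funext => s'; rewrite fint_line.
rewrite fint_line /osc; congr (is_derive _ _ _ _).
by apply: eq_Rintegral => x _; rewrite /cosw /sinw /dA /dB; ring.
Qed.

(** Near a lattice point u is nonpositive, and on the slice it vanishes: the
    slice consists of local maxima in the transversal direction i. *)
Let derivative_zero_near (p : 'rV[R]_n) : shifted_lattice a tau p ->
  exists2 r, 0 < r & forall w : 'rV[R]_n, (forall k, `|w 0 k - p 0 k| < r) ->
    (forall k : 'I_n, (i <= k)%N -> w 0 k = p 0 k) -> fint sigma dA dB w = 0.
Proof.
move=> pL; have [r r0 rP] := neg pL; have r20 : 0 < r / 2 by rewrite divr_gt0.
exists (r / 2) => // w wp wi.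
have w0 : u w = 0.
  by apply: Zi => k ik; rewrite wi//; case: pL => m mP; exists (m 0 k); exact: mP.
have h : is_derive (0 : R) 1 (fun s => u (w + s *: v)) 0.
  apply: (@derive1_at_max _ _ (- (r / 2)) (r / 2)).
  - lra.
  - by move=> s _; have [] := is_derive_u w s.
  - by rewrite in_itv/=; apply/andP; split; lra.
  move=> s; rewrite in_itv/= scale0r addr0 w0 => /andP[s1 s2]; apply: rP => k.
  have -> : (w + s *: v) 0 k - p 0 k = (w 0 k - p 0 k) + s * (k == i)%:R.
    by rewrite !mxE/=; ring.
  rewrite (splitr r) (le_lt_trans (ler_normD _ _))// ltr_leD//.
  rewrite normrM (le_trans _ (_ : `|s| <= _))//; first by rewrite ler_piMr//; case: eqP; rewrite ?normr1 ?normr0.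
  by rewrite ler_norml; apply/andP; split; lra.
have [_ E1] := h; have [_ E2] := is_derive_u w 0.
by move: E2; rewrite E1 scale0r addr0.
Qed.

(** On the segment from a lattice point p to q, whose direction d has no component
    of index >= i, the derivative vanishes near p, hence up to q by analyticity. *)
Let derivative_zero (q : 'rV[R]_n) :
  (forall k : 'I_n, (i <= k)%N -> exists m : int, q 0 k = a 0 k + tau 0 k * m%:~R) ->
  fint sigma dA dB q = 0.
Proof.
move=> qL.
pose p : 'rV[R]_n := \row_k (if (i <= k)%N then q 0 k else a 0 k).
have pL : shifted_lattice a tau p.
  have /choice[m mE] : forall k, exists m : int, p 0 k = a 0 k + tau 0 k * m%:~R.
    by move=> k; rewrite mxE; case: ifP => [/qL//|_]; exists 0; rewrite mulr0 addr0.
  by exists (\row_k m k) => k; rewrite mxE.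
have [r r0 rP] := derivative_zero_near pL.
pose d := q - p; pose M := \sum_k `|d 0 k|.
have M0 : 0 <= M by exact: sumr_ge0.
have rM0 : 0 < r / (1 + M) by rewrite divr_gt0// ltr_wpDr.
have [m1 m2 b1 b2] := weight_bounds p mdA mdB dAC dBC.
have dle (x : 'rV[R]_n) : cube sigma x -> `|dotrv x d| <= \sum_k sigma * `|d 0 k| by exact: dotrv_cube_le.
have : forall s, osc lam (cube sigma) (fun x => dotrv x d) (cosw dA dB p) (sinw dA dB p) s = 0.
  apply: (osc_flat mcube cubeoo (@measurable_dotrv R n (cube sigma) d) dle m1 m2 b1 b2 rM0) => s sr.
  rewrite -(fint_line sigma dA dB p d s); apply: rP => k.
    have -> : (p + s *: d) 0 k - p 0 k = s * d 0 k.
      by rewrite [X in X - _]mxE [X in _ + X - _]mxE; ring.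
    rewrite normrM.
    rewrite (le_lt_trans (_ : _ <= `|s| * (1 + M)))//; last by rewrite -ltr_pdivlMr// ltr_wpDr.
    rewrite ler_wpM2l// -[leLHS]add0r lerD// /M (bigD1 k)//= /d !mxE lerDl sumr_ge0//.
  by move=> ik; rewrite /d !mxE ik subrr mulr0 addr0.
move=> /(_ 1); rewrite -(fint_line sigma dA dB p d 1) scale1r.
by rewrite /d addrC subrK.
Qed.

(** Along a line in direction i inside the slice, u has double zeros at lattice
    points, hence vanishes. *)
Lemma slice_zeroS : slice_zero i.+1.
Proof.
move=> t tL.
pose t0 : 'rV[R]_n := \row_k (if k == i then a 0 i else t 0 k).
have tE : t = t0 + (t 0 i - a 0 i) *: v.
  apply/rowP => k; rewrite !mxE/=; case: eqP => [->|_]; last by rewrite mulr0 addr0.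
  by rewrite mulr1 addrC subrK.
have lineL (c : int) : forall k : 'I_n, (i <= k)%N ->
    exists m : int, (t0 + (c%:~R * tau 0 i) *: v) 0 k = a 0 k + tau 0 k * m%:~R.
  move=> k ik; rewrite !mxE/=; case: eqP => [->|/eqP ki].
    by exists c; rewrite mulr1 mulrC.
  have [|m mE] := tL k; first by rewrite ltn_neqAle eq_sym ki.
  by exists m; rewrite mE mulr0 addr0.
pose P := 2 * pi / tau 0 i.
have P0 : 0 < P by rewrite divr_gt0// mulr_gt0// pi_gt0.
have tauP : tau 0 i * P = 2 * pi by rewrite /P mulrC divfK// gt_eqF.
have sP : sigma <= P by rewrite ler_pdivlMr// mulrC -ler_pdivlMr.
have yP (x : 'rV[R]_n) : cube sigma x -> `|dotrv x v| <= P by move=> cx; rewrite (le_trans (yle cx)).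
have y_ae : {ae lam, forall x, cube sigma x -> 0 < `|dotrv x v| < P}.
  pose H c := cube sigma `&` [set x : 'rV[R]_n | x 0 i = c].
  have mH c : measurable (H c).
    apply: measurableI => //; rewrite -[X in measurable X]setTI.
    exact: (measurable_coord_rV i measurableT (measurable_set1 c)).
  have H0 c : lam (H c) = 0%E by rewrite /H cubeE; exact: box_hyperplane_null.
  have U0 X Y : measurable X -> measurable Y -> lam X = 0%E -> lam Y = 0%E -> lam (X `|` Y) = 0%E.
    move=> mX mY X0 Y0; apply/eqP; rewrite -measure_le0.
    by rewrite (le_trans (measureU2 _ mX mY))// [X in (X + _)%E]X0 add0e [leLHS]Y0.
  exists (H 0 `|` (H P `|` H (- P))); split.
  - by apply: measurableU => //; exact: measurableU.
  - exact: (U0 _ _ (mH 0) (measurableU _ _ (mH P) (mH (- P))) (H0 0)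
      (U0 _ _ (mH P) (mH (- P)) (H0 P) (H0 (- P)))).
  move=> x /= /not_implyP[cx]; rewrite dotv => xP.
  have := yP x cx; rewrite dotv => xle.
  have [x0|x0] := eqVneq (x 0 i) 0; first by left.
  right; have : `|x 0 i| = P.
    apply/eqP; rewrite eq_le xle/= leNgt; apply/negP => h; apply: xP.
    by rewrite normr_gt0 x0 h.
  by move=> E; case: (ger0P (x 0 i)) E => _ E; [left|right; split => //=]; rewrite -?E ?opprK.
have [m1 m2 b1 b2] := weight_bounds t0 mA mB AC BC.
rewrite tE fint_line.
apply: (osc_double_zeros mcube cubeoo (@measurable_dotrv R n (cube sigma) v) P0 tauP yP y_ae m1 m2 b1 b2).
  move=> j k; rewrite -(fint_line sigma A B t0 v); apply: Zi.
  by have := lineL (j%:Z - k%:Z); rewrite intrB -!pmulrn.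
move=> j k.
have := derivative_zero (lineL (j%:Z - k%:Z)); rewrite intrB -!pmulrn fint_line => E.
rewrite -[RHS]E; apply: eq_Rintegral => x _; rewrite /cosw /sinw /dA /dB; ring.
Qed.

End step.

Lemma fint_eq0 t : u t = 0.
Proof.
have Z j : (j <= n)%N -> slice_zero j.
  elim: j => [_|j IH jn]; first exact: slice_zero0.
  exact: (@slice_zeroS (Ordinal jn) (IH (ltnW jn))).
by apply: (Z n (leqnn n)) => k; rewrite leqNgt ltn_ord.
Qed.

End chain.

(** * Characteristic functions agreeing off a cube *)

Section charfun_parts.
Variables (R : realType) (n : nat) (m : probability 'rV[R]_n R).

Lemma Re_charfun x : complex.Re (charfun m x) = cchar m x.
Proof. by apply: eq_Rintegral => t _; rewrite /= cosN. Qed.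

Lemma Im_charfun x : complex.Im (charfun m x) = - schar m x.
Proof.
have moo : (m setT < +oo)%E by rewrite probability_setT ltry.
rewrite /schar -mulN1r -RintegralZl//.
  by apply: eq_Rintegral => t _; rewrite /= sinN mulN1r.
apply: (bounded_integrable measurableT moo (M := 1)).
  apply: measurableT_comp; first by apply: continuous_measurable_fun; exact: continuous_sin.
  rewrite (_ : dotrv x = (fun t => dotrv t x)); first exact: measurable_dotrv.
  by apply/funext => t; exact: dotrvC.
by move=> t _; rewrite ler_norml sin_geN1 sin_le1.
Qed.

Lemma cchar0 : cchar m 0 = 1.
Proof.
have E : fine (m setT) = 1 := congr1 fine (probability_setT m).
transitivity (\int[m]_t (cst 1 t : R)).
  apply: eq_Rintegral => t _; rewrite (_ : dotrv 0 t = 0) ?cos0//.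
  by rewrite /dotrv big1// => k _; rewrite mxE mul0r.
by rewrite (Rintegral_cst m)// mul1r E.
Qed.

Lemma schar0 : schar m 0 = 0.
Proof.
transitivity (\int[m]_t (cst 0 t : R)).
  apply: eq_Rintegral => t _; rewrite (_ : dotrv 0 t = 0) ?sin0//.
  by rewrite /dotrv big1// => k _; rewrite mxE mul0r.
by rewrite (Rintegral_cst m)// mul0r.
Qed.

End charfun_parts.

(** The support being closed, each lattice point has a neighbourhood free of it. *)
Lemma supp_gap (R : realType) n (phi : 'rV[R]_n -> R) p : ~ supp phi p ->
  exists2 r, 0 < r & forall y : 'rV[R]_n, (forall k, `|y 0 k - p 0 k| < r) -> phi y = 0.
Proof.
move=> /existsNP[U /not_implyP[/nbhs_ballP[r /= r0 rU] UN]]; exists r => // y yp.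
apply/eqP; apply: contrapT => phiy; apply: UN; exists y; split; first exact/negP.
by apply: rU; split => // i k; rewrite ord1 /ball /= distrC.
Qed.

Unset Implicit Arguments.
Set Strict Implicit.

Theorem theorem1p2 (R : realType) (n : nat) (sigma : R)
    (f : 'rV[R]_n -> R[i]) (mu : probability 'rV[R]_n R)
    (mu_ac mu_s : {measure set 'rV[R]_n -> \bar R}) (phi : 'rV[R]_n -> R)
    (n_ge1 : (1 <= n)%N) (sigma_gt0 : 0 < sigma)
    (f_charfun : forall x, f x = charfun mu x)
    (mu_decomposition : lebesgue_decomposition mu mu_ac mu_s)
    (mu_ac_neq0 : exists2 A, measurable A & mu_ac A <> 0%E)
    (mu_ac_density : has_density mu_ac phi)
    (phi_continuous : continuous phi)
    (gaps : exists a tau : 'rV[R]_n,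
      [/\ forall k, 0 < tau 0 k,
          forall k, tau 0 k <= 2 * pi / sigma &
          supp phi `&` shifted_lattice a tau = set0]) :
  sigma_deterministic sigma f.
Proof.
move=> [g [[nu gE] gf fg]]; apply: gf => x.
have [a [tau [tau_gt0 tau_le gap]]] := gaps.
have fgE y : ~ cube sigma y -> charfun mu y = charfun nu y.
  by move=> cy; rewrite -f_charfun -gE; exact: fg.
have cdiff_cube y : ~ cube sigma y -> cdiff mu nu y = 0.
  by move=> cy; rewrite /cdiff -!Re_charfun fgE// subrr.
have sdiff_cube y : ~ cube sigma y -> sdiff mu nu y = 0.
  move=> cy; rewrite /sdiff -[schar mu y]opprK -[schar nu y]opprK -!Im_charfun.
  by rewrite fgE// subrr.
have neg p : shifted_lattice a tau p -> exists2 r, 0 < r &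
    forall y : 'rV[R]_n, (forall k, `|y 0 k - p 0 k| < r) -> density_diff sigma mu nu y <= 0.
  move=> pL; have [|r r0 phi0] := @supp_gap R n phi p.
    by move=> sp; have : (supp phi `&` shifted_lattice a tau) p by []; rewrite gap.
  have near_p (y : 'rV[R]_n) : obox (\row_k (p 0 k - r)) (\row_k (p 0 k + r)) y <->
      forall k, `|y 0 k - p 0 k| < r.
    by split=> h k; have := h k; rewrite !mxE ltr_distl.
  exists r => // y /near_p yp.
  exact: (density_diff_le0 cdiff_cube sdiff_cube mu_decomposition mu_ac_density
    (fun z zb => phi0 z ((near_p z).1 zb)) yp).
have u0 := fint_eq0 sigma_gt0 (@continuous_cdiff _ _ mu nu) (@continuous_sdiff _ _ mu nu)
  cdiff_cube sdiff_cube (etrans (congr2 _ (cchar0 mu) (congr1 _ (cchar0 nu))) (subrr 1))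
  (etrans (congr2 _ (schar0 mu) (congr1 _ (schar0 nu))) (subrr 0))
  (fun y _ => norm_cdiff_le mu nu y) (fun y _ => norm_sdiff_le mu nu y) tau_gt0 tau_le neg.
have mu_nu := density_diff_eq0 cdiff_cube sdiff_cube u0.
rewrite gE f_charfun /charfun /cintegral /Rintegral.
by congr (fine _ +i* fine _)%C; apply: eq_measure_integral => A mA _; exact: esym (mu_nu A mA).
Qed.
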